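(* Let $T>0$, let $G=(G_t)_{t\in[0,T]}$ be a continuous centered Gaussian process with continuous covariance function $R(t,s)=\mathbb E[G_tG_s]$, with associated Hilbert space $\mathfrak H$, and let $\mathcal V_{[0,T]}$ be the set of functions of bounded variation on $[0,T]$. Then $\mathcal V_{[0,T]}$ is dense in $\mathfrak H$ and $$\langle f,g\rangle_{\mathfrak H}=\int_{[0,T]^2}R(t,s)\,\nu_f(\mathrm dt)\,\nu_g(\mathrm ds),\qquad\forall f,g\in\mathcal V_{[0,T]}.$$ Furthermore, if $R$ satisfies Hypothesis (A) described in the context with parameter $H\in(0,\frac12)\cup(\frac12,1)$ and constant $C_H'$, then for all $f,g\in\mathcal V_{[0,T]}$, $$\langle f,g\rangle_{\mathfrak H}=-\int_{[0,T]^2}f(t)\,\frac{\partial R(t,s)}{\partial t}\,\mathrm dt\,\nu_g(\mathrm ds)$$ and $$\big|\langle f,g\rangle_{\mathfrak H}-\langle f,g\rangle_{\mathfrak H_1}\big|\le\langle f,g\rangle_{\mathfrak H_2}.$$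
   Context: $\mathfrak H$ is the closure of the space of real-valued step functions on $[0,T]$ under the inner product $\langle\mathbf 1_{[a,b)},\mathbf 1_{[c,d)}\rangle_{\mathfrak H}=\mathbb E[(G_b-G_a)(G_d-G_c)]$. For $g\in\mathcal V_{[0,T]}$, $\nu_g$ is the restriction to $([0,T],\mathcal B([0,T]))$ of the Lebesgue–Stieltjes signed measure on $\mathbb R$ associated with $g^0$, where $g^0(x)=g(x)$ for $x\in[0,T)$ and $g^0(x)=0$ otherwise (e.g. $\nu_{\mathbf 1_{[a,b)}}=\delta_a-\delta_b$). $R^B(t,s)=\frac12(t^{2H}+s^{2H}-|t-s|^{2H})$ is the covariance function of fractional Brownian motion. For $f,g\in\mathcal V_{[0,T]}$, $$\langle f,g\rangle_{\mathfrak H_1}=-\int_{[0,T]^2}f(t)\frac{\partial R^B(t,s)}{\partial t}\,\mathrm dt\,\nu_g(\mathrm ds),\qquad \langle f,g\rangle_{\mathfrak H_2}=C_H'\int_{[0,T]^2}|f(t)g(s)|(ts)^{H-1}\,\mathrm dt\,\mathrm ds.$$ Hypothesis (A). There is a constant $C_H'\ge0$ (not depending on $T$) such that: (1) $R(0,s)=0$ for all $s\ge0$; (2) for each fixed $s\in(0,T)$, $t\mapsto R(t,s)$ is continuous on $[0,T]$ and differentiable on $(0,s)\cup(s,T)$, with $\frac{\partial}{\partial t}R(t,s)$ absolutely integrable in $t$; (3) for each fixed $t\in(0,T)$, the difference $\frac{\partial R(t,s)}{\partial t}-\frac{\partial R^B(t,s)}{\partial t}$, as a function of $s$, is (extends across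 $s=t$ to) a continuous function on $[0,T]$, differentiable in $s\in(0,T)$, and its partial derivative with respect to $s$, denoted $\Psi(t,s)$, satisfies $|\Psi(t,s)|\le C_H'|ts|^{H-1}$. *)

(* Defs.v *)
From HB Require Import structures.
From mathcomp Require Import all_boot all_order all_algebra.
From mathcomp Require Import all_classical all_reals all_analysis.

Set Implicit Arguments.
Unset Strict Implicit.
Unset Printing Implicit Defensive.

Import Order.TTheory GRing.Theory Num.Theory.
Import numFieldNormedType.Exports.

Local Open Scope classical_set_scope.
Local Open Scope ring_scope.

Section charge_integrals.
Context d1 d2 (T1 : measurableType d1) (T2 : measurableType d2) (R : realType).

Lemma hahn_pair d (T : measurableType d) (nu : {charge set T -> \bar R}) :
  exists PN : set T * set T, hahn_decomposition nu PN.1 PN.2.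
Proof. by have [P [N nuPN]] := Hahn_decomposition nu; exists (P, N). Qed.

(* The Jordan decomposition does not depend on the chosen Hahn decomposition
   (Hahn_decomposition_uniq). *)
Definition charge_pos d (T : measurableType d) (nu : {charge set T -> \bar R})
    : {finite_measure set T -> \bar R} :=
  jordan_pos (projT2 (cid (hahn_pair nu))).

Definition charge_neg d (T : measurableType d) (nu : {charge set T -> \bar R})
    : {finite_measure set T -> \bar R} :=
  jordan_neg (projT2 (cid (hahn_pair nu))).

Local Open Scope ereal_scope.

(* Since +oo - +oo = -oo in \bar R, the two integrals below can only take a
   finite value if the integrand is absolutely integrable. *)

Definition integral_measure_charge (m : {measure set T1 -> \bar R})
    (nu : {charge set T2 -> \bar R}) (D : set (T1 * T2))
    (F : T1 * T2 -> \bar R) : \bar R :=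
  \int[m \x charge_pos nu]_(p in D) F p - \int[m \x charge_neg nu]_(p in D) F p.

Definition integral_charge_charge (mu : {charge set T1 -> \bar R})
    (nu : {charge set T2 -> \bar R}) (D : set (T1 * T2))
    (F : T1 * T2 -> \bar R) : \bar R :=
  integral_measure_charge (charge_pos mu) nu D F
  - integral_measure_charge (charge_neg mu) nu D F.

End charge_integrals.

Section stieltjes.
Context {R : realType}.
Implicit Types (F g : R -> R) (T : R).

(* F need not be right-continuous, hence the right limits. *)
Definition is_stieltjes F (nu : {charge set (measurableTypeR R) -> \bar R}) :=
  forall a b : R, a <= b ->
    nu `]a, b]%classic = (lim (F x @[x --> b^'+]) - lim (F x @[x --> a^'+]))%:E.

(* The condition is_stieltjes F determines the charge; czero is only a default
   for functions F without Lebesgue-Stieltjes charge. *)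
Definition stieltjes_charge F : {charge set (measurableTypeR R) -> \bar R} :=
  if pselect (exists nu, is_stieltjes F nu) is left h then projT1 (cid h)
  else czero.

Definition ext0 T g : R -> R := fun x => if 0 <= x < T then g x else 0.

(* This charge lives on R; the restriction to [0, T] is made by the domains of
   integration. *)
Definition nu_ T g : {charge set (measurableTypeR R) -> \bar R} :=
  stieltjes_charge (ext0 T g).

Definition square T : set (measurableTypeR R * measurableTypeR R) :=
  `[0, T]%classic `*` `[0, T]%classic.

End stieltjes.

Section gaussian_process.
Context d (Omega : measurableType d) (R : realType) (P : probability Omega R).
Implicit Types (T : R) (G : R -> {RV P >-> R}).

(* normal_prob m 0 is a dummy value, not the Dirac mass. *)
Definition gaussian_law (m s : R) : set R -> \bar R :=
  if s == 0 then \d_m else normal_prob m s.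

Definition gaussian_variable (X : Omega -> R) :=
  exists m s : R, 0 <= s /\
    forall A : set R, measurable A -> P (X @^-1` A) = gaussian_law m s A.

Definition gaussian_process T G :=
  forall (n : nat) (c t : 'I_n -> R), (forall i, 0 <= t i <= T) ->
    gaussian_variable (fun w => \sum_(i < n) c i * G (t i) w).

Definition centered_process T G :=
  forall t, 0 <= t <= T -> ('E_P[G t] = 0)%E.

Definition continuous_process T G :=
  {ae P, forall w, {within `[0, T], continuous (fun t => G t w)}}.

Definition cov_fun G (t s : R) : R := fine 'E_P[(fun w => G t w * G s w)%R]%E.

End gaussian_process.

Section hilbert_space.
Context d (Omega : measurableType d) (R : realType) (P : probability Omega R).
Context (E : completeNormedModType R).
Implicit Types (T : R) (G : R -> {RV P >-> R}) (ip : E -> E -> R).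
Implicit Types (iota : (R -> R) -> E) (f g : R -> R).

Definition step_fun T f :=
  exists (n : nat) (c a b : 'I_n -> R),
    (forall i, [/\ 0 <= a i, a i <= b i & b i <= T]) /\
    f = (fun x => \sum_(i < n) c i * \1_(`[a i, b i[) x).

Record inner_product ip : Prop := {
  ip_sym : forall u v, ip u v = ip v u ;
  ip_linear : forall (k : R) u v w, ip (k *: u + v) w = k * ip u w + ip v w ;
  ip_norm : forall u, ip u u = `|u| ^+ 2 }.

(* E, with the canonical map iota from step functions, is the Hilbert space
   associated with G: the completion of the step functions for the
   (semi-)inner product given on indicators by the increments of G. Only the
   values of iota on step functions are constrained. *)
Record associated_hilbert T G ip iota : Prop := {
  ah_inner : inner_product ip ;
  ah_linear : forall (k : R) f g, step_fun T f -> step_fun T g ->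
    iota (fun x => k * f x + g x) = k *: iota f + iota g ;
  ah_indic : forall a b c e : R, 0 <= a <= b -> b <= T -> 0 <= c <= e -> e <= T ->
    ((ip (iota \1_(`[a, b[)) (iota \1_(`[c, e[)))%:E =
    'E_P[(fun w => (G b w - G a w) * (G e w - G c w))%R])%E ;
  ah_dense : closure [set iota f | f in step_fun T] = setT }.

(* T is left out because step functions vanish there; nu_ T f and the elements
   of the Hilbert space do not see the value of f at T either. *)
Definition bv_approx T (u : nat -> R -> R) f :=
  [/\ forall n, step_fun T (u n),
      exists M : R, forall n, (total_variation 0 T (u n) <= M%:E)%E &
      forall t, 0 <= t < T -> u n t @[n --> \oo] --> f t].

(* h is the element of the Hilbert space with which the function f is
   identified; it is unique, and it is iota f when f is a step function. *)
Definition represents T iota f (h : E) :=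
  (exists u, bv_approx T u f) /\
  forall u, bv_approx T u f -> iota (u n) @[n --> \oo] --> h.

End hilbert_space.

Section hypothesis_A.
Context {R : realType}.
Implicit Types (H C T t s : R) (K : R -> R -> R) (f g : R -> R).

Definition covB H t s : R :=
  2^-1 * (t `^ (2 * H) + s `^ (2 * H) - `|t - s| `^ (2 * H)).

(* The partial derivative in the first variable on (0, T), set to 0 on the
   diagonal and for t outside (0, T); these t form a null set for each s. *)
Definition pderiv1 T K t s : R :=
  if (0 < t < T) && (t != s) then derive1 (fun u => K u s) t else 0.

Record hypothesis_A H C T K : Prop := {
  hA_const : 0 <= C ;
  hA_zero : forall s, 0 <= s <= T -> K 0 s = 0 ;
  hA_cont : forall s, 0 < s < T ->
    {within `[0, T], continuous (fun t => K t s)} ;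
  hA_derivable : forall s t, 0 < s < T -> 0 < t < T -> t != s ->
    derivable (fun u => K u s) t 1 ;
  hA_integrable : forall s, 0 < s < T ->
    lebesgue_measure.-integrable `[0, T] (fun t => (pderiv1 T K t s)%:E) ;
  (* D is the difference of the partial derivatives, extended to s = t; that
     it is a function on [0, T] includes the existence of the derivative of
     K at the points (t, 0) and (t, T). *)
  hA_diff : forall t, 0 < t < T -> exists D : R -> R,
    [/\ forall s, 0 <= s <= T -> s != t ->
          derivable (fun u => K u s) t 1 /\
          D s = pderiv1 T K t s - pderiv1 T (covB H) t s,
        {within `[0, T], continuous D} &
        forall s, 0 < s < T ->
          derivable D s 1 /\ `|derive1 D s| <= C * `|t * s| `^ (H - 1)] }.

Local Open Scope ereal_scope.

Definition inner_dt_nu T K f g : \bar R :=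
  - integral_measure_charge lebesgue_measure (nu_ T g) (square T)
      (fun p => (f p.1 * pderiv1 T K p.1 p.2)%:E).

Definition inner1 H T f g : \bar R := inner_dt_nu T (covB H) f g.

Definition inner2 H C T f g : \bar R :=
  C%:E * \int[lebesgue_measure \x lebesgue_measure]_(p in square T)
    (`|f p.1 * g p.2| * (p.1 * p.2) `^ (H - 1))%:E.

End hypothesis_A.

(* Main.v *)
Require Import Defs.
From HB Require Import structures.
From mathcomp Require Import all_boot all_order all_algebra.
From mathcomp Require Import all_classical all_reals all_analysis.
From mathcomp Require Import measurable_realfun ring lra.

(** Step functions embed in the Hilbert space, and the squared norm of a step
    function u is obtained by applying to the covariance, in each variable,
    the functional [is_step_functional] of u: phi is sent to the sum of the
    c_i (phi a_i - phi b_i), the integral of phi against the charge of u.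

    The whole proof rests on one weak convergence statement,
    [step_functional_cvg]. If step functions u_n of uniformly bounded variation
    converge pointwise to f on [0, T[, their functionals converge, on every
    continuous function, to the integral against the charge of f: on a fine
    grid whose nodes avoid the countably many discontinuities of f, both are
    close, uniformly in n, to sums of increments over the cells. The same
    uniformity shows that such u_n form a Cauchy sequence in the Hilbert space
    and that its limit depends on f only ([bv_approx_close]). Since every f of
    bounded variation has such an approximation ([bv_approx_exists]), it
    represents an element of the space, and taking limits in one variable,
    then in the other, turns the inner product into the double integral of the
    covariance against the two charges ([ip_represents]). Density is inherited
    from the step functions, which represent their own images.

    Under Hypothesis (A), the bound on the mixed derivative and the vanishing
    of the covariances on the axes bound the difference of the two partial
    derivatives by a multiple of t ^ (H - 1) ([pderiv1_difference_le]). Together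
    with the explicit derivative for fractional Brownian motion, this dominates
    the partial derivative of R by a function of t that is integrable uniformly
    in s. Hence R( . , s) is absolutely continuous ([kernel_section_density],
    from a fundamental theorem of calculus for dominated derivatives), and
    integration by parts against the charge of f ([charge_integral_by_parts]),
    followed by Fubini's theorem, gives the formula with the partial derivative.

    For the comparison, the difference of the two inner products is minus the
    integral of f(t) times the difference of the partial derivatives against
    dt nu_g(ds). In the opposite order of integration, at a fixed t that is not
    an atom of nu_g, that difference extends continuously in s and integration
    by parts against nu_g replaces it by its derivative in s, which is at most
    C (t s) ^ (H - 1) in absolute value ([section_difference_le]). *)

Set Implicit Arguments.
Unset Strict Implicit.
Unset Printing Implicit Defensive.

Import Order.TTheory GRing.Theory Num.Theory.
Import numFieldNormedType.Exports.

Local Open Scope classical_set_scope.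
Local Open Scope ring_scope.

(** * Step functions and their functionals *)

Section step_functional.
Context {R : realType}.
Implicit Types (T : R) (u v f phi psi : R -> R) (L : (R -> R) -> R).

(** L is integration against the charge of u, a combination of Dirac masses.
    It is a relation because the decomposition of u into indicators is not
    unique. *)
Definition is_step_functional T u L := exists (n : nat) (c a b : 'I_n -> R),
  [/\ forall i, [/\ 0 <= a i, a i <= b i & b i <= T],
      u = (fun x => \sum_(i < n) c i * \1_(`[a i, b i[) x) &
      L = (fun phi => \sum_(i < n) c i * (phi (a i) - phi (b i)))].

Lemma step_functional_exists T u : step_fun T u ->
  exists L, is_step_functional T u L.
Proof.
move=> [n [c [a [b [h ->]]]]].
exists (fun phi => \sum_(i < n) c i * (phi (a i) - phi (b i))).
by exists n, c, a, b; split.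
Qed.

Lemma step_functional_step T u L : is_step_functional T u L -> step_fun T u.
Proof. by move=> [n [c [a [b [h -> _]]]]]; exists n, c, a, b. Qed.

Lemma indic_itvco (a b x : R) : \1_(`[a, b[) x = (a <= x < b)%R%:R :> R.
Proof. by rewrite indicE mem_setE in_itv. Qed.

Lemma indic_itvoc (a b x : R) : \1_(`]a, b]) x = (a < x <= b)%R%:R :> R.
Proof. by rewrite indicE mem_setE in_itv. Qed.

Section facts.
Variables (T : R) (u : R -> R) (L : (R -> R) -> R).
Hypothesis uL : is_step_functional T u L.

Lemma step_functionalD phi psi : L (phi \+ psi) = L phi + L psi.
Proof.
have [n [c [a [b [h _ ->]]]]] := uL; rewrite -big_split; apply: eq_bigr => i _ /=.
by ring.
Qed.

Lemma step_functionalZ k phi : L (fun x => k * phi x) = k * L phi.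
Proof.
have [n [c [a [b [h _ ->]]]]] := uL; rewrite big_distrr; apply: eq_bigr => i _ /=.
by ring.
Qed.

Lemma step_functionalB phi psi : L (fun x => phi x - psi x) = L phi - L psi.
Proof.
have -> : (fun x => phi x - psi x) = phi \+ (fun x => (-1) * psi x).
  by apply/funext => x /=; rewrite mulN1r.
by rewrite step_functionalD step_functionalZ mulN1r.
Qed.

Lemma step_functional_sum (I : Type) (r : seq I) (F : I -> R -> R) :
  L (fun x => \sum_(i <- r) F i x) = \sum_(i <- r) L (F i).
Proof.
have [n [c [a [b [h _ ->]]]]] := uL; rewrite exchange_big; apply: eq_bigr => i _ /=.
by rewrite -sumrB big_distrr/=.
Qed.

Lemma step_fun_out t : ~~ (0 <= t < T) -> u t = 0.
Proof.
have [n [c [a [b [h -> _]]]]] := uL => tT; apply: big1 => i _.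
have [a0 ab bT] := h i; rewrite indic_itvco.
have [/andP[h1 h2]|_] := boolP (a i <= t < b i); last by rewrite mulr0.
by move: tT; rewrite (le_trans a0 h1) (lt_le_trans h2 bT).
Qed.

Lemma step_functional_indic x y : x <= y -> L \1_(`]x, y]) = u y - u x.
Proof.
have [n [c [a [b [h -> ->]]]]] := uL => xy; rewrite -sumrB; apply: eq_bigr => i _.
have [a0 ab bT] := h i; rewrite -mulrBr; congr (_ * _).
rewrite !indic_itvoc !indic_itvco.
have [h1|h1] := ltP x (a i); have [h2|h2] := leP (a i) y; have [h3|h3] := ltP x (b i);
 have [h4|h4] := leP (b i) y; rewrite /= ?subrr ?subr0 ?sub0r //; exfalso; lra.
Qed.

End facts.

Lemma le_last_path (x : R) (s : seq R) (y : R) :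
  path <%R x s -> y \in x :: s -> y <= last x s.
Proof.
elim/last_ind: s => [|s z IH]; first by rewrite inE => _ /eqP ->.
rewrite rcons_path last_rcons -rcons_cons mem_rcons in_cons => /andP[p lz].
by move=> /predU1P[->//|/(IH p)] yl; apply: ltW; exact: le_lt_trans lz.
Qed.

(** The increments over the cells from a on telescope, a being a node. *)
Lemma sum_increments_from (phi : R -> R) (x : R) (s : seq R) (d a : R) :
  path <%R x s -> a \in x :: s ->
  \sum_(0 <= k < size s) (a <= nth d (x :: s) k)%R%:R *
    (phi (nth d (x :: s) k.+1) - phi (nth d (x :: s) k)) = phi (last x s) - phi a.
Proof.
elim: s x a => [|y s IH] x a /=.
  by move=> _; rewrite inE => /eqP ->; rewrite big_nil subrr.
move=> /andP[xy ys] axs; rewrite big_nat_recl//=.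
have ylt k : (k < size s)%N -> y <= nth d (y :: s) k.
  case: k => //= k ks; apply/ltW; move: ys; rewrite path_sortedE; last exact: lt_trans.
  by move=> /andP[/allP h _]; apply: h; rewrite mem_nth// ltnW.
move: axs; rewrite in_cons => /predU1P[->|ays].
  rewrite lexx mul1r.
  rewrite (_ : \sum_(0 <= i < size s) _ = phi (last y s) - phi y); first by ring.
  rewrite -IH ?mem_head//; apply: eq_big_nat => k /andP[_ ks].
  by rewrite !(le_trans _ (ylt k ks))// ltW.
have xa : x < a.
  move: ays; rewrite in_cons => /predU1P[-> //|].
  move: ys; rewrite path_sortedE; last exact: lt_trans.
  by move=> /andP[/allP h _] /h; exact: lt_trans.
by rewrite leNgt xa mul0r add0r IH.
Qed.

Lemma partition_through T (l : seq R) : 0 < T -> (forall x, x \in l -> 0 <= x <= T) ->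
  exists s, itv_partition 0 T s /\ {subset l <= 0 :: s}.
Proof.
move=> T0 lT.
pose s := sort <=%R (undup [seq x <- T :: l | 0 < x]).
have mems x : (x \in s) = (0 < x) && ((x == T) || (x \in l)).
  by rewrite mem_sort mem_undup mem_filter in_cons.
have pth : path <%R 0 s.
  rewrite path_sortedE; last exact: lt_trans.
  rewrite sort_lt_sorted// undup_uniq andbT.
  by apply/allP => x; rewrite mems => /andP[].
have lastT : last 0 s = T.
  apply/eqP; rewrite eq_le; apply/andP; split.
    have : last 0 s \in 0 :: s by exact: mem_last.
    rewrite in_cons mems => /predU1P[->|/andP[_ /orP[/eqP ->//|/lT/andP[]//]]].
    exact: ltW.
  by apply: le_last_path => //; rewrite in_cons mems T0 eqxx orbT.
exists s; split; first by split; rewrite ?lastT.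
move=> x xl; rewrite in_cons mems xl orbT andbT.
by have /andP[] := lT x xl; rewrite le_eqVlt eq_sym.
Qed.

(** On a common refinement of the jump points the increments of phi telescope
    over each interval, so that only the values of u at the nodes remain. *)
Lemma step_functional_partition T u L : 0 < T -> is_step_functional T u L ->
  exists s, itv_partition 0 T s /\
  forall phi, L phi = \sum_(0 <= k < size s) u (nth T (0 :: s) k) *
     (phi (nth T (0 :: s) k) - phi (nth T (0 :: s) k.+1)).
Proof.
move=> T0 [n [c [a [b [h -> ->]]]]].
have [|s [sT sub]] := @partition_through T (codom a ++ codom b) T0.
  move=> x; rewrite mem_cat => /orP[/codomP[i ->]|/codomP[i ->]].
  - by have [? ? ?] := h i; lra.
  - by have [? ? ?] := h i; lra.
have [pth /eqP lastT] := sT.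
exists s; split=> //.
have memc i : a i \in 0 :: s /\ b i \in 0 :: s.
  by split; apply: sub; rewrite mem_cat codom_f ?orbT.
move=> phi; under [RHS]eq_bigr do rewrite big_distrl/=.
rewrite exchange_big/=; apply: eq_bigr => i _.
under eq_bigr do rewrite -mulrA; rewrite -big_distrr/=; congr (_ * _).
have [ai bi] := memc i; have [a0 ab bT] := h i.
rewrite -[LHS]opprK opprB.
have -> : phi (b i) - phi (a i) = (phi (last 0 s) - phi (a i)) - (phi (last 0 s) - phi (b i)) by ring.
rewrite -!(sum_increments_from _ T) // -sumrB -sumrN; apply: eq_bigr => k _.
rewrite indic_itvco.
have [h1|h1] := leP (a i) (nth T (0 :: s) k); have [h2|h2] := leP (b i) (nth T (0 :: s) k); rewrite /= ?(mul1r,mul0r); try ring.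
by exfalso; lra.
Qed.

(** Abel summation moves the increments from phi to u; the boundary terms are
    controlled by the variation as well, because u vanishes at T. *)
Lemma step_functional_bound T u L (M e : R) phi : 0 < T ->
  is_step_functional T u L -> (total_variation 0 T u <= M%:E)%E ->
  (forall t, 0 <= t <= T -> `|phi t| <= e) -> `|L phi| <= 2 * M * e.
Proof.
move=> T0 uL uM phie.
have [s [sT ->]] := step_functional_partition T0 uL.
have [ps /eqP ls] := sT.
set y := nth T (0 :: s).
have e0 : 0 <= e by apply: le_trans (normr_ge0 _) (phie 0 _); rewrite lexx ltW.
have yT k : 0 <= y k <= T.
  rewrite /y; have [ks|ks] := ltnP k (size (0 :: s)); last by rewrite nth_default// lexx ltW.
  have := mem_nth T ks; rewrite in_cons => /predU1P[->|]; first by rewrite lexx ltW.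
  move=> m; apply/andP; split.
    by have /allP/(_ _ m)/ltW := order_path_min lt_trans ps.
  by rewrite -[leRHS]ls; apply: le_last_path => //; rewrite in_cons m orbT.
have ysz : y (size s) = T by rewrite /y -[RHS]ls (last_nth T).
have uT : u T = 0 by rewrite (step_fun_out uL)// ltxx andbF.
have var : \sum_(0 <= k < size s) `|u (y k.+1) - u (y k)| <= M.
  rewrite -lee_fin; apply: le_trans uM; apply: ereal_sup_ubound.
  by exists (variation 0 T u s) => //; exact: variations_variation.
have abel : \sum_(0 <= k < size s) u (y k) * (phi (y k) - phi (y k.+1)) =
   u (y 0%N) * phi (y 0%N) - u (y (size s)) * phi (y (size s)) +
   \sum_(0 <= k < size s) (u (y k.+1) - u (y k)) * phi (y k.+1).
  have := telescope_sumr (fun k => u (y k) * phi (y k)) (leq0n (size s)).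
  move=> tel; rewrite -(opprB (u (y (size s)) * _)) -tel -sumrN -big_split/=.
  by apply: eq_bigr => k _; ring.
rewrite abel ysz uT mul0r subr0.
have u0 : `|u (y 0%N)| <= M.
  rewrite -lee_fin; apply: le_trans uM; have := total_variation_ge u (ltW T0).
  by rewrite uT sub0r normrN.
rewrite (le_trans (ler_normD _ _))// mulrDl mul1r mulrDl lerD//.
  by rewrite normrM ler_pM// phie.
apply: (le_trans (ler_norm_sum _ _ _)).
apply: (@le_trans _ _ (\sum_(0 <= k < size s) `|u (y k.+1) - u (y k)| * e)).
  by apply: ler_sum => k _; rewrite normrM ler_wpM2l// phie.
by rewrite -big_distrl/= ler_wpM2r.
Qed.

Lemma step_functional_comb T u v L L' k :
  is_step_functional T u L -> is_step_functional T v L' ->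
  is_step_functional T (fun x => k * u x + v x) (fun phi => k * L phi + L' phi).
Proof.
move=> [n [c [a [b [h -> ->]]]]] [n' [c' [a' [b' [h' -> ->]]]]].
pose mix (f : 'I_n -> R) (g : 'I_n' -> R) (i : 'I_(n + n')) :=
  match fintype.split i with inl j => f j | inr j => g j end.
exists (n + n')%N, (mix (fun i => k * c i) c'), (mix a a'), (mix b b'); split.
- by move=> i; rewrite /mix; case: fintype.split.
- apply/funext => x; rewrite big_split_ord/= big_distrr/=; congr (_ + _); apply: eq_bigr => i _.
    by rewrite /mix (unsplitK (inl i)) mulrA.
  by rewrite /mix (unsplitK (inr i)).
- apply/funext => x; rewrite big_split_ord/= big_distrr/=; congr (_ + _); apply: eq_bigr => i _.
    by rewrite /mix (unsplitK (inl i)) mulrA.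
  by rewrite /mix (unsplitK (inr i)).
Qed.

Lemma step_functional_indicator T a b : 0 <= a -> a <= b -> b <= T ->
  is_step_functional T \1_(`[a, b[) (fun phi => phi a - phi b).
Proof.
move=> a0 ab bT; exists 1%N, (fun=> 1), (fun=> a), (fun=> b); split=> //.
- by apply/funext => x; rewrite big_ord1 mul1r.
- by apply/funext => x; rewrite big_ord1 mul1r.
Qed.

Lemma step_functional0 T : is_step_functional T (fun=> 0) (fun=> 0).
Proof.
exists 0%N, (fun=> 0), (fun=> 0), (fun=> 0); split; first by case.
  by apply/funext => x; rewrite big_ord0.
by apply/funext => x; rewrite big_ord0.
Qed.

End step_functional.

(** * Grids and uniform continuity *)

Section grid.
Context {R : realType}.
Implicit Types (T d e : R) (u f phi : R -> R) (x : nat -> R).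

(** Grids start at -1 so that the first cell ]-1, x_1] carries the atom that
    a function vanishing on ]-oo, 0[ has at 0. *)
Definition is_grid T d (N : nat) x := [/\ x 0%N = -1, x N = T &
  forall i, (i < N)%N -> [/\ x i < x i.+1, 0 < x i.+1 <= T &
    forall t, 0 <= t <= T -> x i < t <= x i.+1 -> `|t - x i.+1| < d]].

Definition grid_fun (N : nat) x phi : R -> R :=
  fun t => \sum_(0 <= i < N) phi (x i.+1) * \1_(`]x i, x i.+1]) t.

Definition grid_sum (N : nat) x f phi : R :=
  \sum_(0 <= i < N) phi (x i.+1) * (f (x i.+1) - f (x i)).

Lemma countable_avoid (B : set R) (a b : R) : countable B -> a < b ->
  exists y, a < y < b /\ ~ B y.
Proof.
move=> cB ab; apply: contrapT => h.
have sub : `]a, b[%classic `<=` B.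
  by move=> y /=; rewrite in_itv/= => yab; apply: contrapT => nB; apply: h; exists y.
have := countable_lebesgue_measure0 (sub_countable (subset_card_le sub) cB).
rewrite lebesgue_measure_itv/= lte_fin ab => /eqP.
by rewrite -EFinB eqe subr_eq0 gt_eqF.
Qed.

(** A countable set, below the discontinuities of a function of bounded
    variation, can be avoided by the interior nodes; 0 is not a node, so that
    the jump there stays inside the first cell. *)
Lemma grid_exists (B : set R) T d : countable B -> 0 < T -> 0 < d ->
  exists N x, is_grid T d N x /\ forall i, (0 < i < N)%N -> ~ B (x i).
Proof.
move=> cB T0 d0.
pose N := (Num.truncn (2 * T / d)).+1.
have Nd : 2 * T / d < N%:R by exact: truncnS_gt.
have N0 : 0 < N%:R :> R by rewrite ltr0n.
pose h := T / N%:R.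
have h0 : 0 < h by rewrite divr_gt0.
have hd : 2 * h < d.
  by rewrite /h mulrA ltr_pdivrMr// [ltRHS]mulrC -ltr_pdivrMr.
have NT : N%:R * h = T by rewrite /h mulrCA divff ?mulr1// gt_eqF.
have pick (i : nat) : {y | i%:R * h < y < i.+1%:R * h /\ ~ B y}.
  apply: cid; apply: countable_avoid => //.
  by rewrite ltr_pM2r// ltr_nat.
pose x i := if i is i'.+1 then (if (i < N)%N then sval (pick i') else T) else -1.
have xub i : (i < N)%N -> x i.+1 <= i.+1%:R * h.
  move=> iN; rewrite /x; case: ifPn => [iN'|].
    by case: (pick i) => y /= [/andP[_ /ltW]].
  by rewrite -leqNgt => Ni; rewrite -NT ler_pM2r// ler_nat.
have xlb i : (i < N)%N -> i%:R * h < x i.+1.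
  move=> iN; rewrite /x; case: ifPn => [iN'|].
    by case: (pick i) => y /= [/andP[]].
  by rewrite -leqNgt => Ni; rewrite -NT ltr_pM2r// ltr_nat.
exists N, x; split; last first.
  move=> [//|i] /= iN; rewrite iN; by case: (pick i) => y /= [].
split => //; first by rewrite /x ltnn.
have xS i : (i < N)%N -> x i < x i.+1.
  case: i => [|i] iN; last by apply: le_lt_trans (xlb _ iN); exact/xub/ltnW.
  by rewrite (lt_trans _ (xlb _ iN))// mul0r ltrN10.
move=> i iN; split; first exact: xS.
  apply/andP; split; first by apply: le_lt_trans (xlb _ iN); rewrite mulr_ge0// ltW.
  by apply: (le_trans (xub _ iN)); rewrite -NT ler_pM2r// ler_nat.
move=> t /andP[t0 tT] /andP[xit txi].
rewrite ler0_norm ?subr_le0// opprB ltrBlDr.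
apply: (le_lt_trans (xub _ iN)).
case: i iN xit txi => [|i] iN xit txi.
  by rewrite mul1r; lra.
have := xlb _ (ltnW iN); rewrite -[i.+2%:R]natr1 -[i.+1%:R]natr1 => xl.
by rewrite !mulrDl mul1r; lra.
Qed.

Lemma grid_fun_close T d N x (phi : R -> R) e : is_grid T d N x ->
  (forall s t, 0 <= s <= T -> 0 <= t <= T -> `|s - t| < d -> `|phi s - phi t| <= e) ->
  forall t, 0 <= t <= T -> `|phi t - grid_fun N x phi t| <= e.
Proof.
move=> [x0 xN gx] unif t tT.
have [i [iN ti]] : exists i, (i < N)%N /\ x i < t <= x i.+1.
  have [m [mN tm]] : exists m, (m <= N)%N /\ t <= x m.
    by exists N; rewrite leqnn xN; case/andP: tT.
  elim: m mN tm => [|m IH] mN tm.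
    by move: tT; rewrite x0 in tm; move=> /andP[t0 _]; exfalso; lra.
  have [tm'|tm'] := leP t (x m); first by apply: IH => //; exact: ltnW.
  by exists m; split => //; rewrite tm' tm.
have [xi xiT mesh] := gx i iN.
have mono j k : (j <= k <= N)%N -> x j <= x k.
  elim: k => [|k IH]; first by rewrite leqn0 => /andP[/eqP -> //].
  rewrite leq_eqVlt => /andP[/predU1P[->//|jk] kN].
  apply: (le_trans (IH _)); first by rewrite -ltnS jk ltnW.
  by have [/ltW] := gx k kN.
have -> : grid_fun N x phi t = phi (x i.+1).
  rewrite /grid_fun big_mkord (bigD1 (Ordinal iN))//= indic_itvoc ti mulr1.
  rewrite big1 ?addr0// => j ji; rewrite indic_itvoc.
  rewrite (_ : (_ && _) = false) ?mulr0//; apply/negbTE; apply/negP => /andP[h1 h2].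
  have : (j < i)%N || (i < j)%N by rewrite -neq_ltn.
  move=> /orP[ij|ij].
    have := mono j.+1 i; rewrite ij ltnW// => /(_ isT); case/andP: ti => *; lra.
  have := mono i.+1 j; rewrite ij ltnW// => /(_ isT); case/andP: ti => *; lra.
apply: unif => //; last exact: mesh.
by have /andP[/ltW -> ->] := xiT.
Qed.

Lemma step_functional_grid T d N x u L phi : is_grid T d N x ->
  is_step_functional T u L -> L (grid_fun N x phi) = grid_sum N x u phi.
Proof.
move=> [x0 xN gx] uL.
rewrite /grid_fun (step_functional_sum uL)/=; apply: eq_big_nat => i /andP[_ iN].
have [xi _ _] := gx i iN.
by rewrite (step_functionalZ uL) (step_functional_indic uL)// ltW.
Qed.

(** A uniform approximation of the integrand costs at most the variation of
    the step function, whatever the number of its jumps. *)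
Lemma step_functional_near_grid T d N x u L phi (M e : R) : 0 < T -> is_grid T d N x ->
  is_step_functional T u L -> (total_variation 0 T u <= M%:E)%E ->
  (forall s t, 0 <= s <= T -> 0 <= t <= T -> `|s - t| < d -> `|phi s - phi t| <= e) ->
  `|L phi - grid_sum N x u phi| <= 2 * M * e.
Proof.
move=> T0 gx uL uM unif.
rewrite -(step_functional_grid phi gx uL) -(step_functionalB uL).
apply: step_functional_bound uL uM _ => //.
exact: grid_fun_close gx unif.
Qed.

End grid.

Section heine.
Context {R : realType}.

(** Heine's theorem, for a function continuous on a compact set only. *)
Lemma compact_unif_continuous (M : pseudoMetricType R) (A : set M) (f : M -> R) (e : R) :
  compact A -> {within A, continuous f} -> 0 < e ->
  exists d : R, 0 < d /\ forall x y, A x -> A y -> ball x d y -> `|f x - f y| <= e.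
Proof.
move=> cA /subspace_continuousP cf e0.
have /compact_near_coveringP/near_covering_withinP/(_ _ (0^'+ : set_system R)
  (fun d x => forall y, A y -> ball x d y -> `|f x - f y| <= e)) := cA.
have cov : forall x, A x -> \forall x' \near x & i \near (0:R)^'+, A x' ->
   forall y, A y -> ball x' i y -> `|f x' - f y| <= e.
  move=> x Ax.
  have /cvgrPdist_lt/(_ (e / 2)) := cf x Ax.
  rewrite divr_gt0// => /(_ isT); rewrite near_withinE near_simpl.
  move=> /nbhs_ballP[r /= r0 hr].
  exists (ball x (r / 2), [set i | i < r / 2]); first split => /=.
  - by apply: nbhsx_ballx; rewrite divr_gt0.
  - by apply: nbhs_right_lt; rewrite divr_gt0.
  move=> [x' i] /= [xx' ir] Ax' y Ay x'y.
  have h1 : `|f x - f x'| < e / 2.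
    by apply: hr => //; apply: le_ball xx'; rewrite ler_pdivrMr// ler_pMr// ler1n.
  have h2 : `|f x - f y| < e / 2.
    apply: hr => //; rewrite [r]splitr; apply: ball_triangle xx' _.
    by apply: le_ball x'y; exact: ltW.
  rewrite -(subrKA (f x)) (le_trans (ler_normD _ _))// [leRHS]splitr distrC.
  by rewrite lerD// ltW.
move=> /(_ _ cov) h.
near (0:R)^'+ => d; exists d; split => //.
by move=> x y Ax; apply: (near h d).
Unshelve. all: by end_near. Qed.

Lemma itv_unif_continuous (T : R) (phi : R -> R) e :
  {within `[0, T], continuous phi} -> 0 < e ->
  exists d : R, 0 < d /\
  (forall s t, 0 <= s <= T -> 0 <= t <= T -> `|s - t| < d -> `|phi s - phi t| <= e).
Proof.
move=> cphi e0.
have [d [d0 h]] := compact_unif_continuous (@segment_compact _ 0 T) cphi e0.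
by exists d; split => // s t sT tT st; apply: h; rewrite //= ?in_itv.
Qed.

(** The two coordinates are compared separately rather than in the product
    distance, so that a kernel can be varied in one of them. *)
Lemma square_unif_continuous (T : R) (K : R -> R -> R) e :
  {within `[0, T] `*` `[0, T], continuous (fun p : R * R => K p.1 p.2)} -> 0 < e ->
  exists d : R, 0 < d /\
  (forall s s' t t', 0 <= s <= T -> 0 <= s' <= T -> 0 <= t <= T -> 0 <= t' <= T ->
     `|s - s'| < d -> `|t - t'| < d -> `|K s t - K s' t'| <= e).
Proof.
move=> cK e0.
have [d [d0 h]] := compact_unif_continuous (compact_setX (@segment_compact _ 0 T)
  (@segment_compact _ 0 T)) cK e0.
exists d; split => // s s' t t' sT sT' tT tT' ss' tt'.
by apply: (h (s, t) (s', t')); split; rewrite //= ?in_itv.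
Qed.

Lemma compact_fun_bounded (M : pseudoMetricType R) (A : set M) (f : M -> R) :
  compact A -> {within A, continuous f} ->
  exists c : R, 0 <= c /\ forall x, A x -> `|f x| <= c.
Proof.
move=> cA cf.
have /compact_bounded[c [_ hc]] := continuous_compact cf cA.
exists (`|c| + 1); split; first by rewrite addr_ge0.
move=> x Ax; apply: (hc (`|c| + 1)); last by exists x.
by rewrite (le_lt_trans (ler_norm _))// ltrDl.
Qed.

End heine.

(** * Existence of the Lebesgue-Stieltjes charge *)

Section stieltjes_existence.
Context {R : realType}.
Implicit Types (T C : R) (f g h : R -> R).

Definition right_limit h (x : R) : R := lim (h y @[y --> x^'+]).

Section bounded_nondecreasing.
Variables (h : R -> R) (C : R).
Hypothesis ndh : {homo h : x y / x <= y}.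
Hypothesis bndh : forall x, 0 <= h x <= C.

Lemma right_limitP (x : R) :
  h y @[y --> x^'+] --> right_limit h x /\
  right_limit h x = inf (h @` [set` Interval (BRight x) (BInfty R false)]).
Proof.
have c : h y @[y --> x^'+] --> inf (h @` [set` Interval (BRight x) (BInfty R false)]).
  apply: nondecreasing_at_right_cvgr => //.
    by move=> y z _ _; exact: ndh.
  by exists 0 => _ [y _ <-]; have /andP[] := bndh y.
by have e := cvg_lim (@Rhausdorff R) c; rewrite /right_limit e.
Qed.

Lemma right_limit_le x y : x < y -> right_limit h x <= h y.
Proof.
move=> xy; have [_ ->] := right_limitP x.
apply: ge_inf; first by exists 0 => _ [z _ <-]; have /andP[] := bndh z.
by exists y => //=; rewrite in_itv/= xy.
Qed.

Lemma right_limit_adherent x e : 0 < e -> exists y, x < y /\ h y < right_limit h x + e.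
Proof.
move=> e0; have [_ ->] := right_limitP x.
have hi : has_inf (h @` [set` Interval (BRight x) (BInfty R false)]).
  split; first by exists (h (x + 1)), (x + 1) => //=; rewrite in_itv/= ltrDl ltr01.
  by exists 0 => _ [z _ <-]; have /andP[] := bndh z.
have [_ [y /= + <-] hy] := inf_adherent e0 hi.
by rewrite in_itv/= andbT => xy; exists y.
Qed.

Lemma right_limit_bounds x : 0 <= right_limit h x <= C.
Proof.
apply/andP; split.
  rewrite leNgt; apply/negP => h0.
  have [y [xy]] := right_limit_adherent x (e := - right_limit h x) ltac:(by rewrite oppr_gt0).
  by rewrite subrr; have /andP[/le_lt_trans + _] := bndh y => /[apply]; rewrite ltxx.
by apply: (le_trans (right_limit_le (y := x + 1) _)); rewrite ?ltrDl//; have /andP[] := bndh (x + 1).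
Qed.

Lemma right_limit_homo : nondecreasing (right_limit h).
Proof.
move=> x y xy; apply/ler_addgt0Pr => e e0.
have [z [yz /ltW hz]] := right_limit_adherent y e0.
by apply: le_trans hz; apply: right_limit_le; exact: le_lt_trans yz.
Qed.

Lemma right_limit_right_continuous x :
  right_limit h y @[y --> x^'+] --> right_limit h x.
Proof.
apply/cvgrPdist_le => e e0.
have [z [xz /ltW hz]] := right_limit_adherent x e0.
near=> y.
have xy : x < y by near: y; exact: nbhs_right_gt.
have yz : y < z by near: y; exact: nbhs_right_lt.
have hxy := right_limit_homo (ltW xy).
rewrite distrC ger0_norm ?subr_ge0//.
by rewrite lerBlDl (le_trans _ hz)// right_limit_le.
Unshelve. all: by end_near. Qed.

(** The right-continuous regularization of h is a cumulative function, and h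
    being bounded makes its Lebesgue-Stieltjes measure finite, hence a charge. *)
Lemma nondecreasing_stieltjes_charge : exists nu : {charge set (measurableTypeR R) -> \bar R},
  forall a b : R, a <= b ->
    nu `]a, b]%classic = (right_limit h b - right_limit h a)%:E.
Proof.
pose F : cumulative R R := HB.pack (right_limit h)
  (isCumulative.Build R _ R (right_limit h) right_limit_homo right_limit_right_continuous).
pose m := lebesgue_stieltjes_measure F.
have mE (a b : R) : a <= b -> m `]a, b]%classic = (right_limit h b - right_limit h a)%:E.
  move=> ab; rewrite /m /lebesgue_stieltjes_measure /measure_extension.
  rewrite measurable_mu_extE/=; last exact: is_ocitv.
  by rewrite wlength_itv_bnd.
have mT : (m setT <= C%:E)%E.
  rewrite -(bigcup_itvT false false).
  pose I n : set R := `]- (n%:R), n%:R]%classic.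
  have : (m \o I) n @[n --> \oo] --> m (\bigcup_n I n).
    apply: nondecreasing_cvg_mu; rewrite /I//; first exact: bigcup_measurable.
    by move=> *; apply/subsetPset/subset_itv; rewrite leBSide/= ?lerN2 ler_nat.
  move=> /cvg_lim <-//; apply: lime_le.
    apply: ereal_nondecreasing_is_cvgn => i j ij; apply: le_measure; rewrite ?inE //.
    - by apply: sub_sigma_algebra; exact: is_ocitv.
    - by apply: sub_sigma_algebra; exact: is_ocitv.
    - by apply: subset_itv; rewrite leBSide/= ?lerN2 ler_nat.
  apply: nearW => n; rewrite /= mE ?lee_fin; last by rewrite (@le_trans _ _ 0)// oppr_le0.
  by have := right_limit_bounds n%:R; have := right_limit_bounds (- n%:R); lra.
have fin : forall U, measurable U -> m U \is a fin_num.
  move=> U mU; rewrite ge0_fin_numE//; apply: (le_lt_trans _ (ltry C)).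
  by apply: (le_trans _ mT); apply: le_measure; rewrite ?inE.
pose nu : {charge set (measurableTypeR R) -> \bar R} :=
  HB.pack (m : set (measurableTypeR R) -> \bar R)
   (isCharge.Build _ (measurableTypeR R) R m (measure0 m) fin (@measure_semi_sigma_additive _ _ _ m)).
by exists nu => a b /mE.
Qed.

End bounded_nondecreasing.

(** Adding c makes p nonnegative on [0, T[; the constants 0 and C outside then
    keep the function nondecreasing on the whole line. *)
Definition extend_monotone T c C (p : R -> R) (x : R) : R :=
  if x < 0 then 0 else if x < T then p x + c else C.

Lemma extend_monotone_homo T c C (p : R -> R) : 0 < T ->
  {in `[0, T] &, nondecreasing_fun p} -> 0 <= p 0 + c -> p T + c <= C ->
  {homo extend_monotone T c C p : x y / x <= y} /\
  forall x, 0 <= extend_monotone T c C p x <= C.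
Proof.
move=> T0 ndp c0 cC.
have pge x : 0 <= x <= T -> p 0 <= p x <= p T.
  move=> /andP[x0 xT]; rewrite !ndp ?in_itv/= ?x0 ?xT ?lexx ?(ltW T0)//.
have C0 : 0 <= C.
  have := pge 0; rewrite lexx ltW// => /(_ isT); lra.
have b x : 0 <= extend_monotone T c C p x <= C.
  rewrite /extend_monotone; case: ltP => x0; first by rewrite lexx.
  case: ltP => xT; last by rewrite lexx C0.
  by have := pge x; rewrite x0 ltW// => /(_ isT); lra.
split => // x y xy.
have := b x; have := b y; rewrite /extend_monotone.
case: (ltP x 0) => x0; case: (ltP y 0) => y0; rewrite ?lexx //; [lra|lra|].
case: (ltP x T) => xT; case: (ltP y T) => yT; rewrite ?lexx //; [|lra|lra].
by rewrite lerD2r ndp// in_itv/= ?x0 ?y0 ltW.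
Qed.

(** The two monotone parts of the Jordan decomposition of f are extended with
    the same constants, which cancel in the difference. *)
Lemma ext0_monotone_parts T f : 0 < T -> bounded_variation 0 T f ->
  exists (p q : R -> R) C, [/\ {homo p : x y / x <= y}, {homo q : x y / x <= y},
   forall x, 0 <= p x <= C, forall x, 0 <= q x <= C &
   forall x, ext0 T f x = p x - q x].
Proof.
move=> T0 bvf.
have ndq := fine_neg_tv_nondecreasing bvf.
have ndp : {in `[0, T] &, nondecreasing_fun (fine \o pos_tv 0 f)}.
  exact: fine_neg_tv_nondecreasing (bounded_variationN bvf).
have fE := bounded_variation_pos_neg_tvE bvf.
set p0 := fine \o pos_tv 0 f in ndp fE; set q0 := fine \o neg_tv 0 f in ndq fE.
pose c := `|p0 0| + `|q0 0|; pose C := `|p0 T| + `|q0 T| + c.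
have [hp bp] : {homo extend_monotone T c C p0 : x y / x <= y} /\
  forall x, 0 <= extend_monotone T c C p0 x <= C.
  apply: extend_monotone_homo => //; rewrite /C /c.
    by have := ler_norm (- p0 0); rewrite normrN; have := normr_ge0 (q0 0); lra.
  by have := ler_norm (p0 T); have := normr_ge0 (q0 T); lra.
have [hq bq] : {homo extend_monotone T c C q0 : x y / x <= y} /\
  forall x, 0 <= extend_monotone T c C q0 x <= C.
  apply: extend_monotone_homo => //; rewrite /C /c.
    by have := ler_norm (- q0 0); rewrite normrN; have := normr_ge0 (p0 0); lra.
  by have := ler_norm (q0 T); have := normr_ge0 (p0 T); lra.
exists (extend_monotone T c C p0), (extend_monotone T c C q0), C; split => // x.
rewrite /ext0 /extend_monotone; case: (ltP x 0) => x0; first by rewrite subrr.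
case: (ltP x T) => xT; last by rewrite subrr.
by rewrite opprD addrACA subrr addr0 fE// in_itv/= x0 ltW.
Qed.

Lemma nu_stieltjes T f : 0 < T -> bounded_variation 0 T f -> forall a b : R, a <= b ->
  nu_ T f `]a, b]%classic = (right_limit (ext0 T f) b - right_limit (ext0 T f) a)%:E.
Proof.
move=> T0 bvf.
have ex : exists nu, is_stieltjes (ext0 T f) nu.
  have [p [q [C [hp hq bp bq fE]]]] := ext0_monotone_parts T0 bvf.
  have [n1 n1E] := nondecreasing_stieltjes_charge hp bp.
  have [n2 n2E] := nondecreasing_stieltjes_charge hq bq.
  exists (cadd n1 (cscale (-1) n2)) => a b ab.
  have rl x : lim (ext0 T f y @[y --> x^'+]) = right_limit p x - right_limit q x.
    have -> : ext0 T f = (fun x => p x - q x) by apply/funext.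
    have [cp _] := right_limitP hp bp x; have [cq _] := right_limitP hq bq x.
    by apply: cvg_lim => //; exact: cvgB.
  rewrite !rl /= /cadd /= n1E//.
  rewrite -[cscale _ _ _]/((-1)%:E * n2 `]a, b]%classic)%E n2E// -EFinM -EFinD; congr EFin; ring.
move=> a b ab; rewrite /nu_ /stieltjes_charge; case: pselect => // h.
by case: cid => nu /= /(_ a b ab) ->.
Qed.

End stieltjes_existence.

(** * Continuity points, and integrals against a charge *)

Section monotone_continuity.
Context {R : realType}.
Implicit Types (T : R) (f h : R -> R).

Lemma nondecreasing_continuous_off_countable h C a b :
  {homo h : x y / x <= y} -> (forall x, 0 <= h x <= C) ->
  exists B : set R, countable B /\
    forall x, a < x < b -> ~ B x -> {for x, continuous h}.
Proof.
move=> ndh bndh; exists [set x | x \in (`]a, b[) /\ discontinuity h x]; split.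
  by apply: discontinuity_countable => x y _ _; exact: ndh.
move=> x xab nB.
have cr : cvg (h y @[y --> x^'+]).
  by apply/cvg_ex; exists (right_limit h x); have [] := right_limitP ndh bndh x.
have cl : cvg (h y @[y --> x^'-]).
  apply: nondecreasing_at_left_is_cvgr.
    by near=> y => u v _ _; exact: ndh.
  by near=> y; exists C => _ [u _ <-]; have /andP[] := bndh u.
have e : lim (h y @[y --> x^'-]) = lim (h y @[y --> x^'+]).
  apply: contrapT => ne; apply: nB; rewrite /= in_itv/= xab; split => //.
  by split => //; exact/eqP.
have le1 : lim (h y @[y --> x^'-]) <= h x.
  apply: limr_le => //; near=> y; apply: ndh; apply/ltW.
  by near: y; exact: nbhs_left_lt.
have le2 : h x <= lim (h y @[y --> x^'+]).
  apply: limr_ge => //; near=> y; apply: ndh; apply/ltW.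
  by near: y; exact: nbhs_right_gt.
have hl : h x = lim (h y @[y --> x^'-]) by apply/eqP; rewrite eq_le le1 e le2.
apply/left_right_continuousP; split; first by rewrite [X in _ --> X]hl; exact: cl.
by rewrite [X in _ --> X]hl e; exact: cr.
Unshelve. all: by end_near. Qed.

Lemma countable_setU (X : Type) (A B : set X) :
  countable A -> countable B -> countable (A `|` B).
Proof.
move=> cA cB; rewrite (_ : A `|` B = \bigcup_(b in [set: bool]) if b then A else B).
  by apply: bigcup_countable => [|[] _ //]; exact: countableP.
by apply/seteqP; split => [x [?|?]|x [[] _ ?]]; by [exists true|exists false|left|right].
Qed.

(** A monotone function has countably many discontinuities. *)
Lemma ext0_continuous_off_countable T f : 0 < T -> bounded_variation 0 T f ->
  exists B : set R, countable B /\
    forall x, 0 < x < T -> ~ B x -> {for x, continuous (ext0 T f)}.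
Proof.
move=> T0 /(ext0_monotone_parts T0)[p [q [C [hp hq bp bq fE]]]].
have [B1 [cB1 h1]] := nondecreasing_continuous_off_countable 0 T hp bp.
have [B2 [cB2 h2]] := nondecreasing_continuous_off_countable 0 T hq bq.
exists (B1 `|` B2); split; first exact: countable_setU.
move=> x xT nB.
have -> : ext0 T f = (fun x => p x - q x) by apply/funext.
apply: cvgB; first by apply: h1 => // Bx; apply: nB; left.
by apply: h2 => // Bx; apply: nB; right.
Qed.

Lemma right_limit_continuous h x : {for x, continuous h} -> right_limit h x = h x.
Proof. by move=> ch; apply: cvg_lim => //; apply: cvg_at_right_filter. Qed.

Lemma right_limit_ext0_lt0 T f x : x < 0 -> right_limit (ext0 T f) x = 0.
Proof.
move=> x0; apply: cvg_lim => //; apply: cvg_near_cst; near=> y.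
have y0 : y < 0 by near: y; exact: nbhs_right_lt.
by rewrite /ext0 leNgt y0.
Unshelve. all: by end_near. Qed.

Lemma right_limit_ext0_ge T f x : T <= x -> right_limit (ext0 T f) x = 0.
Proof.
move=> Tx; apply: cvg_lim => //; apply: cvg_near_cst; near=> y.
have Ty : T <= y by rewrite (le_trans Tx)// ltW//; near: y; exact: nbhs_right_gt.
by rewrite /ext0 [y < T]ltNge Ty andbF.
Unshelve. all: by end_near. Qed.

End monotone_continuity.

Section finite_measure_integral.
Context d (X : measurableType d) (R : realType).
Variables (m : {finite_measure set X -> \bar R}) (D : set X) (mD : measurable D).

Lemma bounded_finite_integrable (f : X -> R) c : measurable_fun D f ->
  (forall x, D x -> `|f x| <= c) -> m.-integrable D (EFin \o f).
Proof.
move=> mf fc; apply: measurable_bounded_integrable => //.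
  by rewrite ltey_eq fin_num_measure.
exists c; split; first exact: num_real.
by move=> M cM x Dx; apply: le_trans (fc x Dx) _; exact: ltW.
Qed.

Lemma finite_Rintegral_bound (f : X -> R) c : 0 <= c -> measurable_fun D f ->
  (forall x, D x -> `|f x| <= c) -> `|\int[m]_(x in D) f x| <= c * fine (m setT).
Proof.
move=> c0 mf fc.
apply: (le_trans (le_normr_Rintegral mD (bounded_finite_integrable mf fc))).
apply: (@le_trans _ _ (\int[m]_(x in D) c)).
  apply: le_Rintegral => //.
  - apply: (bounded_finite_integrable (c := c)); first exact: measurableT_comp.
    by move=> x Dx; rewrite normr_id fc.
  - by apply: (bounded_finite_integrable (c := c)) => // x _; rewrite ger0_norm.
rewrite Rintegral_cst// ler_wpM2l// fine_le ?fin_num_measure//.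
by apply: le_measure; rewrite ?inE.
Qed.

End finite_measure_integral.

Section charge_integral.
Context {R : realType}.
Local Notation RT := (measurableTypeR R).
Implicit Types (T : R) (nu : {charge set RT -> \bar R}) (phi psi f : R -> R).

Definition charge_integral nu T phi : R :=
  \int[charge_pos nu]_(x in `[0, T]) phi x - \int[charge_neg nu]_(x in `[0, T]) phi x.

Definition charge_mass nu : R :=
  fine (charge_pos nu setT) + fine (charge_neg nu setT).

Lemma charge_mass_ge0 nu : 0 <= charge_mass nu.
Proof. by rewrite addr_ge0// fine_ge0. Qed.

Lemma charge_pos_neg nu (A : set RT) : measurable A ->
  nu A = (charge_pos nu A - charge_neg nu A)%E.
Proof.
move=> mA; rewrite (jordan_decomp (projT2 (cid (hahn_pair nu))) mA) /cadd /=.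
by congr (_ + _)%E; rewrite -[LHS]/((-1)%:E * charge_neg nu A)%E EFinN mulN1e.
Qed.

Lemma measurable_segment T : measurable (`[0, T]%classic : set RT).
Proof. exact: measurable_itv. Qed.

Section fixed.
Variables (nu : {charge set RT -> \bar R}) (T : R).
Let mD := measurable_segment T.

Lemma charge_integral_bound phi c : 0 <= c -> measurable_fun (`[0, T]%classic : set RT) phi ->
  (forall t, 0 <= t <= T -> `|phi t| <= c) ->
  `|charge_integral nu T phi| <= charge_mass nu * c.
Proof.
move=> c0 mphi phic; rewrite mulrC mulrDr (le_trans (ler_normB _ _))// lerD//;
  by apply: finite_Rintegral_bound => // x /=; rewrite in_itv/=; exact: phic.
Qed.

Lemma charge_integralB phi psi c : measurable_fun (`[0, T]%classic : set RT) phi ->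
  measurable_fun (`[0, T]%classic : set RT) psi ->
  (forall t, 0 <= t <= T -> `|phi t| <= c) ->
  (forall t, 0 <= t <= T -> `|psi t| <= c) ->
  charge_integral nu T (fun x => phi x - psi x) =
  charge_integral nu T phi - charge_integral nu T psi.
Proof.
move=> mphi mpsi phic psic; rewrite /charge_integral !RintegralB//; first by ring.
all: by apply: bounded_finite_integrable => // x /=; rewrite in_itv/=; (first [exact: phic|exact: psic]).
Qed.

Lemma charge_integralN phi c : measurable_fun (`[0, T]%classic : set RT) phi ->
  (forall t, 0 <= t <= T -> `|phi t| <= c) ->
  charge_integral nu T (fun x => - phi x) = - charge_integral nu T phi.
Proof.
move=> mphi phic; rewrite /charge_integral.
have e (m : {finite_measure set RT -> \bar R}) :
    \int[m]_(x in `[0, T]) (- phi x) = - \int[m]_(x in `[0, T]) phi x.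
  under eq_Rintegral do rewrite -mulN1r.
  rewrite RintegralZl ?mulN1r//; apply: (@bounded_finite_integrable _ _ _ m _ mD phi c) => //.
by rewrite !e; ring.
Qed.

End fixed.
End charge_integral.

(** * Charges of functions of bounded variation on a grid *)

Section charge_grid.
Context {R : realType}.
Local Notation RT := (measurableTypeR R).
Implicit Types (T : R) (nu : {charge set RT -> \bar R}) (phi psi f : R -> R).

Lemma charge_integral_indic nu T (A : set RT) : measurable A ->
  charge_integral nu T \1_A = fine (nu (A `&` `[0, T]%classic)).
Proof.
move=> mA; have mD := measurable_segment T.
rewrite /charge_integral /Rintegral !integral_indic//.
have mAD : measurable (A `&` `[0, T]%classic) by exact: measurableI.
by rewrite (charge_pos_neg nu mAD) fineB// fin_num_measure.
Qed.

Lemma charge_integral_sum nu T N (c : nat -> R) (A : nat -> set RT) :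
  (forall i, measurable (A i)) ->
  charge_integral nu T (fun t => \sum_(0 <= i < N) c i * \1_(A i) t) =
  \sum_(0 <= i < N) c i * charge_integral nu T \1_(A i).
Proof.
move=> mA; have mD := measurable_segment T.
have ind (m : {finite_measure set RT -> \bar R}) i :
    m.-integrable `[0, T]%classic (EFin \o (\1_(A i) : RT -> R)).
  apply: (bounded_finite_integrable m mD (c := 1)); first exact: measurable_indic.
  by move=> x _; rewrite indicE; case: (_ \in _); rewrite /= ?normr1 ?normr0.
have indc (m : {finite_measure set RT -> \bar R}) i :
    m.-integrable `[0, T]%classic (EFin \o (fun t : RT => c i * \1_(A i) t)).
  exact: (integrableZl mD (c i) (ind m i)).
have inds (m : {finite_measure set RT -> \bar R}) k :
    m.-integrable `[0, T]%classic (EFin \o (fun t : RT => \sum_(0 <= i < k) c i * \1_(A i) t)).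
  elim: k => [|k IH].
    rewrite (_ : _ \o _ = cst 0%E); first exact: integrable0.
    by apply/funext => t /=; rewrite big_nil.
  pose f1 (t : RT) := \sum_(0 <= i < k) c i * \1_(A i) t.
  pose f2 (t : RT) := c k * \1_(A k) t.
  rewrite (_ : _ \o _ = ((EFin \o f1) \+ (EFin \o f2))%E); first exact: (integrableD mD (IH : m.-integrable _ (EFin \o f1)) (indc m k : m.-integrable _ (EFin \o f2))).
  by apply/funext => t /=; rewrite big_nat_recr.
have part (m : {finite_measure set RT -> \bar R}) k :
    \int[m]_(t in `[0, T]) (\sum_(0 <= i < k) c i * \1_(A i) t) =
    \sum_(0 <= i < k) c i * \int[m]_(t in `[0, T]) \1_(A i) t.
  elim: k => [|k IH].
    rewrite big_nil; under eq_Rintegral do rewrite big_nil.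
    by rewrite Rintegral_cst// mul0r.
  rewrite big_nat_recr//= -IH -RintegralZl//; last exact: ind.
  rewrite -RintegralD//; [|exact: inds|exact: indc].
  by apply: eq_Rintegral => t _; rewrite big_nat_recr.
rewrite /charge_integral !part -sumrB; apply: eq_bigr => i _.
by rewrite mulrBr.
Qed.

Section stieltjes.
Variables (T : R) (f : R -> R).
Hypotheses (T0 : 0 < T) (bvf : bounded_variation 0 T f).
Local Notation nu := (nu_ T f).
Local Notation F := (ext0 T f).

(** The segment [0, y] is not a cell, and its mass has to be reached from the
    left of 0. *)
Lemma charge_itv_cvg (mu : {charge set RT -> \bar R}) (y : R) : 0 <= y ->
  mu `]- n.+1%:R^-1, y]%classic @[n --> \oo] --> mu `[0, y]%classic.
Proof.
move=> y0.
pose A n : set RT := `]- n.+1%:R^-1, y]%classic.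
have mA n : measurable (A n) by exact: measurable_itv.
have AI : \bigcap_n A n = `[0, y]%classic.
  apply/seteqP; split => t; last first.
    rewrite /A /= in_itv/= => /andP[t0 ty] n _ /=; rewrite in_itv/= ty andbT.
    by rewrite (lt_le_trans _ t0)// oppr_lt0 invr_gt0.
  move=> h /=; have := h 0%N I; rewrite /A /= !in_itv/= => /andP[_ ->]; rewrite andbT.
  apply/ler_addgt0Pl => e e0; have [n ne] : exists n : nat, n.+1%:R^-1 < e.
    exists (Num.truncn e^-1); rewrite invf_plt ?posrE//.
    exact: truncnS_gt.
  have := h n I; rewrite /A /= in_itv/= => /andP[+ _].
  by move: (n.+1%:R^-1) ne => z; lra.
have part (m : {finite_measure set RT -> \bar R}) : m (A n) @[n --> \oo] --> m `[0, y]%classic.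
  rewrite -AI; apply: nonincreasing_cvg_mu => //.
  - by rewrite ltey_eq fin_num_measure.
  - by rewrite AI; exact: measurable_itv.
  - move=> n k nk; apply/subsetPset; apply: subset_itvr.
    by rewrite bnd_simp lerN2 lef_pV2 ?posrE// ler_nat.
rewrite (charge_pos_neg mu); last exact: measurable_itv.
under eq_cvg do rewrite (charge_pos_neg mu (mA _)).
apply: cvgeB; [|exact: part|exact: part].
by rewrite fin_num_adde_defl// fin_numN fin_num_measure//; exact: measurable_itv.
Qed.

Lemma nu_segment0 y : 0 <= y -> nu `[0, y]%classic = (right_limit F y)%:E.
Proof.
move=> y0; rewrite -(cvg_lim (@ereal_hausdorff R) (@charge_itv_cvg (nu_ T f) y y0)).
apply: cvg_lim => //.
apply: cvg_near_cst; near=> n.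
have n0 : - n.+1%:R^-1 < 0 :> R by rewrite oppr_lt0 invr_gt0.
rewrite nu_stieltjes//; last by rewrite (le_trans (ltW n0)).
by rewrite (right_limit_ext0_lt0 _ _ n0) subr0.
Unshelve. all: by end_near. Qed.

(** The first cell, cut at 0, has the mass of the atom at 0 in addition. *)
Lemma nu_cell x y : x = -1 \/ 0 <= x -> x <= y -> 0 <= y <= T ->
  nu (`]x, y]%classic `&` `[0, T]%classic) = (right_limit F y - right_limit F x)%:E.
Proof.
move=> xx xy /andP[y0 yT]; case: xx => [xN1|x0].
  have -> : `]x, y]%classic `&` `[0, T]%classic = `[0, y]%classic.
    apply/seteqP; split => t /=; rewrite xN1 !in_itv/=; first by move=> [/andP[_ ->] /andP[-> _]].
    by move=> /andP[t0 ty]; rewrite ty t0 (le_trans ty yT) (lt_le_trans _ t0).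
  by rewrite nu_segment0// xN1 (@right_limit_ext0_lt0 _ T f (-1)) ?ltrN10// subr0.
have -> : `]x, y]%classic `&` `[0, T]%classic = `]x, y]%classic.
  apply: setIidl => t /=; rewrite !in_itv/= => /andP[xt ty].
  by rewrite (le_trans x0 (ltW xt)) (le_trans ty).
exact: nu_stieltjes.
Qed.

Section on_grid.
Variables (B : set R) (d : R) (N : nat) (x : nat -> R).
Hypothesis contF : forall x, 0 < x < T -> ~ B x -> {for x, continuous F}.
Hypothesis gx : is_grid T d N x.
Hypothesis xB : forall i, (0 < i < N)%N -> ~ B (x i).

(** The nodes are continuity points, or lie where the function is locally
    constant on the right. *)
Lemma grid_node_right_limit i : (i <= N)%N -> right_limit F (x i) = F (x i).
Proof.
have [x0 xN xi] := gx.
case: i => [_|i iN].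
  by rewrite x0 right_limit_ext0_lt0 /ext0 ?leNgt ltrN10.
have := iN; rewrite leq_eqVlt => /predU1P[->|iN'].
  by rewrite xN right_limit_ext0_ge /ext0 ?ltxx ?andbF.
apply: right_limit_continuous; apply: contF; last exact: xB.
have [h1 /andP[_ h2] _] := xi _ iN'; have [_ /andP[h3 _] _] := xi _ iN.
by rewrite h3 (lt_le_trans h1 h2).
Qed.

(** On a grid the charge of f acts as a step functional does: through the
    increments of the function over the cells. *)
Lemma charge_integral_grid phi :
  charge_integral nu T (grid_fun N x phi) = grid_sum N x F phi.
Proof.
have [x0 xN xi] := gx.
rewrite /grid_fun charge_integral_sum; last by move=> i; exact: measurable_itv.
apply: eq_big_nat => i /andP[_ iN]; congr (_ * _).
rewrite charge_integral_indic; last exact: measurable_itv.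
have [h1 /andP[h2 h3] _] := xi _ iN.
rewrite nu_cell ?(ltW h1) ?(ltW h2)//=; last first.
  case: i iN {h1 h2 h3} => [|i] iN; first by left.
  by right; have [_ /andP[/ltW]] := xi _ (ltnW iN).
by rewrite !grid_node_right_limit// ltnW.
Qed.

Lemma measurable_grid_fun phi : measurable_fun (`[0, T]%classic : set RT) (grid_fun N x phi).
Proof.
rewrite /grid_fun; apply: measurable_sum => i.
apply: measurable_funM => //; exact: measurable_indic.
Qed.

Lemma charge_integral_near_grid phi e :
  measurable_fun (`[0, T]%classic : set RT) phi ->
  (forall s t, 0 <= s <= T -> 0 <= t <= T -> `|s - t| < d -> `|phi s - phi t| <= e) ->
  0 <= e -> (exists c, forall t, 0 <= t <= T -> `|phi t| <= c) ->
  `|charge_integral nu T phi - grid_sum N x F phi| <= charge_mass nu * e.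
Proof.
move=> mphi unif e0 [c phic].
have close := grid_fun_close gx unif.
have phic' t : 0 <= t <= T -> `|phi t| <= c + e by move=> /phic; lra.
have gc t : 0 <= t <= T -> `|grid_fun N x phi t| <= c + e.
  move=> tT; rewrite -(subrKC (phi t) (grid_fun N x phi t)) (le_trans (ler_normD _ _))//.
  by rewrite lerD ?phic// distrC close.
rewrite -charge_integral_grid -(charge_integralB nu mphi (measurable_grid_fun phi) phic' gc).
apply: charge_integral_bound => //; apply: measurable_funB => //.
exact: measurable_grid_fun.
Qed.

End on_grid.
End stieltjes.
End charge_grid.

(** * Weak convergence, and approximation by step functions *)

Section weak_convergence.
Context {R : realType}.
Local Notation RT := (measurableTypeR R).
Implicit Types (T : R) (phi f : R -> R).

Lemma measurable_continuous_segment T phi : {within `[0, T], continuous phi} ->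
  measurable_fun (`[0, T]%classic : set RT) phi.
Proof. exact: subspace_continuous_measurable_fun. Qed.

(** Weak convergence. On a grid avoiding the discontinuities of f, both sides
    are, up to an error uniform in n, the same sum over the nodes of the
    increments of u n and of f; there pointwise convergence suffices. *)
Lemma step_functional_cvg T f (u : nat -> R -> R) L M phi : 0 < T ->
  bounded_variation 0 T f -> (forall n, is_step_functional T (u n) (L n)) ->
  (forall n, (total_variation 0 T (u n) <= M%:E)%E) ->
  (forall t, 0 <= t < T -> u n t @[n --> \oo] --> f t) ->
  {within `[0, T], continuous phi} ->
  L n phi @[n --> \oo] --> charge_integral (nu_ T f) T phi.
Proof.
move=> T0 bvf uL uM uf cphi.
have M0 : 0 <= M.
  by rewrite -lee_fin; apply: le_trans (uM 0%N); apply: total_variation_ge0; exact: ltW.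
have mass0 := charge_mass_ge0 (nu_ T f).
set mass := charge_mass _ in mass0.
have uF t : u n t @[n --> \oo] --> ext0 T f t.
  rewrite /ext0; case: ifPn => [|tT]; first exact: uf.
  by apply: cvg_near_cst; near=> n; rewrite (step_fun_out (uL n)).
apply/cvgrPdist_le => eps eps0.
(* 2 * M * e and mass * e are the two errors of replacing phi on the grid. *)
pose e := eps / 2 / (2 * M + mass + 1).
have P0 : 0 < 2 * M + mass + 1 by lra.
have e0 : 0 < e by rewrite divr_gt0// divr_gt0.
have eE : (2 * M + mass + 1) * e = eps / 2 by rewrite /e mulrC divfK// gt_eqF.
have [d [d0 unif]] := itv_unif_continuous cphi e0.
have [B [cB contF]] := ext0_continuous_off_countable T0 bvf.
have [N [x [gx xB]]] := grid_exists cB T0 d0.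
have [c [_ phic]] := compact_fun_bounded (@segment_compact _ 0 T) cphi.
have h1 := charge_integral_near_grid T0 bvf contF gx xB
  (measurable_continuous_segment cphi) unif (ltW e0).
have {}h1 : `|charge_integral (nu_ T f) T phi - grid_sum N x (ext0 T f) phi| <= mass * e.
  by apply: h1; exists c => t tT; apply: phic; rewrite /= in_itv.
have h2 : grid_sum N x (u n) phi @[n --> \oo] --> grid_sum N x (ext0 T f) phi.
  rewrite /grid_sum; elim: N {gx xB h1} => [|N IH].
    by under eq_cvg do rewrite big_nil; rewrite big_nil; exact: cvg_cst.
  under eq_cvg do rewrite big_nat_recr//=; rewrite big_nat_recr//=.
  apply: cvgD; first exact: IH.
  by apply: cvgM; [exact: cvg_cst|apply: cvgB; exact: uF].
move/cvgrPdist_le : h2 => /(_ (eps / 2)); rewrite divr_gt0// => /(_ isT) h2.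
near=> n.
have h3 := step_functional_near_grid T0 gx (uL n) (uM n) unif.
have h4 : `|grid_sum N x (ext0 T f) phi - grid_sum N x (u n) phi| <= eps / 2 by near: n.
move: h1 h3 h4 eE; rewrite !ler_norml; nra.
Unshelve. all: by end_near. Qed.

End weak_convergence.

Section bv_approximation.
Context {R : realType}.
Implicit Types (T : R) (f h : R -> R) (s : seq R).

Definition partition_step T s h : R -> R := fun t =>
  \sum_(k < size s) h (nth T (0 :: s) k) * \1_(`[nth T (0 :: s) k, nth T (0 :: s) k.+1[) t.

Lemma itv_partition_locate (d x t : R) s : path <%R x s -> x <= t < last x s ->
  exists2 k, (k < size s)%N & nth d (x :: s) k <= t < nth d (x :: s) k.+1.
Proof.
elim: s x => [|y s IH] x /=; first by move=> _ /andP[/le_lt_trans] /[apply]; rewrite ltxx.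
move=> /andP[xy ys] /andP[xt tl]; have [ty|yt] := ltP t y.
  by exists 0%N => //=; rewrite xt.
by have [|k ks kt] := IH y ys; [rewrite yt|exists k.+1].
Qed.

Section partition.
Variables (T : R) (s : seq R).
Hypotheses (T0 : 0 < T) (sT : itv_partition 0 T s).
Let y := nth T (0 :: s).

Let y_lt i j : (i < j)%N -> (j <= size s)%N -> y i < y j.
Proof.
move=> ij js; have [ps _] := sT.
by rewrite /y lt_sorted_ltn_nth// inE/= ltnS// ltnW// (leq_trans ij).
Qed.

Let y_le i j : (i <= j)%N -> (j <= size s)%N -> y i <= y j.
Proof. by rewrite leq_eqVlt => /predU1P[->//|ij js]; apply: ltW; exact: y_lt. Qed.

Let yT k : (k <= size s)%N -> 0 <= y k <= T.
Proof.
move=> ks; have [ps /eqP ls] := sT; have e : y (size s) = T by rewrite /y -(last_nth T).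
by apply/andP; split; [exact: (y_le (leq0n k) ks)|rewrite -[leRHS]e y_le].
Qed.

Lemma partition_step_step h : step_fun T (partition_step T s h).
Proof.
exists (size s), (fun k => h (y k)), (fun k => y k), (fun k => y k.+1); split => // k.
by have /andP[? ?] := yT (ltnW (ltn_ord k)); have /andP[? ?] := yT (ltn_ord k); split => //;
   apply: ltW; apply: y_lt.
Qed.

(** The cell of t determines the value of every step function with jumps in
    the partition. *)
Lemma partition_stepP t : 0 <= t < T -> exists z,
  [/\ 0 <= z <= t, z \in 0 :: s, forall h, partition_step T s h t = h z &
      forall z', z' \in 0 :: s -> z' <= t -> z' <= z].
Proof.
move=> /andP[t0 tT]; have [ps /eqP ls] := sT.
have [k ks kt] : exists2 k, (k < size s)%N & y k <= t < y k.+1.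
  by apply: itv_partition_locate => //; rewrite t0 ls.
have [kt1 kt2] := andP kt.
exists (y k); split.
- by have /andP[-> _] := yT (ltnW ks).
- by apply: mem_nth => /=; rewrite ltnS ltnW.
- move=> h; rewrite /partition_step (bigD1 (Ordinal ks))//= indic_itvco kt mulr1.
  rewrite big1 ?addr0// => j jk; rewrite indic_itvco -/y.
  rewrite (_ : (_ && _) = false) ?mulr0//; apply/negbTE/negP => /andP[h1 h2].
  have : (j < k)%N || (k < j)%N by rewrite -neq_ltn.
  move=> /orP[ij|ij].
    by move: h2; rewrite ltNge => /negP; apply; exact: (le_trans (y_le ij (ltnW ks)) kt1).
  by move: kt2; rewrite ltNge => /negP; apply; exact: (le_trans (y_le ij (ltnW (ltn_ord j))) h1).
- move=> z' z's z't; rewrite leNgt; apply/negP => h.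
  have yz : y (index z' (0 :: s)) = z' by exact: nth_index.
  have zs : (index z' (0%R :: s) <= size s)%N.
    by rewrite -ltnS -[(size s).+1]/(size (0%R :: s)) index_mem.
  have [zk|kz] := leqP (index z' (0%R :: s)) k.
    by have := y_le zk (ltnW ks); rewrite yz leNgt h.
  by have := y_le kz zs; rewrite yz => h'; have := lt_le_trans kt2 (le_trans h' z't); rewrite ltxx.
Qed.

Lemma partition_step_T h : partition_step T s h T = 0.
Proof.
apply: big1 => k _; rewrite indic_itvco -/y; have /andP[_ h2] := yT (ltn_ord k).
by rewrite [T < _]ltNge h2 andbF mulr0.
Qed.

(** On [0, T] the step function is h composed with the nondecreasing map r that
    rounds down to a node, and composition with r keeps p and q monotone. *)
Lemma partition_step_total_variation (p q h : R -> R) C :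
  {homo p : x y / x <= y} -> {homo q : x y / x <= y} ->
  (forall x, 0 <= p x <= C) -> (forall x, 0 <= q x <= C) ->
  (forall x, h x = p x - q x) -> h T = 0 ->
  (total_variation 0 T (partition_step T s h) <= (C + C)%:E)%E.
Proof.
move=> hp hq bp bq hE hT.
pose r t := if t < T then partition_step T s id t else T.
have rle t : 0 <= t <= T -> 0 <= r t <= T.
  rewrite /r => /andP[t0 _]; case: ifPn => tT; last by rewrite lexx ltW.
  have [|z [/andP[z0 zt] _ -> _]] := @partition_stepP t; first by rewrite t0.
  by rewrite z0 (le_trans zt)// ltW.
have rnd : {in `[0, T] &, nondecreasing_fun r}.
  move=> t t'; rewrite !in_itv/= => tT t'T tt'.
  have := rle t tT; rewrite /r; case: (ltP t' T) => t'T1; last by move=> /andP[].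
  have tT1 : t < T by exact: le_lt_trans t'T1.
  rewrite tT1 => _.
  have [|z [/andP[z0 zt] zs -> _]] := @partition_stepP t; first by case/andP: tT => ->.
  have [|z' [_ _ -> z'P]] := @partition_stepP t'; first by case/andP: t'T => ->.
  by apply: z'P => //; exact: le_trans tt'.
have rE t : 0 <= t <= T -> partition_step T s h t = p (r t) - q (r t).
  move=> /andP[t0 tT]; rewrite /r; case: ifPn => tT1.
    by have [|z [_ _ zE _]] := @partition_stepP t; [rewrite t0|rewrite !zE hE].
  have -> : t = T by apply/eqP; rewrite eq_le tT leNgt.
  by rewrite partition_step_T -hE.
have TV (g : R -> R) : {homo g : x y / x <= y} -> (forall x, 0 <= g x <= C) ->
    (total_variation 0 T (g \o r) <= C%:E)%E.
  move=> hg bg; rewrite nondecreasing_total_variation ?(ltW T0)//.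
    by rewrite lee_fin /=; have := bg (r T); have := bg (r 0); lra.
  by move=> a b aT bT ab; apply: hg; exact: rnd.
have -> : total_variation 0 T (partition_step T s h) =
    total_variation 0 T ((p \o r) \+ (\- (q \o r))).
  rewrite /total_variation; congr ereal_sup.
  suff : variations 0 T (partition_step T s h) =
         variations 0 T ((p \o r) \+ (\- (q \o r))) by move=> ->.
  have eqv l : itv_partition 0 T l -> variation 0 T (partition_step T s h) l =
      variation 0 T ((p \o r) \+ (\- (q \o r))) l.
    move=> [pl /eqP ll]; apply: eq_big_nat => i /andP[_ il].
    have lT k : 0 <= nth T (0 :: l) k <= T.
      have [kl|kl] := ltnP k (size (0 :: l)); last by rewrite nth_default// lexx ltW.
      have m := mem_nth T kl; apply/andP; split; last by rewrite -[leRHS]ll le_last_path.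
      move: m; rewrite in_cons => /predU1P[->//|m].
      by have /allP/(_ _ m)/ltW := order_path_min lt_trans pl.
    by rewrite /= !rE//; exact: (lT i.+1) || exact: (lT i).
  by apply/seteqP; split => _ [l lT <-]; exists l => //; rewrite eqv.
apply: (le_trans (total_variation_le _ _ (ltW T0))).
by rewrite total_variationN EFinD leeD// TV.
Qed.

End partition.

(** The partitions run through a uniform mesh and through an enumeration of
    the discontinuities of the function, where the left limit would be wrong. *)
Lemma bv_approx_exists T f : 0 < T -> bounded_variation 0 T f ->
  exists u, bv_approx T u f.
Proof.
move=> T0 bvf.
have [p [q [C [hp hq bp bq fE]]]] := ext0_monotone_parts T0 bvf.
have [B [cB contF]] := ext0_continuous_off_countable T0 bvf.
have [b bB] : exists b : nat -> R, B `<=` range b.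
  have [b bB] := pcard_surjP cB.
  by exists b => x Bx; have [n _ <-] := bB x Bx; exists n.
pose l n : seq R := [seq x <- [seq b i | i <- iota 0 n] ++
  [seq i%:R / n%:R * T | i <- iota 0 n] | 0 <= x <= T].
have part n : {s | itv_partition 0 T s /\ {subset l n <= 0 :: s}}.
  apply: cid; apply: partition_through => // x.
  by rewrite mem_filter => /andP[].
pose s n := sval (part n).
have sT n : itv_partition 0 T (s n) by rewrite /s; case: (part n) => ? [].
have sl n : {subset l n <= 0%R :: s n} by rewrite /s; case: (part n) => ? [].
have F_T : ext0 T f T = 0 by rewrite /ext0 ltxx andbF.
exists (fun n => partition_step T (s n) (ext0 T f)); split.
- by move=> n; exact: partition_step_step.
- by exists (C + C) => n; exact: (partition_step_total_variation T0 (sT n) hp hq).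
- move=> t tT; have [t0 tT1] := andP tT.
  have -> : f t = ext0 T f t by rewrite /ext0 tT.
  have loc n : {z | [/\ 0 <= z <= t, z \in 0 :: s n, forall h, partition_step T (s n) h t = h z &
      forall z', z' \in 0 :: s n -> z' <= t -> z' <= z]}.
    by apply: cid; exact: partition_stepP.
  pose z n := sval (loc n).
  have zE n : partition_step T (s n) (ext0 T f) t = ext0 T f (z n).
    by rewrite /z; case: (loc n) => z0 /= [_ _ h _]; exact: h.
  have zt n : z n <= t by rewrite /z; case: (loc n) => z0 /= [/andP[_ h] _ _ _].
  have zl n z' : z' \in 0 :: s n -> z' <= t -> z' <= z n.
    by rewrite /z; case: (loc n) => z0 /= [_ _ _]; exact.
  under eq_cvg do rewrite zE.
  have [Bt|nBt] := pselect (B t \/ t = 0).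
    have tn : \forall n \near \oo, t \in 0 :: s n.
      case: Bt => [/bB[i _ bit]|->]; last by near=> n; rewrite in_cons eqxx.
      exists i.+1 => // n /= ni.
      apply: sl; rewrite mem_filter t0 (ltW tT1)/= mem_cat -bit map_f//.
      by rewrite mem_iota/= add0n.
    apply: cvg_near_cst; near=> n.
    have -> // : z n = t.
    by apply/eqP; rewrite eq_le zt/= zl//; near: n.
  have t00 : 0 < t by rewrite lt_neqAle t0 andbT eq_sym; apply/eqP => e; apply: nBt; right.
  have zcvg : z n @[n --> \oo] --> t.
    apply/cvgrPdist_le => e e0.
    have Tnear : \forall n \near \oo, T <= n%:R * e.
      exists (Num.truncn (T / e)).+1 => // n /= hn; rewrite -ler_pdivrMr//.
      by apply: le_trans (ltW (truncnS_gt _)) _; rewrite ler_nat.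
    near=> n.
    have n0 : (0 < n)%N by near: n; exists 1%N.
    have n0' : 0 < n%:R :> R by rewrite ltr0n.
    have Tn : T <= n%:R * e by near: n.
    have tn0 : 0 <= t / T * n%:R by rewrite mulr_ge0// divr_ge0// ltW.
    pose i := Num.truncn (t / T * n%:R).
    have /andP[i1 i2] := truncn_itv tn0.
    have iT : i%:R / n%:R * T <= t.
      by rewrite mulrAC ler_pdivrMr// -ler_pdivlMr// mulrAC.
    have iT2 : t <= (i%:R / n%:R * T) + e.
      have h1 : t * n%:R <= (i%:R + 1) * T.
        by rewrite natr1 -ler_pdivrMr// mulrAC ltW.
      rewrite -(ler_pM2r n0') mulrDl mulrAC divfK ?gt_eqF//.
      by apply: (le_trans h1); rewrite mulrDl mul1r lerD2l [leRHS]mulrC.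
    rewrite ger0_norm ?subr_ge0// lerBlDr (le_trans iT2)// addrC lerD2l zl//.
    apply: sl; rewrite mem_filter mem_cat; apply/andP; split.
      by rewrite (le_trans iT (ltW tT1)) andbT mulr_ge0 ?divr_ge0// ltW.
    apply/orP; right; apply/mapP; exists i => //; rewrite mem_iota/= add0n.
    rewrite -(ltr_nat R); apply: le_lt_trans i1 _.
    by rewrite gtr_pMl// ltr_pdivrMr// mul1r.
  apply: (@cvg_comp _ _ _ z (ext0 T f) _ (nbhs t)) => //.
  by apply: contF; [rewrite t00|move=> Bt; apply: nBt; left].
Unshelve. all: by end_near. Qed.

End bv_approximation.

(** * Second moments of Gaussian variables *)

Section gaussian_second_moment.
Context {R : realType}.
Local Notation mu := (@lebesgue_measure R).

(** By y <= exp y, a squared deviation times the density is at most a multiple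
    of the density with twice the variance. *)
Lemma normal_second_moment (m s : R) : s != 0 ->
  (\int[normal_prob m s]_x ((x - m) ^+ 2)%:E < +oo)%E.
Proof.
move=> s0.
have msq : measurable_fun setT (fun x : measurableTypeR R => ((x - m) ^+ 2)%:E).
  apply/measurable_EFinP; apply: measurable_funX; exact: measurable_funB.
have mpdf a : measurable_fun setT (fun x : measurableTypeR R => (normal_pdf m a x)%:E).
  by apply/measurable_EFinP; exact: measurable_normal_pdf.
have dom := normal_prob_dominates m s.
rewrite -(Radon_Nikodym_SigmaFinite.change_of_variables dom) //; last first.
  by move=> x; rewrite lee_fin sqr_ge0.
have ae : ae_eq mu setT (Radon_Nikodym_SigmaFinite.f (normal_prob m s) mu)
    (fun x => (normal_pdf m s x)%:E).
  apply: integral_ae_eq => //.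
  - exact: Radon_Nikodym_SigmaFinite.f_integrable.
  - by move=> E _ mE; rewrite -Radon_Nikodym_SigmaFinite.f_integral.
rewrite [X in (X < _)%E](_ : _ = \int[mu]_x (((x - m) ^+ 2)%:E * (normal_pdf m s x)%:E))%E; last first.
  apply: ae_eq_integral => //.
  - apply: emeasurable_funM => //.
    exact: measurable_int (Radon_Nikodym_SigmaFinite.f_integrable dom).
  - exact: emeasurable_funM.
  - exact: ae_eqe_mul2l.
pose s' := Num.sqrt 2 * s.
have s'0 : s' != 0 by rewrite mulf_neq0// sqrtr_eq0 -ltNge.
have s'2 : s' ^+ 2 = 2 * s ^+ 2 by rewrite /s' exprMn sqr_sqrtr.
pose c := 4 * s ^+ 2 * normal_peak s / normal_peak s'.
have c0 : 0 <= c.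
  by rewrite /c divr_ge0 ?normal_peak_ge0// mulr_ge0 ?normal_peak_ge0// mulr_ge0// sqr_ge0.
have ps' : normal_peak s' != 0 by rewrite gt_eqF// normal_peak_gt0.
apply: (@le_lt_trans _ _ (\int[mu]_x (c%:E * (normal_pdf m s' x)%:E))%E); last first.
  by rewrite ge0_integralZl//= ?integral_normal_pdf ?mule1 ?ltry// => x _;
     rewrite lee_fin normal_pdf_ge0.
apply: ge0_le_integral => //.
- by move=> x _; rewrite lee_fin mulr_ge0 ?sqr_ge0 ?normal_pdf_ge0.
- exact: emeasurable_funM.
- exact: emeasurable_funM.
move=> x _; rewrite -!EFinM lee_fin !normal_pdfE// /normal_fun s'2.
pose y := (x - m) ^+ 2 / (4 * s ^+ 2).
have s20 : s ^+ 2 != 0 by rewrite expf_neq0.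
have s2p : 0 < s ^+ 2 by rewrite lt_neqAle eq_sym s20 sqr_ge0.
have -> : - (x - m) ^+ 2 / (s ^+ 2 *+ 2) = - y - y by rewrite /y; field.
have -> : - (x - m) ^+ 2 / (2 * s ^+ 2 *+ 2) = - y by rewrite /y; field.
have -> : (x - m) ^+ 2 = 4 * s ^+ 2 * y by rewrite /y; field.
have yle : y <= expR y by have := expR_ge1Dx y; lra.
have -> : c * (normal_peak s' * expR (- y)) =
    4 * s ^+ 2 * normal_peak s * (expR (- y)) by rewrite /c; field.
have -> : expR (- y) = expR y * expR (- y - y) by rewrite -expRD; congr expR; ring.
have -> : 4 * s ^+ 2 * y * (normal_peak s * expR (- y - y)) =
  4 * s ^+ 2 * normal_peak s * (y * expR (- y - y)) by ring.
apply: ler_wpM2l; first by rewrite mulr_ge0 ?normal_peak_ge0// mulr_ge0 ?sqr_ge0.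
by apply: ler_wpM2r => //; exact: expR_ge0.
Qed.

(** The second moment is that of the law of X, about its mean; the mean is
    removed by X ^ 2 <= 2 (X - m) ^ 2 + 2 m ^ 2. *)
Lemma gaussian_square_integrable d (Omega : measurableType d) (P : probability Omega R)
    (X : {RV P >-> R}) : gaussian_variable P X ->
  P.-integrable setT (EFin \o (fun w => X w ^+ 2)).
Proof.
move=> [m [s [s0 Xlaw]]].
pose RT := measurableTypeR R.
have mX : measurable_fun setT (X : Omega -> RT) by exact: (measurable_funPT X).
pose X' : {mfun Omega >-> RT} :=
  HB.pack (X : Omega -> RT) (isMeasurableFun.Build _ _ _ _ (X : Omega -> RT) mX).
have msq : measurable_fun setT (fun x : RT => ((x - m) ^+ 2)%:E).
  apply/measurable_EFinP; apply: measurable_funX; exact: measurable_funB.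
have fin : (\int[P]_w ((X w - m) ^+ 2)%:E < +oo)%E.
  rewrite -[ltLHS](@ge0_integral_distribution _ _ _ RT _ P X' (fun x => ((x - m) ^+ 2)%:E))//; last first.
    by move=> x; rewrite lee_fin sqr_ge0.
  have [sz|sn] := eqVneq s 0.
    rewrite (eq_measure_integral (\d_ (m : RT))); last first.
      move=> A mA _; have := Xlaw A mA; rewrite /gaussian_law sz eqxx => h. exact: h.
    by rewrite integral_dirac//= subrr expr0n/= mule0 ltry.
  rewrite (eq_measure_integral (normal_prob m s)); last first.
    by move=> A mA _; have := Xlaw A mA; rewrite /gaussian_law (negbTE sn) => h; exact: h.
  exact: normal_second_moment.
have ic : P.-integrable setT (EFin \o (fun w => (X w - m) ^+ 2)).
  apply/integrableP; split.
    apply/measurable_EFinP; apply: measurable_funX; exact: measurable_funB.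
  by under eq_integral do rewrite /= ger0_norm ?sqr_ge0//.
have i1 : P.-integrable setT (EFin \o (fun w => 2 * (X w - m) ^+ 2 + 2 * m ^+ 2)).
  pose f1 w : R := 2 * (X w - m) ^+ 2; pose f2 (w : Omega) : R := 2 * m ^+ 2.
  rewrite (_ : EFin \o _ = ((EFin \o f1) \+ (EFin \o f2))%E) //.
  apply: integrableD => //; first exact: (integrableZl measurableT 2 ic).
  exact: finite_measure_integrable_cst.
apply: le_integrable i1 => //.
  by apply/measurable_EFinP; exact: measurable_funX.
move=> w _ /=; rewrite lee_fin !ger0_norm ?sqr_ge0//; last first.
  by rewrite addr_ge0// mulr_ge0// sqr_ge0.
by have := sqr_ge0 (X w - 2 * m); rewrite !expr2; nra.
Qed.

End gaussian_second_moment.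

(** * The element represented by a function of bounded variation *)

Section covariance.
Context d (Omega : measurableType d) (R : realType) (P : probability Omega R).
Variables (T : R) (G : R -> {RV P >-> R}).
Hypothesis gaussianG : gaussian_process T G.
Local Notation K := (cov_fun G).

Lemma process_square_integrable t : 0 <= t <= T ->
  P.-integrable setT (EFin \o (fun w => G t w ^+ 2)).
Proof.
move=> tT; apply: gaussian_square_integrable.
have := @gaussianG 1%N (fun=> 1) (fun=> t) (fun=> tT).
rewrite (_ : (fun w => \sum_(i < 1) 1 * G t w) = G t)//.
by apply/funext => w; rewrite big_ord1 mul1r.
Qed.

Lemma process_product_integrable t s : 0 <= t <= T -> 0 <= s <= T ->
  P.-integrable setT (EFin \o (fun w => G t w * G s w)).
Proof.
move=> tT sT.
have := integrableD measurableT (process_square_integrable tT) (process_square_integrable sT).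
apply: le_integrable => //.
  by apply/measurable_EFinP; exact: measurable_funM.
move=> w _ /=; rewrite lee_fin ler_norml.
rewrite ger0_norm ?addr_ge0 ?sqr_ge0//.
have := sqr_ge0 (G t w - G s w); have := sqr_ge0 (G t w + G s w).
have := sqr_ge0 (G t w); have := sqr_ge0 (G s w).
by rewrite !expr2 => *; apply/andP; split; nra.
Qed.

Lemma cov_funE t s : K t s = \int[P]_w (G t w * G s w).
Proof. by rewrite /cov_fun unlock. Qed.

Lemma cov_fun_sym t s : K t s = K s t.
Proof. by rewrite !cov_funE; apply: eq_Rintegral => w _; rewrite mulrC. Qed.

Lemma expectation_increments a b c e :
  0 <= a <= T -> 0 <= b <= T -> 0 <= c <= T -> 0 <= e <= T ->
  ('E_P[(fun w => (G b w - G a w) * (G e w - G c w))%R] =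
   ((K a c - K a e) - (K b c - K b e))%:E)%E.
Proof.
move=> aT bT cT eT.
have i x y (xT : 0 <= x <= T) (yT : 0 <= y <= T) := process_product_integrable xT yT.
have iB x y z t (xT : 0 <= x <= T) (yT : 0 <= y <= T) (zT : 0 <= z <= T) (tT : 0 <= t <= T) :=
  integrableB measurableT (i x y xT yT) (i z t zT tT).
have e1 : \int[P]_w ((G a w * G c w - G a w * G e w) - (G b w * G c w - G b w * G e w)) =
    (K a c - K a e) - (K b c - K b e).
  by rewrite !RintegralB ?cov_funE//; [exact: i|exact: i|exact: i|exact: i|exact: iB|exact: iB].
rewrite -e1 unlock /Rintegral fineK; last first.
  apply: integrable_fin_num => //.
  exact: (integrableB measurableT (iB _ _ _ _ aT cT aT eT) (iB _ _ _ _ bT cT bT eT)).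
by apply: eq_integral => w _; congr EFin; ring.
Qed.

End covariance.

Section inner_product.
Context (R : realType) (E : completeNormedModType R) (ip : E -> E -> R).
Hypothesis ipP : inner_product ip.

Lemma ip0l w : ip 0 w = 0.
Proof.
have := ip_linear ipP 1 0 0 w; rewrite scale1r addr0 mul1r => h.
by apply: (addrI (ip 0 w)); rewrite -h addr0.
Qed.

Lemma ip_suml n (c : 'I_n -> R) (e : 'I_n -> E) w :
  ip (\sum_(i < n) c i *: e i) w = \sum_(i < n) c i * ip (e i) w.
Proof.
elim: n c e => [|n IH] c e; first by rewrite !big_ord0 ip0l.
by rewrite !big_ord_recl (ip_linear ipP) IH.
Qed.

(** Expressing the inner product by norms makes it continuous. *)
Lemma ip_polarization u v : ip u v = (`|u + v| ^+ 2 - `|u - v| ^+ 2) / 4.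
Proof.
have D x y z : ip (x + y) z = ip x z + ip y z.
  by rewrite -[x]scale1r (ip_linear ipP) mul1r scale1r.
have B x y z : ip (x - y) z = ip x z - ip y z.
  by rewrite addrC -scaleN1r (ip_linear ipP) mulN1r addrC.
rewrite -!(ip_norm ipP) (D u v (u + v)) (B u v (u - v)).
rewrite (ip_sym ipP u (u + v)) (ip_sym ipP v (u + v)).
rewrite (ip_sym ipP u (u - v)) (ip_sym ipP v (u - v)).
rewrite (D u v u) (D u v v) (B u v u) (B u v v) (ip_sym ipP v u).
by field.
Qed.

Lemma ip_cvgl (u : nat -> E) h v : u n @[n --> \oo] --> h ->
  ip (u n) v @[n --> \oo] --> ip h v.
Proof.
move=> uh; rewrite ip_polarization; under eq_cvg do rewrite ip_polarization.
have nsq (w : nat -> E) l : w n @[n --> \oo] --> l -> `|w n| ^+ 2 @[n --> \oo] --> `|l| ^+ 2.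
  by move=> wl; rewrite expr2; under eq_cvg do rewrite expr2; apply: cvgM; exact: cvg_norm.
apply: cvgM; last exact: cvg_cst.
by apply: cvgB; apply: nsq; [apply: cvgD|apply: cvgB] => //; exact: cvg_cst.
Qed.

End inner_product.

Section uniform_limits.
Context {R : realType}.
Implicit Types (T : R) (phi : R -> R).

Lemma unif_within_continuous T phi :
  (forall e, 0 < e -> exists d, 0 < d /\ forall s t, 0 <= s <= T -> 0 <= t <= T ->
     `|s - t| < d -> `|phi s - phi t| <= e) ->
  {within `[0, T], continuous phi}.
Proof.
move=> h; apply/subspace_continuousP => x xT.
apply/cvgrPdist_le => e e0; have [d [d0 hd]] := h e e0.
rewrite near_withinE; exists d => //= y xy yT.
exact: hd.
Qed.

Lemma step_functional_pointwise_cvg T u L (phi_ : nat -> R -> R) phi :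
  is_step_functional T u L ->
  (forall t, 0 <= t <= T -> phi_ n t @[n --> \oo] --> phi t) ->
  L (phi_ n) @[n --> \oo] --> L phi.
Proof.
move=> [m [c [a [b [h _ ->]]]]] cphi.
elim: m c a b h => [|m IH] c a b h.
  by under eq_cvg do rewrite big_ord0; rewrite big_ord0; exact: cvg_cst.
under eq_cvg do rewrite big_ord_recl; rewrite big_ord_recl.
apply: cvgD; last by apply: IH => i; exact: h.
have [a0 ab bT] := h ord0.
apply: cvgM; first exact: cvg_cst.
by apply: cvgB; apply: cphi; lra.
Qed.

End uniform_limits.

Section hilbert.
Context d (Omega : measurableType d) (R : realType) (P : probability Omega R).
Variables (T : R) (G : R -> {RV P >-> R}).
Hypotheses (T0 : 0 < T) (gaussianG : gaussian_process T G).
Hypothesis continuousK : {within `[0, T] `*` `[0, T],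
                    continuous (fun p : R * R => cov_fun G p.1 p.2)}.
Variables (E : completeNormedModType R) (ip : E -> E -> R) (iota : (R -> R) -> E).
Hypothesis hilbertE : associated_hilbert T G ip iota.
Local Notation K := (cov_fun G).
Let ipP := ah_inner hilbertE.

Lemma iota_step n (c a b : 'I_n -> R) : (forall i, [/\ 0 <= a i, a i <= b i & b i <= T]) ->
  iota (fun x => \sum_(i < n) c i * \1_(`[a i, b i[) x) =
  \sum_(i < n) c i *: iota \1_(`[a i, b i[).
Proof.
elim: n c a b => [|n IH] c a b h.
  rewrite big_ord0 (_ : (fun=> _) = (fun=> 0)); last by apply/funext => x; rewrite big_ord0.
  have s0 := step_functional_step (step_functional0 T).
  have := ah_linear hilbertE 1 s0 s0; rewrite scale1r.
  rewrite (_ : (fun x : R => 1 * 0 + 0) = (fun=> 0)); last by apply/funext => x; rewrite mulr0 addr0.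
  by move=> h0; apply: (addrI (iota (fun=> 0))); rewrite -h0 addr0.
rewrite big_ord_recl -IH; last by move=> i; exact: h.
rewrite -(ah_linear hilbertE).
- by congr iota; apply/funext => x; rewrite big_ord_recl.
- by have [h1 h2 h3] := h ord0; exact: step_functional_step (step_functional_indicator h1 h2 h3).
- exists n, (fun i => c (lift ord0 i)), (fun i => a (lift ord0 i)), (fun i => b (lift ord0 i)).
  by split => // i; exact: h.
Qed.

Lemma ip_iota u v L L' : is_step_functional T u L -> is_step_functional T v L' ->
  ip (iota u) (iota v) = L (fun t => L' (K t)).
Proof.
move=> [n [c [a [b [h -> ->]]]]] [n' [c' [a' [b' [h' -> ->]]]]].
rewrite !iota_step// (ip_suml ipP); apply: eq_bigr => i _; congr (_ * _).
rewrite (ip_sym ipP) (ip_suml ipP) -sumrB; apply: eq_bigr => j _.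
rewrite -mulrBr; congr (_ * _); rewrite (ip_sym ipP).
have [a0 ab bT] := h i; have [a0' ab' bT'] := h' j.
apply: EFin_inj; rewrite (ah_indic hilbertE) ?a0 ?a0'//.
by rewrite (expectation_increments gaussianG)//; apply/andP; split; lra.
Qed.

(** The squared norm is the double step functional of the covariance. Its inner
    functional is close to a sum over a grid, small when the values of w at
    the nodes are. *)
Lemma step_norm_bound w L M dd e c N x : is_step_functional T w L ->
  (total_variation 0 T w <= M%:E)%E -> is_grid T dd N x -> 0 <= c ->
  (forall s s' t t', 0 <= s <= T -> 0 <= s' <= T -> 0 <= t <= T -> 0 <= t' <= T ->
     `|s - s'| < dd -> `|t - t'| < dd -> `|K s t - K s' t'| <= e) ->
  (forall s t, 0 <= s <= T -> 0 <= t <= T -> `|K s t| <= c) ->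
  `|iota w| ^+ 2 <= 2 * M * (2 * M * e + c * \sum_(0 <= i < N) `|w (x i.+1) - w (x i)|).
Proof.
move=> wL wM gx c0 unif Kc.
rewrite -(ip_norm ipP) (ip_iota wL wL) (le_trans (ler_norm _))//.
apply: (step_functional_bound T0 wL wM) => t tT.
have h1 : `|L (K t) - grid_sum N x w (K t)| <= 2 * M * e.
  apply: (step_functional_near_grid T0 gx wL wM) => s s' sT s'T ss'.
  by apply: unif => //; rewrite subrr normr0 (le_lt_trans _ ss').
have h2 : `|grid_sum N x w (K t)| <= c * \sum_(0 <= i < N) `|w (x i.+1) - w (x i)|.
  rewrite (le_trans (ler_norm_sum _ _ _))// big_distrr/=.
  rewrite !big_nat; apply: ler_sum => i /andP[_ iN]; rewrite normrM ler_wpM2r//.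
  have [_ _ gxi] := gx; have [_ /andP[xi xiT] _] := gxi i iN.
  by apply: Kc => //; rewrite xiT ltW.
rewrite -(subrK (grid_sum N x w (K t)) (L (K t))).
by rewrite (le_trans (ler_normD _ _))// lerD.
Qed.

Lemma bv_approx_out u f t : bv_approx T u f -> u n t @[n --> \oo] --> ext0 T f t.
Proof.
move=> [us _ uf]; rewrite /ext0; case: ifPn => [|tT]; first exact: uf.
apply: cvg_near_cst; near=> n; have [L uL] := step_functional_exists (us n).
by rewrite (step_fun_out uL).
Unshelve. all: by end_near. Qed.

Lemma total_variation_sub (u v : R -> R) (M M' : R) :
  (total_variation 0 T u <= M%:E)%E -> (total_variation 0 T v <= M'%:E)%E ->
  (total_variation 0 T (fun x => (-1) * v x + u x)%R <= (M' + M)%:E)%E.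
Proof.
move=> uM vM.
have -> : (fun x => -1 * v x + u x) = (\- v) \+ u by apply/funext => x /=; rewrite mulN1r.
apply: (le_trans (total_variation_le _ _ (ltW T0))).
by rewrite total_variationN EFinD leeD.
Qed.

(** The difference of two approximations of the same f has bounded variation
    and tends to 0 at every node of a fixed grid. *)
Lemma bv_approx_close f u v eps : bv_approx T u f -> bv_approx T v f -> 0 < eps ->
  exists n0, forall n m, (n0 <= n)%N -> (n0 <= m)%N -> `|iota (u n) - iota (v m)| < eps.
Proof.
move=> uf vf eps0.
have [us [M uM] _] := uf; have [vs [M' vM] _] := vf.
pose M2 := M' + M.
have M20 : 0 <= M2.
  rewrite /M2 addr_ge0// -lee_fin.
    by apply: le_trans (vM 0%N); apply: total_variation_ge0; exact: ltW.
  by apply: le_trans (uM 0%N); apply: total_variation_ge0; exact: ltW.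
have [c [c0 Kc]] := compact_fun_bounded (compact_setX (@segment_compact _ 0 T)
  (@segment_compact _ 0 T)) continuousK.
(* With e and h below, each of the two terms of the bound on the squared norm
   of the difference is at most eps ^ 2 / 4. *)
pose e := eps ^+ 2 / (16 * (M2 + 1) ^+ 2).
have e2 : 0 < eps ^+ 2 by rewrite exprn_gt0.
have M21 : 0 < M2 + 1 by lra.
have e0 : 0 < e by rewrite /e divr_gt0// mulr_gt0// exprn_gt0.
have eE : 16 * (M2 + 1) ^+ 2 * e = eps ^+ 2 by rewrite /e; field; rewrite gt_eqF.
pose h := eps ^+ 2 / (32 * (M2 + 1) * (c + 1)).
have c1 : 0 < c + 1 by lra.
have h0 : 0 < h by rewrite /h divr_gt0// !mulr_gt0.
have hE : 32 * (M2 + 1) * (c + 1) * h = eps ^+ 2.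
  by rewrite /h; field; rewrite !gt_eqF.
have [dd [dd0 unif]] := @square_unif_continuous _ T K e continuousK e0.
have [N [x [gx _]]] := grid_exists (countable0 R) T0 dd0.
pose sg (u : nat -> R -> R) n := \sum_(0 <= i < N) (`|u n (x i.+1) - ext0 T f (x i.+1)|
   + `|u n (x i) - ext0 T f (x i)|).
have sg0 w : bv_approx T w f -> sg w n @[n --> \oo] --> 0.
  move=> wf; rewrite /sg; elim: N {gx sg} => [|N IH].
    by under eq_cvg do rewrite big_nil; exact: cvg_cst.
  under eq_cvg do rewrite big_nat_recr//=.
  have one y : `|w n y - ext0 T f y| @[n --> \oo] --> (0 : R).
    have : (w n y - ext0 T f y) @[n --> \oo] --> ext0 T f y - ext0 T f y.
      by apply: cvgB; [exact: bv_approx_out|exact: cvg_cst].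
    by move=> /cvg_norm; rewrite subrr normr0.
  have := cvgD IH (cvgD (one (x N.+1)) (one (x N))); rewrite !addr0 => hh; exact: (hh _ _).
have /cvgrPdist_le/(_ h h0)[n1 _ H1] := sg0 u uf.
have /cvgrPdist_le/(_ h h0)[n2 _ H2] := sg0 v vf.
exists (maxn n1 n2) => n m; rewrite !geq_max => /andP[nn1 _] /andP[_ mn2].
have {}H1 := H1 n nn1; have {}H2 := H2 m mn2.
have [L uL] := step_functional_exists (us n); have [L' vL] := step_functional_exists (vs m).
have wL := step_functional_comb (-1) vL uL.
have := step_norm_bound wL (total_variation_sub (uM n) (vM m)) gx c0 unif _.
rewrite (ah_linear hilbertE)// scaleN1r addrC -/M2 => bnd0.
have Kc' s t : 0 <= s <= T -> 0 <= t <= T -> `|K s t| <= c.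
  by move=> sT tT; apply: (Kc (s, t)); split; rewrite /= in_itv.
have {bnd0} := bnd0 Kc'.
set S := \sum_(0 <= i < N) _.
have Sle : S <= 2 * h.
  apply: (@le_trans _ _ (sg u n + sg v m)).
    rewrite /sg /S -big_split; apply: ler_sum => i _ /=.
    set a := x i.+1; set b := x i.
    rewrite (_ : _ - _ = (u n a - ext0 T f a) - (u n b - ext0 T f b)
      - ((v m a - ext0 T f a) - (v m b - ext0 T f b))); last by ring.
    by rewrite (le_trans (ler_normB _ _))// lerD// ler_normB.
  move: H1 H2; rewrite /= !sub0r !normrN => H1 H2.
  by have := ler_norm (sg u n); have := ler_norm (sg v m); lra.
have S0 : 0 <= S by rewrite /S sumr_ge0.
move=> bnd.
rewrite -(@ltr_pXn2r _ 2)// ?nnegrE//; last exact: ltW.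
apply: (le_lt_trans bnd).
have A1 : 4 * M2 * M2 * e <= 4 * (M2 + 1) ^+ 2 * e.
  by rewrite ler_wpM2r ?(ltW e0)// expr2 -!mulrA ler_wpM2l//; nra.
have A2 : 2 * M2 * (c * S) <= 4 * (M2 + 1) * (c + 1) * h.
  apply: (@le_trans _ _ (2 * M2 * (c * (2 * h)))).
    by rewrite !ler_wpM2l// mulr_ge0.
  have := mulr_ge0 M20 (ltW h0); have := mulr_ge0 c0 (ltW h0); nra.
nra.
Qed.

(** Approximations of f are Cauchy, and any two of them have the same limit. *)
Lemma represents_exists f : bounded_variation 0 T f -> exists h, represents T iota f h.
Proof.
move=> bvf; have [u uf] := bv_approx_exists T0 bvf.
have cu : cvg (iota (u n) @[n --> \oo]).
  apply/cauchy_cvgP/cauchy_exP => eps eps0.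
  have [n0 hn0] := bv_approx_close uf uf eps0.
  by exists (iota (u n0)), n0 => // n /= nn0; rewrite -ball_normE /=; exact: hn0.
exists (lim (iota (u n) @[n --> \oo])); split; first by exists u.
move=> v vf; apply/cvgrPdist_lt => eps eps0.
have eps2 : 0 < eps / 2 by rewrite divr_gt0.
have [n0 hn0] := bv_approx_close uf vf eps2.
have /cvgrPdist_lt/(_ _ eps2)[n1 _ hn1] := cu.
exists n0 => // n /= nn0.
have h1 := hn1 (maxn n0 n1) (leq_maxr _ _).
have h2 := hn0 (maxn n0 n1) n (leq_maxl _ _) nn0.
rewrite -(subrKA (iota (u (maxn n0 n1)))) (le_lt_trans (ler_normD _ _))//.
by rewrite [eps]splitr ltrD.
Qed.

End hilbert.

(** * Fubini's theorem, and the double integral of the covariance *)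

Section rectangle_fubini.
Context d1 d2 (T1 : measurableType d1) (T2 : measurableType d2) (R : realType).
Variables (m1 : {sigma_finite_measure set T1 -> \bar R})
          (m2 : {sigma_finite_measure set T2 -> \bar R}).
Variables (A : set T1) (B : set T2) (mA : measurable A) (mB : measurable B).
Local Open Scope ereal_scope.

Lemma restrict_rectangleE (F : T1 * T2 -> \bar R) x y :
  (F \_ (A `*` B)) (x, y) = ((fun x => (fun y => F (x, y)) \_ B) \_ A) x y.
Proof.
rewrite !patchE; case: ifPn => xyAB; case: ifPn => xA; rewrite ?patchE //.
- by move: xyAB xA; rewrite inE => -[/= Ax By]; rewrite (mem_set By).
- by move: xyAB xA; rewrite inE => -[/= Ax By]; rewrite (mem_set Ax).
- case: ifPn => // yB; move: xyAB xA yB; rewrite !inE notin_setE => nAB Ax By.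
  by exfalso; apply: nAB.
Qed.

Lemma restrict_rectangle1 (F : T1 * T2 -> \bar R) y :
  (fun x => (F \_ (A `*` B)) (x, y)) =
  if y \in B then (fun x => F (x, y)) \_ A else cst 0.
Proof.
apply/funext => x; rewrite restrict_rectangleE patchE; case: (boolP (y \in B)) => yB.
  by rewrite !patchE; case: ifPn => xA //; rewrite patchE yB.
by case: ifPn => xA //; rewrite patchE (negbTE yB).
Qed.

Lemma restrict_rectangle2 (F : T1 * T2 -> \bar R) x :
  (fun y => (F \_ (A `*` B)) (x, y)) =
  if x \in A then (fun y => F (x, y)) \_ B else cst 0.
Proof.
apply/funext => y; rewrite restrict_rectangleE patchE; case: (boolP (x \in A)) => xA //.
Qed.

Let mAB : measurable (A `*` B). Proof. exact: measurableX. Qed.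

Lemma rectangle_fubini21 (F : T1 * T2 -> \bar R) :
  (m1 \x m2).-integrable (A `*` B) F ->
  \int[m1 \x m2]_(p in A `*` B) F p = \int[m2]_(y in B) \int[m1]_(x in A) F (x, y).
Proof.
move=> /(integrable_mkcond _ mAB) iF.
rewrite integral_mkcond -integral21_prod_meas1// [RHS]integral_mkcond.
apply: eq_integral => y _; rewrite /fubini_G restrict_rectangle1 patchE.
by case: ifPn => yB; [rewrite [RHS]integral_mkcond|rewrite integral0].
Qed.

Lemma rectangle_fubini12 (F : T1 * T2 -> \bar R) :
  (m1 \x m2).-integrable (A `*` B) F ->
  \int[m1 \x m2]_(p in A `*` B) F p = \int[m1]_(x in A) \int[m2]_(y in B) F (x, y).
Proof.
move=> /(integrable_mkcond _ mAB) iF.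
rewrite integral_mkcond -integral12_prod_meas1// [RHS]integral_mkcond.
apply: eq_integral => x _; rewrite /fubini_F restrict_rectangle2 patchE.
by case: ifPn => xA; [rewrite [RHS]integral_mkcond|rewrite integral0].
Qed.

Lemma rectangle_fubini_integrable (F : T1 * T2 -> \bar R) :
  (m1 \x m2).-integrable (A `*` B) F ->
  m1.-integrable A (fun x => \int[m2]_(y in B) F (x, y)).
Proof.
move=> /(integrable_mkcond _ mAB) iF.
apply/(integrable_mkcond _ mA); apply: eq_integrable (integrable_fubini_F iF) => //.
move=> x _; rewrite /fubini_F restrict_rectangle2 patchE.
by case: ifPn => xA; [rewrite [RHS]integral_mkcond|rewrite integral0].
Qed.

Lemma rectangle_tonelli21 (F : T1 * T2 -> \bar R) : measurable_fun (A `*` B) F ->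
  (forall p, (A `*` B) p -> 0 <= F p) ->
  \int[m1 \x m2]_(p in A `*` B) F p = \int[m2]_(y in B) \int[m1]_(x in A) F (x, y).
Proof.
move=> /(measurable_restrictT _ mAB) mF F0.
have F0' p : 0 <= (F \_ (A `*` B)) p by apply: erestrict_ge0 => q; exact: F0.
rewrite integral_mkcond fubini_tonelli2// [RHS]integral_mkcond.
apply: eq_integral => y _; rewrite /fubini_G restrict_rectangle1 patchE.
by case: ifPn => yB; [rewrite [RHS]integral_mkcond|rewrite integral0].
Qed.

Lemma rectangle_tonelli_measurable2 (F : T1 * T2 -> \bar R) : measurable_fun (A `*` B) F ->
  (forall p, (A `*` B) p -> 0 <= F p) ->
  measurable_fun B (fun y => \int[m1]_(x in A) F (x, y)).
Proof.
move=> /(measurable_restrictT _ mAB) mF F0.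
have F0' p : 0 <= (F \_ (A `*` B)) p by apply: erestrict_ge0 => q; exact: F0.
apply/(measurable_restrictT _ mB).
rewrite (_ : _ \_ _ = fubini_G m1 (F \_ (A `*` B))).
  exact: measurable_fun_fubini_tonelli_G.
apply/funext => y; rewrite /fubini_G restrict_rectangle1 patchE.
by case: ifPn => yB; [rewrite [LHS]integral_mkcond|rewrite integral0].
Qed.

Lemma rectangle_tonelli12 (F : T1 * T2 -> \bar R) : measurable_fun (A `*` B) F ->
  (forall p, (A `*` B) p -> 0 <= F p) ->
  \int[m1 \x m2]_(p in A `*` B) F p = \int[m1]_(x in A) \int[m2]_(y in B) F (x, y).
Proof.
move=> /(measurable_restrictT _ mAB) mF F0.
have F0' p : 0 <= (F \_ (A `*` B)) p by apply: erestrict_ge0 => q; exact: F0.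
rewrite integral_mkcond fubini_tonelli1// [RHS]integral_mkcond.
apply: eq_integral => x _; rewrite /fubini_F restrict_rectangle2 patchE.
by case: ifPn => xA; [rewrite [RHS]integral_mkcond|rewrite integral0].
Qed.

Lemma rectangle_tonelli_measurable1 (F : T1 * T2 -> \bar R) : measurable_fun (A `*` B) F ->
  (forall p, (A `*` B) p -> 0 <= F p) ->
  measurable_fun A (fun x => \int[m2]_(y in B) F (x, y)).
Proof.
move=> /(measurable_restrictT _ mAB) mF F0.
have F0' p : 0 <= (F \_ (A `*` B)) p by apply: erestrict_ge0 => q; exact: F0.
apply/(measurable_restrictT _ mA).
rewrite (_ : _ \_ _ = fubini_F m2 (F \_ (A `*` B))).
  exact: measurable_fun_fubini_tonelli_F.
apply/funext => x; rewrite /fubini_F restrict_rectangle2 patchE.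
by case: ifPn => xA; [rewrite [LHS]integral_mkcond|rewrite integral0].
Qed.

End rectangle_fubini.

Section square_measurability.
Context {R : realType}.
Local Notation RT := (measurableTypeR R).

Lemma measurable_square (T : R) : measurable (square T).
Proof. by apply: measurableX; exact: measurable_segment. Qed.

(** A continuous kernel is the limit of the kernels obtained by freezing its
    first variable on each cell of a grid. *)
Lemma measurable_continuous_square (T : R) (K : R -> R -> R) : 0 < T ->
  {within `[0, T] `*` `[0, T], continuous (fun p : R * R => K p.1 p.2)} ->
  measurable_fun (square T) (fun p => K p.1 p.2).
Proof.
move=> T0 cK.
have cKs t : 0 <= t <= T -> measurable_fun (`[0, T]%classic : set RT) (K t).
  move=> tT; apply: measurable_continuous_segment; apply: unif_within_continuous => e e0.
  have [dd [dd0 unif]] := square_unif_continuous cK e0.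
  exists dd; split => // s s' sT s'T ss'; apply: unif => //.
  by rewrite subrr normr0.
have gr n : {g : RT * RT -> R | measurable_fun (square T) g /\
    forall p, square T p -> `|K p.1 p.2 - g p| <= n.+1%:R^-1}.
  apply: cid; have n0 : 0 < n.+1%:R^-1 :> R by rewrite invr_gt0.
  have [dd [dd0 unif]] := square_unif_continuous cK n0.
  have [N [x [gx _]]] := grid_exists (countable0 R) T0 dd0.
  exists (fun p => grid_fun N x (K ^~ p.2) p.1); split; last first.
    move=> [t s] [] /=; rewrite !in_itv/= => tT sT.
    apply: (grid_fun_close gx) tT => u v uT vT uv.
    by apply: unif => //; rewrite subrr normr0.
  have [_ _ gxi] := gx; rewrite /grid_fun.
  under eq_fun do rewrite big_mkord; apply: measurable_sum => i.
  have [_ /andP[/ltW xi0 xiT] _] := gxi _ (ltn_ord i).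
  apply: measurable_funM.
    apply: (measurable_comp (F := `[0, T]%classic : set RT)) (measurable_segment T) _ _ _.
    - by move=> _ [p [_ pT] <-].
    - by apply: cKs; rewrite xi0.
    - exact: measurable_funTS.
  by apply: (measurable_comp (F := setT)) => //; exact: measurable_funTS.
apply: (@measurable_fun_cvg _ _ _ _ (fun n => sval (gr n))).
  by move=> n; case: (gr n) => g [].
move=> p pT; apply/cvgrPdist_le => e e0.
exists (Num.truncn e^-1) => // n /= hn; case: (gr n) => g [_ gp] /=.
apply: (le_trans (gp p pT)); rewrite invf_ple ?posrE//.
by apply: le_trans (ltW (truncnS_gt _)) _; rewrite ler_nat ltnS.
Qed.

End square_measurability.

Section iterated_charges.
Context {R : realType}.
Local Notation RT := (measurableTypeR R).
Variables (T c : R) (K : R -> R -> R).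
Hypotheses (T0 : 0 < T) (c0 : 0 <= c).
Hypothesis mK : measurable_fun (square T) (fun p => K p.1 p.2).
Hypothesis Kc : forall t s, 0 <= t <= T -> 0 <= s <= T -> `|K t s| <= c.

Lemma measurable_section s : 0 <= s <= T ->
  measurable_fun (`[0, T]%classic : set RT) (K ^~ s).
Proof.
move=> sT; apply: (measurable_comp (F := square T) (f := fun p => K p.1 p.2)
   (g := fun t : RT => (t, s : RT))) => //.
- exact: measurable_square.
- by move=> _ [t tT <-]; split => //=; rewrite in_itv.
- exact: measurable_funTS.
Qed.

Lemma finite_measures_fubini (m1 m2 : {finite_measure set RT -> \bar R}) :
  (\int[m1 \x m2]_(p in square T) (K p.1 p.2)%:E)%E =
  (\int[m2]_(s in `[0, T]) \int[m1]_(t in `[0, T]) K t s)%:E.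
Proof.
have mD := measurable_segment T.
have iK : (m1 \x m2)%E.-integrable (square T) (fun p => (K p.1 p.2)%:E).
  apply: (@measurable_bounded_integrable _ _ _ (m1 \x m2)%E (fun p : RT * RT => K p.1 p.2) (square T)) => //.
  - exact: measurable_square.
  - rewrite [ltLHS](_ : _ = (m1 `[0%R, T]%classic * m2 `[0%R, T]%classic)%E); last exact: product_measure1E.
    by rewrite lte_mul_pinfty// ?fin_num_measure// ltey_eq fin_num_measure.
  - exists c; split; first exact: num_real.
    move=> M cM [t s] [/=]; rewrite !in_itv/= => tT sT.
    by apply: le_trans (Kc tT sT) _; exact: ltW.
have inner s : 0 <= s <= T -> m1.-integrable `[0, T]%classic (fun t => (K t s)%:E).
  move=> sT; apply: (@bounded_finite_integrable _ _ _ m1 _ mD (K ^~ s) c (measurable_section sT)).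
  by move=> t /=; rewrite in_itv/= => tT; exact: Kc.
have fin := integrable_fin_num (measurable_square T) iK.
rewrite -[LHS]fineK//; congr EFin; rewrite /square (rectangle_fubini21 mD mD iK).
rewrite /Rintegral; congr fine; apply: eq_integral => s; rewrite inE/= in_itv/= => sT.
by rewrite fineK//; apply: integrable_fin_num => //; exact: inner.
Qed.

Hypothesis mI : forall m : {finite_measure set RT -> \bar R},
  measurable_fun (`[0, T]%classic : set RT) (fun s => \int[m]_(t in `[0, T]) K t s).

(** The four products of Jordan parts are finite measures and the kernel is
    bounded, so that Fubini's theorem applies to each. *)
Lemma integral_charge_chargeE (mu nu : {charge set RT -> \bar R}) :
  integral_charge_charge mu nu (square T) (fun p => (K p.1 p.2)%:E) =
  (charge_integral nu T (fun s => charge_integral mu T (fun t => K t s)))%:E.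
Proof.
have mD := measurable_segment T.
rewrite /integral_charge_charge /integral_measure_charge !finite_measures_fubini.
rewrite -!EFinB; congr EFin; rewrite /charge_integral.
have bnd (m : {finite_measure set RT -> \bar R}) (n : {finite_measure set RT -> \bar R}) :
    n.-integrable `[0, T]%classic (EFin \o (fun s => \int[m]_(t in `[0, T]) K t s)).
  apply: (@bounded_finite_integrable _ _ _ n _ mD _ (c * fine (m setT)) (mI m)) => s /=.
  rewrite in_itv/= => sT; apply: finite_Rintegral_bound => //.
    exact: measurable_section.
  by move=> t /=; rewrite in_itv/= => tT; exact: Kc.
by rewrite !RintegralB//; [ring|exact: bnd..].
Qed.

End iterated_charges.

Section continuous_kernel.
Context {R : realType}.
Local Notation RT := (measurableTypeR R).
Variables (T : R) (K : R -> R -> R).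
Hypothesis continuousK : {within `[0, T] `*` `[0, T],
                    continuous (fun p : R * R => K p.1 p.2)}.

Lemma kernel_bound : exists c : R, 0 <= c /\
  forall t s, 0 <= t <= T -> 0 <= s <= T -> `|K t s| <= c.
Proof.
have [c [c0 Kc]] := compact_fun_bounded (compact_setX (@segment_compact _ 0 T)
  (@segment_compact _ 0 T)) continuousK.
by exists c; split => // t s tT sT; apply: (Kc (t, s)); split; rewrite /= in_itv.
Qed.

Lemma kernel_continuous1 s : 0 <= s <= T -> {within `[0, T], continuous (K ^~ s)}.
Proof.
move=> sT; apply: unif_within_continuous => e e0.
have [dd [dd0 unif]] := @square_unif_continuous _ T K e continuousK e0.
exists dd; split => // t t' tT t'T tt'; apply: unif => //.
by rewrite subrr normr0.
Qed.

Lemma kernel_integral_continuous (m : {finite_measure set RT -> \bar R}) :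
  {within `[0, T], continuous (fun s => \int[m]_(t in `[0, T]) K t s)}.
Proof.
have mD := measurable_segment T.
have [c [c0 Kc]] := kernel_bound.
have m0 : 0 <= fine (m setT) by rewrite fine_ge0.
have mK s (sT : 0 <= s <= T) := measurable_continuous_segment (kernel_continuous1 sT).
apply: unif_within_continuous => e e0.
pose e' := e / (fine (m setT) + 1).
have m1 : 0 < fine (m setT) + 1 by lra.
have e'0 : 0 < e' by rewrite divr_gt0.
have e'E : e' * (fine (m setT) + 1) = e by rewrite /e' divfK// gt_eqF.
have [dd [dd0 unif]] := @square_unif_continuous _ T K e' continuousK e'0.
exists dd; split => // s s' sT s'T ss'.
have i u : 0 <= u <= T -> m.-integrable `[0, T]%classic (EFin \o (K ^~ u)).
  move=> uT; apply: (@bounded_finite_integrable _ _ _ m _ mD _ c (mK _ uT)).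
  by move=> t /=; rewrite in_itv/= => tT; exact: Kc.
rewrite -RintegralB//; [|exact: i|exact: i].
apply: (@le_trans _ _ (e' * fine (m setT))); last by nra.
apply: finite_Rintegral_bound => //; first exact: ltW.
  by apply: measurable_funB; exact: mK.
move=> t /=; rewrite in_itv/= => tT; apply: unif => //.
by rewrite subrr normr0.
Qed.

Lemma kernel_charge_integral_continuous (nu : {charge set RT -> \bar R}) :
  {within `[0, T], continuous (fun s => charge_integral nu T (K ^~ s))}.
Proof.
by apply: within_continuousB; exact: kernel_integral_continuous.
Qed.

End continuous_kernel.

Section hilbert_formula.
Context d (Omega : measurableType d) (R : realType) (P : probability Omega R).
Variables (T : R) (G : R -> {RV P >-> R}).
Hypotheses (T0 : 0 < T) (gaussianG : gaussian_process T G).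
Hypothesis continuousK : {within `[0, T] `*` `[0, T],
                    continuous (fun p : R * R => cov_fun G p.1 p.2)}.
Variables (E : completeNormedModType R) (ip : E -> E -> R) (iota : (R -> R) -> E).
Hypothesis hilbertE : associated_hilbert T G ip iota.
Local Notation K := (cov_fun G).
Local Notation RT := (measurableTypeR R).
Let ipP := ah_inner hilbertE.

(** Weak convergence of the approximating step functionals, once in each
    variable. *)
Lemma ip_represents f g hf hg : bounded_variation 0 T f -> bounded_variation 0 T g ->
  represents T iota f hf -> represents T iota g hg ->
  ip hf hg = charge_integral (nu_ T g) T
    (fun s => charge_integral (nu_ T f) T (fun t => K t s)).
Proof.
move=> bvf bvg [[u uf] rf] [[v vg] rg].
have [us [Mu uM] ucv] := uf; have [vs [Mv vM] vcv] := vg.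
have uh := rf u uf; have vh := rg v vg.
have Lu n : {L | is_step_functional T (u n) L} by apply: cid; exact: step_functional_exists.
have Lv n : {L | is_step_functional T (v n) L} by apply: cid; exact: step_functional_exists.
pose psi s := charge_integral (nu_ T f) T (fun t => K t s).
have ip_step n m : ip (iota (u n)) (iota (v m)) =
    sval (Lv m) (fun s => sval (Lu n) (K ^~ s)).
  rewrite (ip_sym ipP) (ip_iota gaussianG hilbertE (svalP (Lv m)) (svalP (Lu n))).
  congr (sval _ _); apply/funext => s; congr (sval _ _); apply/funext => t.
  exact: cov_fun_sym.
have step1 m : ip hf (iota (v m)) = sval (Lv m) psi.
  have h1 := @ip_cvgl _ _ _ ipP _ _ (iota (v m)) uh.
  have h2 : sval (Lv m) (fun s => sval (Lu n) (K ^~ s)) @[n --> \oo] --> sval (Lv m) psi.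
    apply: (step_functional_pointwise_cvg (svalP (Lv m))) => s sT.
    exact: (step_functional_cvg T0 bvf (fun n => svalP (Lu n)) uM ucv (kernel_continuous1 continuousK sT)).
  move: h1; under eq_cvg do rewrite ip_step.
  by move=> /(cvg_lim (@Rhausdorff R)) <-; exact: (cvg_lim (@Rhausdorff R) h2).
have h1 : ip hf (iota (v m)) @[m --> \oo] --> ip hf hg.
  by under eq_cvg do rewrite (ip_sym ipP); rewrite (ip_sym ipP); exact: ip_cvgl.
have h2 : sval (Lv m) psi @[m --> \oo] --> charge_integral (nu_ T g) T psi.
  apply: (step_functional_cvg T0 bvg (fun n => svalP (Lv n)) vM vcv).
  exact: kernel_charge_integral_continuous.
move: h1; under eq_cvg do rewrite step1.
by move=> /(cvg_lim (@Rhausdorff R)) <-; exact: (cvg_lim (@Rhausdorff R) h2).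
Qed.

Lemma ip_charge_formula f g hf hg : bounded_variation 0 T f -> bounded_variation 0 T g ->
  represents T iota f hf -> represents T iota g hg ->
  (ip hf hg)%:E = integral_charge_charge (nu_ T f) (nu_ T g) (square T)
                    (fun p => (K p.1 p.2)%:E).
Proof.
move=> bvf bvg rf rg.
have [c [c0 Kc]] := kernel_bound continuousK.
rewrite (ip_represents bvf bvg rf rg) (integral_charge_chargeE c0 _ Kc)//.
  exact: measurable_continuous_square.
move=> m; apply: measurable_continuous_segment; exact: kernel_integral_continuous.
Qed.

Lemma step_fun_bounded_variation u : step_fun T u -> bounded_variation 0 T u.
Proof.
have BVjump (c y : R) : bounded_variation 0 T (fun x => c * (y <= x)%R%:R).
  have nd (c' : R) : 0 <= c' -> bounded_variation 0 T (fun x => c' * (y <= x)%R%:R).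
    move=> c0; apply: nondecreasing_bounded_variation => x x' _ _ xx'.
    rewrite ler_wpM2l// ler_nat; case: (leP y x) => // yx.
    by rewrite (le_trans yx xx').
  have [c0|/ltW c0] := leP 0 c; first exact: nd.
  rewrite (_ : (fun x => _) = \- (fun x => (- c) * (y <= x)%R%:R)).
    by apply: bounded_variationN; apply: nd; rewrite oppr_ge0.
  by apply/funext => x /=; rewrite mulNr opprK.
move=> [n [c [a [b [h ->]]]]]; elim: n c a b h => [|n IH] c a b h.
  rewrite (_ : (fun=> _) = fun=> 0); last by apply/funext => x; rewrite big_ord0.
  exact: nondecreasing_bounded_variation.
rewrite (_ : (fun x => _) = ((fun x => c ord0 * (a ord0 <= x)%R%:R) \+
    (fun x => (- c ord0) * (b ord0 <= x)%R%:R)) \+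
    (fun x => \sum_(i < n) c (lift ord0 i) * \1_(`[a (lift ord0 i), b (lift ord0 i)[) x)).
  apply: bounded_variationD => //; last by apply: IH => i; exact: h.
  by apply: bounded_variationD => //; exact: BVjump.
apply/funext => x; rewrite big_ord_recl /=; congr (_ + _); rewrite indic_itvco.
have [a0 ab bT] := h ord0.
by have [h1|h1] := leP (a ord0) x; have [h2|h2] := ltP x (b ord0);
  rewrite /= ?mulr1 ?mulr0 ?addr0 ?add0r ?subrr//; exfalso; lra.
Qed.

Lemma represents_step u : step_fun T u -> represents T iota u (iota u).
Proof.
move=> su; have uu : bv_approx T (fun=> u) u.
  split=> //; last by move=> t _; exact: cvg_cst.
  have := step_fun_bounded_variation su.
  move=> /(bounded_variationP _ (ltW T0)) fin.
  by exists (fine (total_variation 0 T u)) => _; rewrite fineK.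
have [h [ex hP]] := represents_exists T0 gaussianG continuousK hilbertE (step_fun_bounded_variation su).
have e : iota u = h.
  by rewrite -(cvg_lim (@norm_hausdorff _ E) (hP _ uu)); apply/esym/cvg_lim => //; exact: cvg_cst.
by rewrite e; split.
Qed.

Lemma represents_unique f h h' : represents T iota f h -> represents T iota f h' -> h = h'.
Proof.
move=> [[u uf] r] [_ r'].
by rewrite -(cvg_lim (@norm_hausdorff _ E) (r _ uf)) -(cvg_lim (@norm_hausdorff _ E) (r' _ uf)).
Qed.

End hilbert_formula.

(** * The fundamental theorem of calculus for integrable derivatives *)

Section difference_quotients.
Context {R : realType}.
Implicit Types (F phi : R -> R).

Lemma is_derive_continuous F (x l : R) : is_derive x 1 F l -> {for x, continuous F}.
Proof.
by move=> [dF _]; apply: differentiable_continuous; exact/derivable1_diffP.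
Qed.

Lemma is_derive_quotient_cvg F (x l : R) : is_derive x 1 F l ->
  (F (x + n.+1%:R^-1) - F x) / n.+1%:R^-1 @[n --> \oo] --> l.
Proof.
move=> [dF <-].
have h : (fun h : R => h^-1 *: (F (h *: (1 : R) + x) - F x)) @ 0^' --> 'D_1 F x by exact: dF.
have hn : (n.+1%:R^-1 : R) @[n --> \oo] --> (0 : R)^'.
  move=> A [e /= e0 hA]; have [N _ hN] := near_infty_natSinv_lt (PosNum e0).
  exists N => // n /hN /= ne; apply: hA => /=; last by rewrite gt_eqF.
  by rewrite sub0r normrN ger0_norm// invr_ge0.
have := cvg_comp _ _ hn h; apply: cvg_trans; apply: near_eq_cvg; near=> n => /=.
by rewrite /GRing.scale /= mulr1 (addrC x) mulrC.
Unshelve. all: by end_near. Qed.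

Lemma derive_lipschitz F phi (c d M : R) :
  (forall x, c <= x <= d -> is_derive x 1 F (phi x)) ->
  (forall x, c <= x <= d -> `|phi x| <= M) ->
  forall x y, c <= x <= d -> c <= y <= d -> `|F x - F y| <= M * `|x - y|.
Proof.
move=> dF bphi.
have le x y : c <= x <= d -> c <= y <= d -> x <= y -> `|F x - F y| <= M * `|x - y|.
  move=> /andP[cx xd] /andP[cy yd] xy.
  have [||z zxy e] := @MVT_segment _ F phi x y xy.
  - by move=> z; rewrite in_itv/= => /andP[xz zy]; apply: dF; lra.
  - apply: continuous_in_subspaceT => z; rewrite inE/= in_itv/= => /andP[xz zy].
    by apply: is_derive_continuous; apply: dF; lra.
  rewrite distrC e (distrC x) normrM ler_wpM2r//; apply: bphi.
  by move: zxy; rewrite in_itv/= => /andP[xz zy]; lra.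
move=> x y xcd ycd; have [xy|/ltW xy] := leP x y; first exact: le.
by rewrite distrC (distrC x); exact: le.
Qed.

(** Composition with clamp extends a Lipschitz function on [c, d] to the
    line, where difference quotients are defined everywhere. *)
Definition clamp (c d x : R) : R := if x <= c then c else if d <= x then d else x.

Lemma clamp_lipschitz (c d x y : R) : c <= d -> `|clamp c d x - clamp c d y| <= `|x - y|.
Proof.
move=> cd; have h (u v : R) : u <= v -> `|clamp c d u - clamp c d v| <= `|u - v|.
  move=> uv; rewrite (distrC u) (distrC (clamp c d u)).
  rewrite (ger0_norm (x := v - u)) ?subr_ge0// ler_norml /clamp.
  by case: (leP u c) => ?; case: (leP v c) => ?; case: (leP d u) => ?; case: (leP d v) => ?; lra.
have [xy|/ltW xy] := leP x y; first exact: h.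
by rewrite distrC (distrC x); exact: h.
Qed.

Lemma clamp_in (c d x : R) : c <= d -> c <= clamp c d x <= d.
Proof.
by move=> cd; rewrite /clamp; case: (leP x c) => ?; case: (leP d x) => ?; lra.
Qed.

Lemma clamp_id (c d x : R) : c <= x <= d -> clamp c d x = x.
Proof.
move=> /andP[cx xd]; rewrite /clamp; case: (leP x c) => xc; first by lra.
by case: (leP d x) => dx; lra.
Qed.

End difference_quotients.

Section FTC.
Context {R : realType}.
Local Notation mu := (@lebesgue_measure R).
Implicit Types (F phi : R -> R).

(** The integral of a difference quotient is a difference of means, hence
    converges by continuity alone. *)
Lemma continuous_mean_cvg F (c d : R) : c < d -> continuous F ->
  (\int[mu]_(x in `[c, d]) ((F (x + n.+1%:R^-1) - F x) / n.+1%:R^-1)%:E)%E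
     @[n --> \oo] --> (F d - F c)%:E.
Proof.
move=> cd cF.
pose A := c - 1; pose U := d + 2.
have iF : mu.-integrable `[A, U] (EFin \o F).
  apply: continuous_compact_integrable; first exact: segment_compact.
  exact: continuous_subspaceT.
pose Phi x := \int[mu]_(t in `[A, x]) F t.
have dPhi x : A < x -> x < U -> is_derive x 1 Phi (F x).
  move=> Ax xU; have [h1 h2] := continuous_FTC1_closed xU iF Ax (@cF x).
  by apply: DeriveDef => //; rewrite -derive1E.
pose h n : R := n.+1%:R^-1.
have h0 n : 0 < h n by rewrite invr_gt0.
have h1 n : h n <= 1 by rewrite invf_le1// ler1n.
pose Q n x := (Phi (x + h n) - Phi x) / h n.
have dQ n x : c <= x <= d -> is_derive x 1 (Q n) ((F (x + h n) - F x) / h n).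
  move=> /andP[cx xd].
  have d1 : is_derive x 1 (fun x => Phi (x + h n)) (F (x + h n)).
    rewrite -[F _]mulr1; apply: (@is_derive1_comp _ Phi (fun x => x + h n)).
      by apply: dPhi; rewrite /A /U; have := h0 n; have := h1 n; lra.
    by rewrite -[X in is_derive _ _ _ X](addr0 1); apply: is_deriveD.
  have d2 : is_derive x 1 Phi (F x).
    by apply: dPhi; rewrite /A /U; lra.
  rewrite (_ : Q n = (h n)^-1 \*: ((fun x => Phi (x + h n)) - Phi)); last first.
    by apply/funext => y; rewrite /Q mulrC.
  by rewrite mulrC; apply: is_deriveZ; exact: is_deriveB.
have intQ n : (\int[mu]_(x in `[c, d]) ((F (x + h n) - F x) / h n)%:E)%E =
    (Q n d - Q n c)%:E.
  rewrite (@continuous_FTC2 _ (fun x => (F (x + h n) - F x) / h n) (Q n)) //.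
  - apply: continuous_subspaceT => x.
    apply: cvgM; last exact: cvg_cst.
    apply: cvgB; last exact: cF.
    apply: (@continuous_comp _ _ _ (fun x => x + h n)); last exact: cF.
    by apply: cvgD; [exact: cvg_id|exact: cvg_cst].
  - split.
    + move=> x; rewrite in_itv/= => /andP[cx xd].
      by apply: (@ex_derive _ _ _ _ _ _ _ (dQ n x _)); rewrite !ltW.
    + apply: cvg_at_right_filter; apply: is_derive_continuous; apply: dQ.
      by rewrite lexx ltW.
    + apply: cvg_at_left_filter; apply: is_derive_continuous; apply: dQ.
      by rewrite lexx ltW.
  - move=> x; rewrite in_itv/= => /andP[cx xd]; rewrite derive1E.
    by apply: (@derive_val _ _ _ _ _ _ _ (dQ n x _)); rewrite !ltW.
under eq_cvg do rewrite intQ.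
apply: cvg_EFin; first by near=> n.
apply: cvgB.
- by apply: is_derive_quotient_cvg; apply: dPhi; rewrite /A /U; lra.
- by apply: is_derive_quotient_cvg; apply: dPhi; rewrite /A /U; lra.
Unshelve. all: by end_near. Qed.

(** The derivative need not be continuous: it is the bounded pointwise limit
    of difference quotients, whose integrals converge to the increment of F. *)
Lemma lipschitz_FTC F phi (c d M : R) : c < d ->
  (forall x, c <= x <= d -> is_derive x 1 F (phi x)) ->
  (forall x, c <= x <= d -> `|phi x| <= M) ->
  mu.-integrable `]c, d[ (EFin \o phi) /\
  (\int[mu]_(x in `]c, d[) (phi x)%:E = (F d - F c)%:E)%E.
Proof.
move=> cd dF bphi; have cdW := ltW cd.
have M0 : 0 <= M by apply: le_trans (bphi c _) => //; rewrite lexx.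
pose Ft x := F (clamp c d x).
have lip x y : `|Ft x - Ft y| <= M * `|x - y|.
  apply: (le_trans (derive_lipschitz dF bphi (clamp_in x cdW) (clamp_in y cdW))).
  by rewrite ler_wpM2l// clamp_lipschitz.
have cFt : continuous Ft.
  move=> x; apply/cvgrPdist_le => e e0.
  have e1 : 0 < e / (M + 1) by rewrite divr_gt0//; lra.
  exists (e / (M + 1)) => //= y xy; apply: (le_trans (lip x y)).
  apply: (@le_trans _ _ ((M + 1) * `|x - y|)).
    by rewrite ler_wpM2r//; lra.
  by rewrite -ler_pdivlMl ?(mulrC _^-1) ?ltW//; lra.
pose q n x := (Ft (x + n.+1%:R^-1) - Ft x) / n.+1%:R^-1.
have cq n : continuous (q n).
  move=> x; apply: cvgM; last exact: cvg_cst.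
  apply: cvgB; last exact: cFt.
  apply: (@cvg_comp _ _ _ (fun y : R => y + n.+1%:R^-1) Ft _ (nbhs (x + n.+1%:R^-1))); last exact: cFt.
  by apply: cvgD; [exact: cvg_id|exact: cvg_cst].
have mq n D : measurable_fun D (q n : measurableTypeR R -> R).
  by apply: measurable_funTS; exact: continuous_measurable_fun.
have qM n x : `|q n x| <= M.
  have n0 : 0 < n.+1%:R^-1 :> R by rewrite invr_gt0.
  have := lip (x + n.+1%:R^-1) x; rewrite /q normrM normfV.
  by rewrite addrAC subrr add0r (gtr0_norm n0) ler_pdivrMr.
have qphi x : c < x < d -> q n x @[n --> \oo] --> phi x.
  move=> /andP[cx xd].
  have := is_derive_quotient_cvg (dF x _); rewrite !ltW// => /(_ isT).
  apply: cvg_trans; apply: near_eq_cvg.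
  have dx : 0 < d - x by rewrite subr_gt0.
  have [N _ hN] := near_infty_natSinv_lt (PosNum dx).
  exists N => // n /hN /= nd; have n0 : 0 < n.+1%:R^-1 :> R by rewrite invr_gt0.
  have h1 : c <= x <= d by rewrite !ltW.
  have h2 : c <= x + n.+1%:R^-1 <= d by move: nd n0; move: (n.+1%:R^-1 : R) => h; lra.
  by rewrite /q /Ft !clamp_id.
have mD : measurable (`]c, d[%classic : set (measurableTypeR R)) by exact: measurable_itv.
have mphi : measurable_fun (`]c, d[%classic : set (measurableTypeR R)) phi.
  apply: (@measurable_fun_cvg _ _ _ _ q); first by move=> n; exact: mq.
  by move=> x /=; rewrite in_itv/=; exact: qphi.
have mcd : (mu `]c, d[%classic < +oo)%E.
  by rewrite lebesgue_measure_itv/= lte_fin cd -EFinB ltry.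
have iM : mu.-integrable `]c, d[ (EFin \o cst M).
  apply: (measurable_bounded_integrable (f := cst M)) => //.
  exists M; split; first exact: num_real.
  by move=> K MK x _ /=; rewrite ger0_norm// ltW.
have [iphi _ cvgI] : [/\ mu.-integrable `]c, d[ (EFin \o phi), 
    [sequence (\int[mu]_(x in `]c, d[) `|(q n x)%:E - (phi x)%:E|)%E]_n @ \oo --> 0%E &
    [sequence (\int[mu]_(x in `]c, d[) (q n x)%:E)%E]_n @ \oo -->
      (\int[mu]_(x in `]c, d[) (phi x)%:E)%E].
  apply: (@dominated_convergence _ _ _ mu _ mD (fun n x => (q n x)%:E) (EFin \o phi) (EFin \o cst M)) => //.
  - by move=> n; apply/measurable_EFinP; exact: mq.
  - exact/measurable_EFinP.
  - apply: aeW => x /=; rewrite in_itv/= => xcd; apply: cvg_EFin; first by near=> n.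
    exact: qphi.
  - by apply: aeW => x n _ /=; rewrite lee_fin.
split => //.
have cvgI2 := continuous_mean_cvg cd cFt.
have e n : (\int[mu]_(x in `]c, d[) (q n x)%:E = \int[mu]_(x in `[c, d]) (q n x)%:E)%E.
  rewrite integral_itv_bndo_bndc; last by apply/measurable_EFinP; exact: mq.
  by rewrite integral_itv_obnd_cbnd//; apply/measurable_EFinP; exact: mq.
rewrite -(cvg_lim (@ereal_hausdorff R) cvgI).
rewrite (_ : [sequence _]_n = (fun n => \int[mu]_(x in `[c, d]) (q n x)%:E)%E); last first.
  by apply/funext => n; exact: e.
rewrite (cvg_lim (@ereal_hausdorff R) cvgI2) /Ft !clamp_id// ?lexx ?cdW//.
Unshelve. all: by end_near. Qed.

End FTC.

Section dominated_FTC.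
Context {R : realType}.
Local Notation mu := (@lebesgue_measure R).
Local Notation RT := (measurableTypeR R).
Implicit Types (F phi m f : R -> R).

(** The fundamental theorem on an open interval, by exhaustion with compact
    subintervals on which the function is Lipschitz. *)
Lemma FTC_exhaustion F phi (a b : R) : a < b ->
  {within `[a, b], continuous F} ->
  (forall x, a < x < b -> is_derive x 1 F (phi x)) ->
  (forall c d, a < c -> c < d -> d < b -> exists M, forall x, c <= x <= d -> `|phi x| <= M) ->
  exists (I : nat -> set RT) (v : nat -> R), [/\
    forall k, measurable (I k), nondecreasing_seq I, \bigcup_k I k = `]a, b[%classic,
    forall k, mu.-integrable (I k) (EFin \o phi) /\
      (\int[mu]_(x in I k) (phi x)%:E = (v k)%:E)%E &
    v k @[k --> \oo] --> F b - F a].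
Proof.
move=> ab /(continuous_within_itvP _ ab)[_ Fa Fb] dF locb.
pose h k : R := (b - a) / k.+3%:R.
have ba0 : 0 < b - a by rewrite subr_gt0.
have h0 k : 0 < h k by rewrite divr_gt0.
have h2 k : h k * 2 < b - a.
  by rewrite /h mulrAC ltr_pdivrMr// ltr_pM2l// ltr_nat.
have hcvg : h k @[k --> \oo] --> 0.
  apply/cvgrPdist_le => e e0; exists (Num.truncn ((b - a) / e)) => // k /= hk.
  rewrite sub0r normrN gtr0_norm// ler_pdivrMr// mulrC -ler_pdivrMr//.
  by apply: le_trans (ltW (truncnS_gt _)) _; rewrite ler_nat !ltnS (leq_trans hk)// leqW.
pose I k : set RT := `](a + h k), (b - h k)[%classic.
have ck k : a + h k < b - h k by have := h2 k; lra.
exists I, (fun k => F (b - h k) - F (a + h k)); split.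
- by move=> k; exact: measurable_itv.
- move=> k l kl; apply/subsetPset; apply: subset_itv; rewrite bnd_simp.
    by rewrite lerD2l /h ler_pM2l// lef_pV2 ?posrE// ler_nat !ltnS.
  by rewrite lerD2l lerN2 /h ler_pM2l// lef_pV2 ?posrE// ler_nat !ltnS.
- apply/seteqP; split => x.
    by move=> [k _]; rewrite /I /= !in_itv/= => xk; have := h0 k; lra.
  rewrite /= in_itv/= => /andP[ax xb].
  have xx : 0 < Num.min (x - a) (b - x) by rewrite lt_min !subr_gt0 ax.
  move/cvgrPdist_lt : (hcvg) => /(_ _ xx)[k _ /(_ k (leqnn k))].
  rewrite sub0r normrN gtr0_norm// lt_min => /andP[h3 h4].
  by exists k => //; rewrite /I /= in_itv/=; lra.
- move=> k; have [M bM] : exists M, forall x, a + h k <= x <= b - h k -> `|phi x| <= M.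
    by apply: locb; have := h0 k; have := ck k; lra.
  apply: (@lipschitz_FTC _ F phi _ _ M (ck k)) => // x xk; apply: dF.
  by have := h0 k; lra.
- apply: cvgB.
    apply: (cvg_at_leftP F b (F b)).1 => //; split; first by move=> n; rewrite ltrBlDr ltrDl.
    by rewrite -[X in _ --> X]subr0; apply: cvgB => //; exact: cvg_cst.
  apply: (cvg_at_rightP F a (F a)).1 => //; split; first by move=> n; rewrite ltrDl.
  by rewrite -[X in _ --> X]addr0; apply: cvgD => //; exact: cvg_cst.
Qed.

Lemma nonneg_FTC F phi (a b : R) : a < b ->
  {within `[a, b], continuous F} ->
  (forall x, a < x < b -> is_derive x 1 F (phi x)) ->
  (forall c d, a < c -> c < d -> d < b -> exists M, forall x, c <= x <= d -> `|phi x| <= M) ->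
  (forall x, a < x < b -> 0 <= phi x) ->
  measurable_fun (`]a, b[%classic : set RT) phi /\
  (\int[mu]_(x in `]a, b[) (phi x)%:E = (F b - F a)%:E)%E.
Proof.
move=> ab cF dF locb phi0.
have [I [v [mI ndI UI Iv vF]]] := FTC_exhaustion ab cF dF locb.
split.
  rewrite -UI; apply/measurable_fun_bigcup => // k.
  by have [/integrableP[/measurable_EFinP]] := Iv k.
have IS k x : I k x -> (0 <= (phi x)%:E)%E.
  move=> Ix; rewrite lee_fin; apply: phi0.
  have : (\bigcup_k I k) x by exists k.
  by rewrite UI /= in_itv.
have h1 := ge0_nondecreasing_set_cvg_integral ndI mI
  (fun i => measurable_int _ (Iv i).1) IS (mu := mu).
rewrite UI in h1; rewrite -(cvg_lim (@ereal_hausdorff R) h1); apply: cvg_lim => //.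
rewrite (_ : (fun k => _) = (fun k => (v k)%:E)).
  by apply: cvg_EFin => //; near=> n.
by apply/funext => k; have [_ ->] := Iv k.
Unshelve. all: by end_near. Qed.

(** The integrals over the exhausting intervals converge by domination. *)
Lemma dominated_FTC F phi m (a b : R) : a < b ->
  {within `[a, b], continuous F} ->
  (forall x, a < x < b -> is_derive x 1 F (phi x)) ->
  (forall c d, a < c -> c < d -> d < b -> exists M, forall x, c <= x <= d -> `|phi x| <= M) ->
  (forall x, a < x < b -> `|phi x| <= m x) ->
  mu.-integrable `]a, b[ (EFin \o m) ->
  mu.-integrable `]a, b[ (EFin \o phi) /\
  (\int[mu]_(x in `]a, b[) (phi x)%:E = (F b - F a)%:E)%E.
Proof.
move=> ab cF dF locb bphi im.
have [I [v [mI ndI UI Iv vF]]] := FTC_exhaustion ab cF dF locb.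
have mab : measurable (`]a, b[%classic : set RT) by exact: measurable_itv.
have mphi : measurable_fun (`]a, b[%classic : set RT) phi.
  rewrite -UI; apply/measurable_fun_bigcup => // k.
  by have [/integrableP[/measurable_EFinP]] := Iv k.
have iphi : mu.-integrable `]a, b[ (EFin \o phi).
  apply: le_integrable im => //; first exact/measurable_EFinP.
  move=> x /=; rewrite in_itv/= lee_fin => xab.
  exact: le_trans (bphi x xab) (ler_norm _).
split => //.
have [_ _ cvgI] : [/\ mu.-integrable `]a, b[ (EFin \o phi),
    [sequence (\int[mu]_(x in `]a, b[) `|((EFin \o phi) \_ (I n)) x - (phi x)%:E|)%E]_n @ \oo --> 0%E &
    [sequence (\int[mu]_(x in `]a, b[) ((EFin \o phi) \_ (I n)) x)%E]_n @ \oo -->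
      (\int[mu]_(x in `]a, b[) (phi x)%:E)%E].
  apply: (@dominated_convergence _ _ _ mu _ mab (fun n => (EFin \o phi) \_ (I n))
     (EFin \o phi) (EFin \o (fun x => `|phi x|))) => //.
  - move=> n; apply: measurable_funTS; apply/(measurable_restrictT _ (mI n)).
    by have [/integrableP[]] := Iv n.
  - exact/measurable_EFinP.
  - apply: aeW => x xab; have : (\bigcup_k I k) x by rewrite UI.
    move=> [k _ Ix]; apply: cvg_near_cst; exists k => // n /= kn.
    by rewrite patchE mem_set//; move: x Ix {xab}; apply/subsetPset; exact: ndI.
  - by move/integrable_abse : iphi.
  - apply: aeW => x n _; rewrite patchE; case: ifPn => _; first by rewrite /= lee_fin.
    by rewrite (_ : point = 0%E)// abse0 lee_fin.
rewrite -(cvg_lim (@ereal_hausdorff R) cvgI); apply: cvg_lim => //.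
rewrite (_ : [sequence _]_n = (fun n => (v n)%:E)).
  by apply: cvg_EFin => //; near=> n.
apply/funext => n; have [_ <-] := Iv n; rewrite /= -integral_mkcondr; congr (integral _ _ _).
by apply: setIidr; rewrite -UI; exact: bigcup_sup.
Unshelve. all: by end_near. Qed.

End dominated_FTC.

(** * Integration by parts against a charge *)

Section integration_by_parts.
Context {R : realType}.
Local Notation mu := (@lebesgue_measure R).
Local Notation RT := (measurableTypeR R).
Implicit Types (F phi m f u : R -> R) (T : R).

(** F is absolutely continuous on [0, T] with derivative phi, stated in the
    integrated form that integration by parts uses. *)
Definition has_density T F phi := mu.-integrable `[0, T] (EFin \o phi) /\
  forall x y : R, 0 <= x -> x <= y -> y <= T -> F y - F x = \int[mu]_(t in `[x, y]) phi t.

Lemma Rintegral_oo_cc phi (x y : R) : mu.-integrable `]x, y[ (EFin \o phi) ->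
  \int[mu]_(t in `[x, y]) phi t = \int[mu]_(t in `]x, y[) phi t.
Proof.
move=> /integrableP[mphi _]; rewrite /Rintegral; congr fine.
rewrite [RHS]integral_itv_bndo_bndc//.
have [xy|xy] := ltP x y; last first.
  have e0 : `]x, y]%classic = set0 :> set R.
    by apply/seteqP; split => // t /=; rewrite in_itv/= => /andP[h1 h2]; lra.
  rewrite e0 integral_set0.
  have [xy'|xy'] := eqVneq x y.
    by rewrite -xy' set_itv1 integral_set1.
  rewrite (_ : `[x, y]%classic = set0 :> set R) ?integral_set0//.
  apply/seteqP; split => // t /=; rewrite in_itv/= => /andP[h1 h2].
  by move/eqP: xy' => xy'; apply: xy'; lra.
rewrite [RHS]integral_itv_obnd_cbnd//.
move/measurable_EFinP : mphi => mphi; apply/measurable_EFinP.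
have -> : `]x, y]%classic = `]x, y[%classic `|` [set y] :> set R.
  by rewrite setUitv1// bnd_simp.
apply/measurable_funU => //; split => //; exact: measurable_fun_set1.
Qed.

(** The interval is cut at s, where phi may be singular, as the partial
    derivative of a covariance is on the diagonal. *)
Lemma dominated_density T (s : R) F phi m : 
  {within `[0, T], continuous F} ->
  (forall x, 0 < x < T -> x != s -> is_derive x 1 F (phi x)) ->
  (forall c d, 0 < c -> c < d -> d < T -> s < c \/ d < s ->
     exists M, forall x, c <= x <= d -> `|phi x| <= M) ->
  measurable_fun (`[0, T]%classic : set RT) phi ->
  (forall x, 0 <= x <= T -> `|phi x| <= m x) ->
  mu.-integrable `[0, T] (EFin \o m) ->
  has_density T F phi.
Proof.
move=> cF dF locb mphi bphi im.
have iphi : mu.-integrable `[0, T] (EFin \o phi).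
  apply: le_integrable im => //; first exact/measurable_EFinP.
  move=> x /=; rewrite in_itv/= lee_fin => xT.
  exact: le_trans (bphi x xT) (ler_norm _).
split => // x y x0 xy yT.
have piece a b : x <= a -> a <= b -> b <= y -> s <= a \/ b <= s ->
    F b - F a = \int[mu]_(t in `[a, b]) phi t.
  move=> xa; rewrite le_eqVlt => /predU1P[<-|ab] by_ sab.
    by rewrite subrr set_itv1 Rintegral_set1.
  have sub : `[a, b] `<=` `[0, T] by apply: subset_itv; rewrite bnd_simp; lra.
  have iS D : D `<=` `[0, T]%classic -> measurable (D : set RT) ->
      mu.-integrable D (EFin \o phi) /\ mu.-integrable D (EFin \o m).
    by move=> DT mD; split; [apply: integrableS iphi|apply: integrableS im].
  have [|||||i e] := @dominated_FTC R F phi m a b ab.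
  - exact: continuous_subspaceW cF.
  - move=> t /andP[at_ tb]; apply: dF; first by lra.
    by case: sab => sab; [rewrite gt_eqF//|rewrite lt_eqF//]; lra.
  - by move=> c d ac cd db; apply: locb; lra.
  - by move=> t tab; apply: bphi; lra.
  - apply: (iS _ _ _).2; last exact: measurable_itv.
    by apply: subset_trans sub; exact: subset_itv_oo_cc.
  by rewrite Rintegral_oo_cc// /Rintegral e.
have [ys|sy] := leP y s; first by apply: piece => //; right.
have [sx|xs] := leP s x; first by apply: piece => //; left.
have e1 := piece x s (lexx _) (ltW xs) (ltW sy) (or_intror (lexx _)).
have e2 := piece s y (ltW xs) (ltW sy) (lexx _) (or_introl (lexx _)).
have -> : F y - F x = (F s - F x) + (F y - F s) by ring.
rewrite e1 e2.
have ixy : mu.-integrable `[x, y] (EFin \o phi).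
  by apply: integrableS iphi => //; apply: subset_itv; rewrite bnd_simp.
have := @Rintegral_itvB _ phi (BLeft x) (BRight y) s ixy.
rewrite !bnd_simp (ltW xs) (ltW sy) => /(_ isT isT) => e.
have e3 : \int[mu]_(t in `[s, y]) phi t = \int[mu]_(t in `]s, y]) phi t.
  rewrite -Rintegral_itv_obnd_cbnd//.
  have sub : `]s, y] `<=` `[x, y] by apply: subset_itv; rewrite bnd_simp// ltW.
  by apply: integrableS ixy.
by rewrite e3 -e; ring.
Qed.

Lemma step_functional_density T u L F phi : 0 < T -> is_step_functional T u L ->
  has_density T F phi ->
  mu.-integrable `[0, T] (EFin \o (fun t => u t * phi t)) /\
  L F = - \int[mu]_(t in `[0, T]) (u t * phi t).
Proof.
move=> T0 [n [c [a [b [h -> ->]]]]] [iphi Fphi].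
have mD : measurable (`[0, T]%classic : set RT) by exact: measurable_itv.
elim: n c a b h => [|n IH] c a b h.
  split.
    rewrite (_ : _ \o _ = cst 0%E); first exact: integrable0.
    by apply/funext => t /=; rewrite big_ord0 mul0r.
  rewrite big_ord0; under eq_Rintegral do rewrite big_ord0 mul0r.
  by rewrite Rintegral_cst// mul0r oppr0.
have [i1 e1] := IH (fun i => c (lift ord0 i)) _ _ (fun i => h (lift ord0 i)).
have [a0 ab bT] := h ord0.
have sub : `[a ord0, b ord0[ `<=` `[0, T] by apply: subset_itv; rewrite bnd_simp.
have ico : mu.-integrable `[a ord0, b ord0[ (EFin \o phi).
  by apply: integrableS iphi => //; exact: measurable_itv.
pose g t := \1_(`[a ord0, b ord0[) t * phi t.
have gE : g = phi \_ (`[a ord0, b ord0[).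
  apply/funext => t; rewrite /g patchE indicE.
  by case: ifPn => tab; rewrite ?mul1r ?mul0r.
have ig : mu.-integrable `[0, T] (EFin \o g).
  rewrite gE -restrict_EFin; apply/integrable_restrict => //=; rewrite setIidr//.
have intg : \int[mu]_(t in `[0, T]) g t = F (b ord0) - F (a ord0).
  rewrite gE -Rintegral_mkcondr setIidr// Fphi//.
  by rewrite Rintegral_itv_bndo_bndc.
have icg : mu.-integrable `[0, T] (EFin \o (fun t => c ord0 * g t)).
  exact: (integrableZl mD (c ord0) ig).
pose r t := (\sum_(i < n) c (lift ord0 i) * \1_(`[a (lift ord0 i), b (lift ord0 i)[) t) * phi t.
have split_ t : (\sum_(i < n.+1) c i * \1_(`[a i, b i[) t) * phi t = c ord0 * g t + r t.
  by rewrite big_ord_recl mulrDl /g mulrA.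
split.
  pose g' t := c ord0 * g t.
  rewrite (_ : EFin \o _ = ((EFin \o g') \+ (EFin \o r))%E); first exact: integrableD.
  by apply/funext => t /=; rewrite split_.
under eq_Rintegral do rewrite split_.
rewrite RintegralD// RintegralZl// intg big_ord_recl e1 opprD -mulrN opprB.
by [].
Qed.

(** A step function vanishes at T, so that its variation bounds its values. *)
Lemma bv_approx_bound T u M : 0 < T -> step_fun T u ->
  (total_variation 0 T u <= M%:E)%E -> forall t, 0 <= t <= T -> `|u t| <= M.
Proof.
move=> T0 su uM t /andP[t0 tT]; have [L uL] := step_functional_exists su.
have uT : u T = 0 by rewrite (step_fun_out uL)// ltxx andbF.
rewrite -lee_fin; apply: le_trans uM.
rewrite (total_variationD _ t0 tT); apply: (@le_trans _ _ (total_variation t T u)).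
  by have := total_variation_ge u tT; rewrite uT sub0r normrN.
by rewrite leeDr// total_variation_ge0.
Qed.

(** On [0, T[ the function is a pointwise limit of step functions. *)
Lemma bounded_variation_measurable T f : 0 < T -> bounded_variation 0 T f ->
  measurable_fun (`[0, T]%classic : set RT) f.
Proof.
move=> T0 bvf; have [u [us _ uf]] := bv_approx_exists T0 bvf.
have mu_ n : measurable_fun (`[0, T[%classic : set RT) (u n).
  have [k [c [a [b [_ ->]]]]] := us n; apply: measurable_sum => i.
  by apply: measurable_funM => //; apply: measurable_indic; exact: measurable_itv.
have mf : measurable_fun (`[0, T[%classic : set RT) f.
  by apply: (measurable_fun_cvg mu_) => t /=; rewrite in_itv/=; exact: uf.
have -> : `[0, T]%classic = `[0, T[%classic `|` [set T] :> set R.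
  by rewrite setUitv1// bnd_simp ltW.
by apply/measurable_funU => //; split => //; exact: measurable_fun_set1.
Qed.

Lemma bounded_variation_bounded T f : 0 < T -> bounded_variation 0 T f ->
  exists M : R, 0 <= M /\ forall t, 0 <= t <= T -> `|f t| <= M.
Proof.
move=> T0 bvf; have [u [us [M uM] uf]] := bv_approx_exists T0 bvf.
have M0 : 0 <= M.
  by rewrite -lee_fin; apply: le_trans (uM 0%N); apply: total_variation_ge0; exact: ltW.
exists (M + `|f T|); split; first by rewrite addr_ge0.
move=> t /andP[t0 tT]; have [tT1|Tt] := ltP t T; last first.
  have -> : t = T by apply/eqP; rewrite eq_le tT.
  by rewrite lerDr.
apply: (@le_trans _ _ M); last by rewrite lerDl.
have tT' : 0 <= t < T by rewrite t0.
have c : `|u n t| @[n --> \oo] --> `|f t| by apply: cvg_norm; exact: uf.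
rewrite -(cvg_lim (@Rhausdorff R) c); apply: limr_le; first by apply/cvg_ex; exists `|f t|.
by near=> n; apply: (bv_approx_bound T0 (us n) (uM n)); rewrite t0.
Unshelve. all: by end_near. Qed.

(** For step functions this is the definition of the density of F; both sides
    pass to the limit along an approximation of f, the left one by weak
    convergence, the right one by domination. No boundary term appears
    because the charge is that of f extended by 0. *)
Lemma charge_integral_by_parts T f F phi : 0 < T -> bounded_variation 0 T f ->
  {within `[0, T], continuous F} -> has_density T F phi ->
  charge_integral (nu_ T f) T F = - \int[mu]_(t in `[0, T]) (f t * phi t).
Proof.
move=> T0 bvf cF dens; have [iphi _] := dens.
have [u [us [M uM] uf]] := bv_approx_exists T0 bvf.
have Lu n : {L | is_step_functional T (u n) L} by apply: cid; exact: step_functional_exists.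
have h1 := step_functional_cvg T0 bvf (fun n => svalP (Lu n)) uM uf cF.
have mD : measurable (`[0, T[%classic : set RT) by exact: measurable_itv.
have sub : `[0, T[ `<=` `[0, T] by apply: subset_itv; rewrite bnd_simp.
have iphi' : mu.-integrable `[0, T[ (EFin \o phi) by apply: integrableS iphi.
have /integrableP[/measurable_EFinP mphi _] := iphi'.
have mf : measurable_fun (`[0, T[%classic : set RT) f.
  apply: measurable_funS (bounded_variation_measurable T0 bvf) => //; exact: measurable_itv.
have iun n : mu.-integrable `[0, T[ (EFin \o (fun t => u n t * phi t)).
  by apply: integrableS (step_functional_density T0 (svalP (Lu n)) dens).1.
pose D : set RT := `[0, T[%classic.
have [ifphi _ h2] : [/\ mu.-integrable D (EFin \o (fun t => f t * phi t)),
    [sequence (\int[mu]_(x in D) `|(u n x * phi x)%:E - (f x * phi x)%:E|)%E]_n @ \oo --> 0%E &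
    [sequence (\int[mu]_(x in D) (u n x * phi x)%:E)%E]_n @ \oo -->
      (\int[mu]_(x in D) (f x * phi x)%:E)%E].
  apply: (@dominated_convergence _ _ _ mu _ mD (fun n x => (u n x * phi x)%:E)
     (EFin \o (fun t => f t * phi t)) (fun x => (M * `|phi x|)%:E)) => //.
  - by move=> n; have /integrableP[] := iun n.
  - by apply/measurable_EFinP; exact: measurable_funM.
  - apply: aeW => x /=; rewrite in_itv/= => xT; apply: cvg_EFin; first by near=> n.
    by apply: cvgM; [exact: uf|exact: cvg_cst].
  - by have := integrableZl mD M (integrable_abse iphi').
  - apply: aeW => x n /=; rewrite in_itv/= lee_fin normrM => xT.
    rewrite ler_wpM2r//; apply: (bv_approx_bound T0 (us n) (uM n)).
    by case/andP: xT => -> /ltW.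
have fin : (\int[mu]_(x in D) (f x * phi x)%:E)%E \is a fin_num.
  by apply: integrable_fin_num.
have e n : (\int[mu]_(x in D) (u n x * phi x)%:E)%E = (- sval (Lu n) F)%:E.
  have [i ->] := step_functional_density T0 (svalP (Lu n)) dens.
  rewrite opprK /Rintegral fineK ?integrable_fin_num//.
  by rewrite integral_itv_bndo_bndc//; have /integrableP[] := iun n.
have h3 : (- sval (Lu n) F)%:E @[n --> \oo] --> (- charge_integral (nu_ T f) T F)%:E.
  by apply: cvg_EFin; [near=> n|exact: cvgN].
have e2 : (- charge_integral (nu_ T f) T F)%:E = (\int[mu]_(x in D) (f x * phi x)%:E)%E.
  rewrite -(cvg_lim (@ereal_hausdorff R) h3); apply: cvg_lim => //.
  move: h2; rewrite (_ : [sequence _]_n = (fun n => (- sval (Lu n) F)%:E))//.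
  by apply/funext => n; exact: e.
apply: oppr_inj; rewrite opprK -[LHS]/(fine (- charge_integral (nu_ T f) T F)%:E) e2.
rewrite /Rintegral; congr fine.
by apply: integral_itv_bndo_bndc; apply/measurable_EFinP; exact: measurable_funM.
Unshelve. all: by end_near. Qed.

End integration_by_parts.

(** * Integrals of power kernels *)

Section power_kernels.
Context {R : realType}.
Local Notation mu := (@lebesgue_measure R).
Local Notation RT := (measurableTypeR R).
Implicit Types (T s t al : R).

Lemma continuous_locally_bounded (phi : R -> R) (a b : R) :
  (forall x, a < x < b -> {for x, continuous phi}) ->
  forall c d, a < c -> c < d -> d < b -> exists M, forall x, c <= x <= d -> `|phi x| <= M.
Proof.
move=> cphi c d ac cd db.
have cw : {within `[c, d], continuous phi}.
  apply: continuous_in_subspaceT => x; rewrite inE/= in_itv/= => /andP[cx xd].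
  by apply: cphi; lra.
have [M [_ bM]] := compact_fun_bounded (@segment_compact _ c d) cw.
by exists M => x xcd; apply: bM; rewrite /= in_itv.
Qed.

Section shifted.
Variables (al s : R).

Lemma is_derive_powR_right t : s < t ->
  is_derive t 1 (fun u => `|u - s| `^ al) (al * `|t - s| `^ (al - 1)).
Proof.
move=> st; have ts : 0 < t - s by rewrite subr_gt0.
have d0 : is_derive t 1 (fun u : R => u - s) 1.
  by rewrite -[X in is_derive _ _ _ X](subr0 1); apply: is_deriveB.
have d1 : is_derive t 1 (fun u => (u - s) `^ al) (al * (t - s) `^ (al - 1)).
  rewrite -[X in is_derive _ _ _ X]mulr1.
  exact: (@is_derive1_comp _ _ (fun u => u - s) t _ _ (is_derive1_powR al ts) d0).
have e : \forall u \near t, (u - s) `^ al = `|u - s| `^ al.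
  by near=> u; rewrite gtr0_norm// subr_gt0; near: u; exact: lt_nbhsr.
by rewrite (gtr0_norm ts); apply: near_eq_is_derive d1.
Unshelve. all: by end_near. Qed.

Lemma is_derive_powR_left t : t < s ->
  is_derive t 1 (fun u => `|u - s| `^ al) (- (al * `|t - s| `^ (al - 1))).
Proof.
move=> st; have ts : 0 < s - t by rewrite subr_gt0.
have d0 : is_derive t 1 (fun u : R => s - u) (- 1).
  by rewrite -[X in is_derive _ _ _ X](sub0r 1); apply: is_deriveB.
have d1 : is_derive t 1 (fun u => (s - u) `^ al) (- (al * (s - t) `^ (al - 1))).
  rewrite -[X in is_derive _ _ _ X]mulrN1.
  exact: (@is_derive1_comp _ _ (fun u => s - u) t _ _ (is_derive1_powR al ts) d0).
have e : \forall u \near t, (s - u) `^ al = `|u - s| `^ al.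
  by near=> u; rewrite distrC gtr0_norm// subr_gt0; near: u; exact: lt_nbhsl.
by rewrite (distrC t) (gtr0_norm ts); apply: near_eq_is_derive d1.
Unshelve. all: by end_near. Qed.

Lemma continuous_dist_powR : 0 < al -> continuous (fun u => `|u - s| `^ al).
Proof.
move=> al0 t; have [st|ts|->] := ltgtP s t.
- by apply: is_derive_continuous; exact: is_derive_powR_right.
- by apply: is_derive_continuous; exact: is_derive_powR_left.
rewrite /prop_for /continuous_at subrr normr0 powR0 ?gt_eqF//.
apply/cvgrPdist_le => e e0; exists (e `^ al^-1); first by rewrite /= powR_gt0.
move=> u /= tu; rewrite sub0r normrN ger0_norm ?powR_ge0//.
rewrite -[leRHS]powRr1 ?ltW// -(mulVf (lt0r_neq0 al0)) powRrM.
by apply: (@gt0_ltr_powR R al al0); rewrite ?nnegrE ?powR_ge0// distrC.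
Qed.

End shifted.

(** Up to sign, |t - s| ^ (al + 1) / (al + 1) is a primitive on each side of
    s, continuous up to s because al + 1 > 0. *)
Lemma dist_powR_integral_le T al s : 0 < T -> 0 <= s <= T -> -1 < al ->
  (\int[mu]_(t in `[0%R, T]) (`|t - s| `^ al)%:E <= (2 * (T `^ (al + 1) / (al + 1)))%:E)%E.
Proof.
move=> T0 /andP[s0 sT] al1.
have a0 : 0 < al + 1 by lra.
have a1 : al + 1 - 1 = al by ring.
pose P := T `^ (al + 1) / (al + 1).
have cF c : continuous (fun u => c * (`|u - s| `^ (al + 1))).
  by move=> u; apply: cvgM; [exact: cvg_cst|exact: continuous_dist_powR].
have P0 : 0 <= P by rewrite divr_ge0// ?powR_ge0// ltW.
have cphi x : x != s -> {for x, continuous (fun u => `|u - s| `^ al)}.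
  have [xs|sx|//] := ltgtP x s.
    by move=> _; apply: is_derive_continuous; exact: is_derive_powR_left.
  by move=> _; apply: is_derive_continuous; exact: is_derive_powR_right.
have mono x : `|x| <= T -> `|x| `^ (al + 1) / (al + 1) <= P.
  move=> xT; rewrite ler_pM2r ?invr_gt0// ge0_ler_powR ?nnegrE// ?ltW//.
have [m1 i1] : measurable_fun (`]0, s[%classic : set RT) (fun t => `|t - s| `^ al) /\
    (\int[mu]_(t in `]0%R, s[) (`|t - s| `^ al)%:E <= P%:E)%E.
  have [s0'|s0'] := ltP 0 s; last first.
    have -> : `]0, s[%classic = set0 :> set RT.
      by apply/seteqP; split => // t /=; rewrite in_itv/= => /andP[h1 h2]; lra.
    by rewrite integral_set0 lee_fin; split => //; exact: measurable_fun_set0.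
  have [|x|c d|x|m e] := @nonneg_FTC R (fun u => - (al + 1)^-1 * `|u - s| `^ (al + 1))
     (fun u => `|u - s| `^ al) 0 s s0'.
  - exact: continuous_subspaceT.
  - move=> /andP[_ xs].
    rewrite (_ : `|x - s| `^ al = - (al + 1)^-1 *: (- ((al + 1) * `|x - s| `^ (al + 1 - 1)))).
      exact: is_deriveZ (is_derive_powR_left (al + 1) xs).
    by rewrite a1 /GRing.scale /= mulrNN mulKf// gt_eqF.
  - apply: (@continuous_locally_bounded _ 0 s) => x xs; apply: cphi.
    by rewrite lt_eqF//; case/andP: xs.
  - by rewrite powR_ge0.
  split => //; rewrite e lee_fin subrr normr0 powR0 ?gt_eqF// mulr0 sub0r sub0r normrN mulNr opprK.
  by rewrite mulrC mono// ger0_norm.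
have [m2 i2] : measurable_fun (`]s, T[%classic : set RT) (fun t => `|t - s| `^ al) /\
    (\int[mu]_(t in `]s, T[) (`|t - s| `^ al)%:E <= P%:E)%E.
  have [s0'|s0'] := ltP s T; last first.
    have -> : `]s, T[%classic = set0 :> set RT.
      by apply/seteqP; split => // t /=; rewrite in_itv/= => /andP[h1 h2]; lra.
    by rewrite integral_set0 lee_fin; split => //; exact: measurable_fun_set0.
  have [|x|c d|x|m e] := @nonneg_FTC R (fun u => (al + 1)^-1 * `|u - s| `^ (al + 1))
     (fun u => `|u - s| `^ al) s T s0'.
  - exact: continuous_subspaceT.
  - move=> /andP[sx _].
    rewrite (_ : `|x - s| `^ al = (al + 1)^-1 *: ((al + 1) * `|x - s| `^ (al + 1 - 1))).
      exact: is_deriveZ (is_derive_powR_right (al + 1) sx).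
    by rewrite a1 /GRing.scale /= mulKf// gt_eqF.
  - apply: (@continuous_locally_bounded _ s T) => x xs; apply: cphi.
    by rewrite gt_eqF//; case/andP: xs.
  - by rewrite powR_ge0.
  split => //; rewrite e lee_fin subrr normr0 powR0 ?gt_eqF// mulr0 subr0.
  by rewrite mulrC mono// ger0_norm ?subr_ge0//; lra.
have mall : measurable_fun setT (fun t : RT => `|t - s| `^ al).
  by apply: (measurableT_comp (measurable_powR al)); apply: measurableT_comp => //; exact: measurable_funB.
have mE D : measurable_fun D (fun t : RT => (`|t - s| `^ al)%:E).
  by apply/measurable_EFinP; exact: measurable_funTS.
rewrite (@itv_bndbnd_setU _ _ (BLeft 0) (BRight s) (BRight T)) ?bnd_simp//.
rewrite ge0_integral_setU//=; first last.
- apply/disj_setPS => t [] /=; rewrite !in_itv/= => /andP[_ ts] /andP[st _].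
  by have := le_lt_trans ts st; rewrite ltxx.
have -> : 2 * (T `^ (al + 1) / (al + 1)) = P + P by rewrite mulr_natl mulr2n.
rewrite EFinD leeD//.
  move: i1; rewrite integral_itv_bndo_bndc; last exact: mE.
  by rewrite integral_itv_obnd_cbnd//; exact: mE.
by move: i2; rewrite integral_itv_bndo_bndc//; exact: mE.
Qed.

End power_kernels.

(** * Partial derivatives, and the covariance of fractional Brownian motion *)

Section partial_derivative.
Context {R : realType}.
Local Notation mu := (@lebesgue_measure R).
Local Notation RT := (measurableTypeR R).
Implicit Types (T s t H C : R) (K : R -> R -> R).

Lemma is_derive_derive1 (F : R -> R) t : derivable F t 1 -> is_derive t 1 F (derive1 F t).
Proof. by move=> dF; apply: DeriveDef => //; rewrite derive1E. Qed.

(** The partial derivative is a limit of difference quotients; these are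
    truncated at T to stay on the square. *)
Lemma measurable_pderiv1 T K : 0 < T ->
  measurable_fun (square T) (fun p => K p.1 p.2) ->
  (forall t s, 0 < t < T -> 0 <= s <= T -> t != s -> derivable (fun u => K u s) t 1) ->
  measurable_fun (square T) (fun p => pderiv1 T K p.1 p.2).
Proof.
move=> T0 mK dK.
pose cut n (p : RT * RT) : RT * RT := (Num.min (p.1 + n.+1%:R^-1) T, p.2).
have mcut n : measurable_fun setT (cut n).
  apply/measurable_fun_pairP; split => //=.
    by apply: measurable_minr => //; exact: measurable_funD.
  exact: measurable_snd.
pose g n (p : RT * RT) : R := if (0 < p.1 < T) && (p.1 != p.2) then
  (K (cut n p).1 (cut n p).2 - K p.1 p.2) / n.+1%:R^-1 else 0.
have mg n : measurable_fun (square T) (g n).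
  apply: measurable_fun_if => //.
  - exact: measurable_square.
  - apply: measurable_and; first apply: measurable_and.
    + by apply: measurable_fun_ltr => //; exact: measurable_funTS.
    + by apply: measurable_fun_ltr => //; exact: measurable_funTS.
    + by apply: measurable_neg; apply: measurable_fun_eqr => //; exact: measurable_funTS.
  - apply: measurable_funS; [exact: measurable_square|by move=> p []|].
    apply: measurable_funM => //; apply: measurable_funB => //.
    apply: (measurable_comp (F := square T) (f := fun p => K p.1 p.2) (g := cut n)) => //.
    + exact: measurable_square.
    + move=> _ [[t s] [/= + sT] <-]; rewrite in_itv/= => /andP[t0 tT].
      split => //=; rewrite in_itv/= le_min ge_min lexx orbT andbT (ltW T0) andbT.
      by rewrite addr_ge0.
    + exact: measurable_funTS.
apply: (measurable_fun_cvg mg) => -[t s] [/=]; rewrite !in_itv/= => tT sT.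
rewrite /g /pderiv1 /=; case: ifPn => [/andP[tT' ts]|_]; last exact: cvg_cst.
have := is_derive_quotient_cvg (is_derive_derive1 (dK _ _ tT' sT ts)).
apply: cvg_trans; apply: near_eq_cvg.
have tT0 : 0 < T - t by case/andP: tT'; rewrite subr_gt0.
have [N _ hN] := near_infty_natSinv_lt (PosNum tT0).
exists N => // n /hN /= nd; rewrite min_l// ltW//.
by rewrite -ltrBrDl.
Qed.

Lemma measurable_covB T H : measurable_fun (square T) (fun p => covB H p.1 p.2).
Proof.
apply: measurable_funTS; apply: measurable_funM => //; apply: measurable_funB; last first.
  apply: (measurableT_comp (measurable_powR _)); apply: measurableT_comp => //.
  exact: measurable_funB.
by apply: measurable_funD; apply: (measurableT_comp (measurable_powR _)).
Qed.

(** The sign e is that of t - s. *)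
Lemma covB_is_derive H t s : 0 < t -> t != s ->
  exists e, (e = 1 \/ e = -1) /\
  is_derive t 1 (fun u => covB H u s) (H * (t `^ (2 * H - 1) - e * `|t - s| `^ (2 * H - 1))).
Proof.
move=> t0 ts.
have [e [e1 de]] : exists e, (e = 1 \/ e = -1) /\
    is_derive t 1 (fun u => `|u - s| `^ (2 * H)) (e * (2 * H * `|t - s| `^ (2 * H - 1))).
  have [st|st] := ltP s t.
    exists 1; split; first by left.
    by rewrite mul1r; exact: is_derive_powR_right.
  exists (-1); split; first by right.
  by rewrite mulN1r; apply: is_derive_powR_left; rewrite lt_neqAle ts.
exists e; split => //.
have d1 := is_derive1_powR (2 * H) t0.
have d2 : is_derive t 1 (fun u => u `^ (2 * H) + s `^ (2 * H)) (2 * H * t `^ (2 * H - 1) + 0).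
  exact: is_deriveD.
have := is_deriveZ (2^-1 : R) (is_deriveB d2 de).
rewrite (_ : 2^-1 *: _ = H * (t `^ (2 * H - 1) - e * `|t - s| `^ (2 * H - 1)))//.
by rewrite /GRing.scale /=; field.
Qed.

Lemma covB_derivable H t s : 0 < t -> t != s -> derivable (fun u => covB H u s) t 1.
Proof. by move=> t0 ts; have [e [_ []]] := covB_is_derive H t0 ts. Qed.

Lemma pderiv1_covB_le T H t s : 0 < H -> 0 <= t ->
  `|pderiv1 T (covB H) t s| <= H * (t `^ (2 * H - 1) + `|t - s| `^ (2 * H - 1)).
Proof.
move=> H0 t0; rewrite /pderiv1; case: ifPn => [/andP[/andP[t0' tT] ts]|_]; last first.
  by rewrite normr0 mulr_ge0 ?(ltW H0)// addr_ge0 ?powR_ge0.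
have [e [e1 [_ de]]] := covB_is_derive H t0' ts.
rewrite derive1E de normrM gtr0_norm// ler_wpM2l ?(ltW H0)//.
apply: (le_trans (ler_normB _ _)); rewrite normrM !(ger0_norm (powR_ge0 _ _)).
have -> : `|e| = 1 by case: e1 => ->; rewrite ?normrN normr1.
by rewrite mul1r.
Qed.

End partial_derivative.

Section fractional_majorant.
Context {R : realType}.
Local Notation mu := (@lebesgue_measure R).
Local Notation RT := (measurableTypeR R).
Variables (T H C : R).
Hypotheses (T0 : 0 < T) (H01 : 0 < H < 1) (C0 : 0 <= C).

(** The first term bounds the difference of the partial derivatives of a
    covariance and of covB, the second one the partial derivative of covB. *)
Definition majorant (c s t : R) : R :=
  c * t `^ (H - 1) + H * (t `^ (2 * H - 1) + `|t - s| `^ (2 * H - 1)).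

Lemma majorant_ge0 c s t : 0 <= c -> 0 <= majorant c s t.
Proof.
have /andP[H0 _] := H01 => c0; rewrite /majorant addr_ge0// mulr_ge0 ?powR_ge0 ?(ltW H0)//.
by rewrite addr_ge0 ?powR_ge0.
Qed.

Lemma measurable_majorant c s D : measurable_fun D (majorant c s : RT -> R).
Proof.
apply: measurable_funTS; rewrite /majorant; apply: measurable_funD.
  by apply: measurable_funM => //; exact: measurable_powR.
apply: measurable_funM => //; apply: measurable_funD; first exact: measurable_powR.
by apply: (measurableT_comp (measurable_powR _)); apply: measurableT_comp => //; exact: measurable_funB.
Qed.

Lemma powR_integral_le al : -1 < al ->
  (\int[mu]_(t in `[0%R, T]) (t `^ al)%:E <= (2 * (T `^ (al + 1) / (al + 1)))%:E)%E.
Proof.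
move=> al1; have := @dist_powR_integral_le R T al 0 T0 _ al1; rewrite lexx ltW// => /(_ isT).
congr (_ <= _)%E; apply: eq_integral => t; rewrite inE/= in_itv/= => /andP[t0 _].
by rewrite subr0 ger0_norm.
Qed.

Lemma powR_integrable al : -1 < al -> mu.-integrable `[0, T] (fun t => (t `^ al)%:E).
Proof.
move=> al1; apply/integrableP; split.
  by apply/measurable_EFinP; apply: measurable_funTS; exact: measurable_powR.
under eq_integral do rewrite /= ger0_norm ?powR_ge0//.
exact: le_lt_trans (powR_integral_le al1) (ltry _).
Qed.

(** Every exponent exceeds -1, and the bound is uniform in s: this is what makes
    the kernels integrable against the product of Lebesgue measure and of any
    finite measure. *)
Lemma majorant_integral_le c : 0 <= c -> exists A : R, 0 <= A /\ forall s, 0 <= s <= T ->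
  (\int[mu]_(t in `[0%R, T]) (majorant c s t)%:E <= A%:E)%E.
Proof.
move=> c0; have /andP[H0 H1] := H01.
pose P al := 2 * (T `^ (al + 1) / (al + 1)).
have P0 al : -1 < al -> 0 <= P al.
  by move=> al1; rewrite /P mulr_ge0// divr_ge0 ?powR_ge0//; lra.
have a1 : -1 < H - 1 by lra.
have a2 : -1 < 2 * H - 1 by lra.
exists (c * P (H - 1) + H * (P (2 * H - 1) + P (2 * H - 1))); split.
  by rewrite addr_ge0// mulr_ge0 ?P0// ?(ltW H0)// addr_ge0 ?P0.
move=> s sT.
have mp al D : measurable_fun D (fun t : RT => (t `^ al)%:E).
  by apply/measurable_EFinP; apply: measurable_funTS; exact: measurable_powR.
have md al D : measurable_fun D (fun t : RT => (`|t - s| `^ al)%:E).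
  apply/measurable_EFinP; apply: measurable_funTS.
  by apply: (measurableT_comp (measurable_powR _)); apply: measurableT_comp => //; exact: measurable_funB.
have mD := measurable_segment T.
under eq_integral do rewrite /majorant EFinD EFinM (EFinM H) (EFinD (_ `^ _)).
rewrite ge0_integralD//; first last.
- by apply: emeasurable_funM => //; exact: emeasurable_funD.
- by move=> t _; rewrite -EFinD -EFinM lee_fin mulr_ge0 ?(ltW H0)// addr_ge0 ?powR_ge0.
- by apply: emeasurable_funM.
- by move=> t _; rewrite -EFinM lee_fin mulr_ge0 ?powR_ge0.
rewrite ge0_integralZl//; last by move=> t _; rewrite lee_fin powR_ge0.
rewrite ge0_integralZl//; first last.
- by rewrite lee_fin ltW.
- by move=> t _; rewrite -EFinD lee_fin addr_ge0 ?powR_ge0.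
- exact: emeasurable_funD.
rewrite ge0_integralD//; last by move=> t _; rewrite lee_fin powR_ge0.
set P1 := P (H - 1); set P2 := P (2 * H - 1).
have -> : (c * P1 + H * (P2 + P2))%:E = (c%:E * P1%:E + H%:E * (P2%:E + P2%:E))%E.
  by [].
rewrite leeD//.
  by rewrite lee_wpmul2l ?lee_fin//; exact: powR_integral_le.
rewrite lee_wpmul2l ?lee_fin ?(ltW H0)// leeD//; first exact: powR_integral_le.
exact: dist_powR_integral_le.
Qed.

End fractional_majorant.

(** * Kernels integrated against Lebesgue measure and a charge *)

Section kernel_fubini.
Context {R : realType}.
Local Notation mu := (@lebesgue_measure R).
Local Notation RT := (measurableTypeR R).
Variables (T M A : R) (f : R -> R) (k : R -> R -> R).
Hypotheses (T0 : 0 < T) (M0 : 0 <= M) (A0 : 0 <= A).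
Hypothesis mf : measurable_fun (`[0, T]%classic : set RT) f.
Hypothesis fM : forall t, 0 <= t <= T -> `|f t| <= M.
Hypothesis mk : measurable_fun (square T) (fun p => k p.1 p.2).
Hypothesis kA : forall s, 0 <= s <= T -> (\int[mu]_(t in `[0%R, T]) (`|k t s|)%:E <= A%:E)%E.

Lemma measurable_weighted_kernel : measurable_fun (square T) (fun p => f p.1 * k p.1 p.2).
Proof.
apply: measurable_funM => //.
apply: (measurable_comp (F := `[0, T]%classic : set RT)) => //.
- by move=> _ [p [pT _] <-].
- exact: measurable_funTS.
Qed.

Let msec s : 0 <= s <= T -> measurable_fun (`[0, T]%classic : set RT) (fun t => f t * k t s).
Proof. by move=> sT; apply: measurable_funM => //; exact: measurable_section. Qed.

Let sec_le s : 0 <= s <= T ->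
  (\int[mu]_(t in `[0%R, T]) `|(f t * k t s)%:E| <= (M * A)%:E)%E.
Proof.
move=> sT; have mD := measurable_segment T.
apply: (@le_trans _ _ (\int[mu]_(t in `[0%R, T]) (M%:E * (`|k t s|)%:E))%E).
  apply: ge0_le_integral => //.
  - by apply: measurableT_comp => //; apply/measurable_EFinP; exact: msec.
  - apply/measurable_EFinP; apply: measurable_funM => //.
    by apply: measurableT_comp => //; exact: measurable_section.
  - move=> t /=; rewrite in_itv/= => tT.
    by rewrite lee_fin normrM ler_wpM2r ?fM.
rewrite ge0_integralZl//; last first.
  by apply/measurable_EFinP; apply: measurableT_comp => //; exact: measurable_section.
by rewrite EFinM lee_wpmul2l ?lee_fin// kA.
Qed.

Lemma weighted_kernel_section_integrable s : 0 <= s <= T ->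
  mu.-integrable `[0, T] (fun t => (f t * k t s)%:E).
Proof.
move=> sT; apply/integrableP; split; first by apply/measurable_EFinP; exact: msec.
exact: le_lt_trans (sec_le sT) (ltry _).
Qed.

(** The integral in t is bounded in s, and m is finite. *)
Lemma weighted_kernel_integrable (m : {finite_measure set RT -> \bar R}) :
  (mu \x m)%E.-integrable (square T) (fun p => (f p.1 * k p.1 p.2)%:E).
Proof.
have mD := measurable_segment T.
apply/integrableP; split; first by apply/measurable_EFinP; exact: measurable_weighted_kernel.
rewrite /square rectangle_tonelli21//; last first.
  by apply: measurableT_comp => //; apply/measurable_EFinP; exact: measurable_weighted_kernel.
apply: (@le_lt_trans _ _ (\int[m]_(s in `[0%R, T]) (M * A)%:E)%E).
  apply: ge0_le_integral => //.
  - by move=> s _; exact: integral_ge0.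
  - apply: (@rectangle_tonelli_measurable2 _ _ _ _ _ mu _ _ mD mD
      (fun p => `|(f p.1 * k p.1 p.2)%:E|%E)) => //.
    by apply: measurableT_comp => //; apply/measurable_EFinP; exact: measurable_weighted_kernel.
rewrite [X in (X < _)%E](integral_cst m mD (M * A)%:E).
by rewrite ltey_eq fin_numM// fin_num_measure.
Qed.

Lemma integral_measure_chargeE (nu : {charge set RT -> \bar R}) (psi : R -> R) (c : R) :
  measurable_fun (`[0, T]%classic : set RT) psi -> (forall s, 0 <= s <= T -> `|psi s| <= c) ->
  (forall s, 0 <= s <= T -> \int[mu]_(t in `[0, T]) (f t * k t s) = psi s) ->
  integral_measure_charge mu nu (square T) (fun p => (f p.1 * k p.1 p.2)%:E) =
  (charge_integral nu T psi)%:E.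
Proof.
move=> mpsi psic psiE; have mD := measurable_segment T.
have e (m : {finite_measure set RT -> \bar R}) :
    (\int[mu \x m]_(p in square T) (f p.1 * k p.1 p.2)%:E)%E = (\int[m]_(s in `[0, T]) psi s)%:E.
  rewrite /square rectangle_fubini21//; last exact: weighted_kernel_integrable.
  have i : m.-integrable `[0, T]%classic (EFin \o psi).
    apply: (@bounded_finite_integrable _ _ _ m _ mD psi c mpsi) => s /=.
    by rewrite in_itv/=; exact: psic.
  rewrite /Rintegral fineK; last exact: integrable_fin_num.
  apply: eq_integral => s; rewrite inE/= in_itv/= => sT.
  rewrite -(psiE s sT) /Rintegral fineK//; apply: integrable_fin_num => //.
  exact: weighted_kernel_section_integrable.
by rewrite /integral_measure_charge !e -EFinB.
Qed.

End kernel_fubini.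

Section atoms.
Context {R : realType}.
Local Notation mu := (@lebesgue_measure R).
Local Notation RT := (measurableTypeR R).

(** The diagonal is null for the product of Lebesgue measure and m, Lebesgue
    measure having no atoms; integrated in the other order, this says that
    almost no point is an atom of m. *)
Lemma ae_no_atom (T : R) (m : {finite_measure set RT -> \bar R}) :
  {ae mu, forall t, (`[0, T]%classic : set RT) t -> m [set t] = 0%E}.
Proof.
have mD := measurable_segment T.
pose F (p : RT * RT) : \bar R := ((p.1 == p.2)%:R : R)%:E.
have F0 p : square T p -> (0 <= F p)%E by move=> _; rewrite lee_fin ler0n.
have mF : measurable_fun (square T) F.
  apply/measurable_EFinP.
  rewrite (_ : (fun _ => _) = (fun p : RT * RT => if p.1 == p.2 then 1 else 0)); last first.
    by apply/funext => p; case: ifP.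
  apply: measurable_fun_if => //; first exact: measurable_square.
  by apply: measurable_fun_eqr => //; exact: measurable_funTS.
have atomE (n : {measure set RT -> \bar R}) t : `[0, T]%classic t ->
    (\int[n]_(s in `[0%R, T]) F (s, t))%E = n [set t].
  move=> tT; transitivity (\int[n]_(s in `[0%R, T]) (\1_[set t] s)%:E)%E.
    apply: eq_integral => s _; rewrite /F /= indicE (_ : (s \in _) = (s == t))//.
    by apply/idP/eqP; rewrite inE.
  by rewrite integral_indic// setIidl// => _ ->.
have mI : measurable_fun (`[0, T]%classic : set RT) (fun t => \int[m]_(s in `[0%R, T]) F (s, t))%E.
  exact: (@rectangle_tonelli_measurable2 _ _ _ _ _ m _ _ mD mD F).
have e0 : (\int[m \x mu]_(p in square T) F p = 0)%E.
  rewrite /square rectangle_tonelli12// integral0_eq// => t tT.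
  rewrite -[RHS](lebesgue_measure_set1 t) -(atomE mu t tT).
  by apply: eq_integral => s _; rewrite /F /= eq_sym.
have e : (\int[mu]_(t in `[0%R, T]) \int[m]_(s in `[0%R, T]) F (s, t) = 0)%E.
  by rewrite -e0 /square rectangle_tonelli21.
have : (\int[mu]_(t in `[0%R, T]) `|\int[m]_(s in `[0%R, T]) F (s, t)| = 0)%E.
  rewrite -[RHS]e; apply: eq_integral => t _; rewrite gee0_abs//.
  by apply: integral_ge0 => s sT; rewrite lee_fin ler0n.
move=> /(ae_eq_integral_abs mu mD mI); apply: filterS => t h tT.
by rewrite -(atomE m t tT) h.
Qed.

End atoms.

(** * The difference of the partial derivatives *)

Section hypothesis_A_facts.
Context {R : realType}.
Local Notation mu := (@lebesgue_measure R).
Local Notation RT := (measurableTypeR R).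
Variables (T H C : R) (K : R -> R -> R).
Hypotheses (T0 : 0 < T) (H01 : 0 < H < 1) (hA : hypothesis_A H C T K).
Hypothesis K0 : forall t, 0 <= t <= T -> K t 0 = 0.
Hypothesis continuousK : {within `[0, T] `*` `[0, T],
                    continuous (fun p : R * R => K p.1 p.2)}.
Local Notation k := (pderiv1 T K).
Local Notation kB := (pderiv1 T (covB H)).

Lemma hA_derivable_square t s : 0 < t < T -> 0 <= s <= T -> t != s ->
  derivable (fun u => K u s) t 1.
Proof.
move=> tT sT ts; have [D [h _ _]] := hA_diff hA tT.
by have [] := h s sT; rewrite 1?eq_sym.
Qed.

Lemma pderiv1_axis (L : R -> R -> R) t : 0 < t < T ->
  (forall u, 0 <= u <= T -> L u 0 = 0) -> pderiv1 T L t 0 = 0.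
Proof.
move=> tT L0; rewrite /pderiv1 tT; case: ifP => // _.
rewrite derive1E (@near_eq_derive _ _ _ _ (cst 0)) ?derive_cst//.
have /andP[t0 tT'] := tT.
near=> u; apply: L0; apply/andP; split; apply: ltW.
  by near: u; exact: lt_nbhsr.
by near: u; exact: lt_nbhsl.
Unshelve. all: by end_near. Qed.

Let A := 2 * (T `^ (H - 1 + 1) / (H - 1 + 1)).

Let A0 : 0 <= A.
Proof. by have /andP[h0 h1] := H01; rewrite /A mulr_ge0// divr_ge0 ?powR_ge0//; lra. Qed.

Let H1 : -1 < H - 1. Proof. by have /andP[h0 h1] := H01; lra. Qed.

(** The difference of the two partial derivatives, at a fixed t, vanishes at
    s = 0, so that the bound on its derivative in s, integrable at 0, bounds
    the difference itself. *)
Lemma kernel_difference_density : exists c : R, 0 <= c /\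
  forall t, 0 < t < T -> exists D phi : R -> R,
  [/\ forall s, 0 <= s <= T -> s != t -> D s = k t s - kB t s,
      {within `[0, T], continuous D}, has_density T D phi,
      forall s, 0 <= s <= T -> `|phi s| <= C * (t * s) `^ (H - 1) &
      forall s, 0 <= s <= T -> `|D s| <= c * t `^ (H - 1)].
Proof.
exists (C * A); split=> [|t tT]; first by rewrite mulr_ge0 ?(hA_const hA).
have /andP[t0 _] := tT; have [D [h cD dD]] := hA_diff hA tT.
have C0 := hA_const hA.
pose phi s := if 0 < s < T then derive1 D s else 0.
have phib s : 0 <= s <= T -> `|phi s| <= C * (t * s) `^ (H - 1).
  move=> /andP[s0 sT]; rewrite /phi; case: ifPn => [sT'|_].
    by have [_ ] := dD s sT'; rewrite (@ger0_norm _ (t * s))// mulr_ge0// ltW.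
  by rewrite normr0 mulr_ge0// powR_ge0.
have dphi s : 0 < s < T -> is_derive s 1 D (phi s).
  by move=> sT; have [dDs _] := dD s sT; rewrite /phi sT; exact: is_derive_derive1.
have locb c d : 0 < c -> c < d -> d < T -> exists M, forall x, c <= x <= d -> `|phi x| <= M.
  move=> c0 cd dT; have [N bN] : exists N, forall x, c <= x <= d -> `|x `^ (H - 1)| <= N.
    apply: (@continuous_locally_bounded _ _ 0 (d + 1)) => //; last by rewrite ltrDl.
    by move=> x /andP[x0 _]; apply: is_derive_continuous; exact: is_derive1_powR.
  exists (C * (t `^ (H - 1) * N)) => x xcd.
  have x0 : 0 <= x by lra.
  apply: (le_trans (phib x _)); first by lra.
  rewrite powRM// ?(ltW t0)// ler_wpM2l// ler_wpM2l ?powR_ge0//.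
  exact: le_trans (ler_norm _) (bN x xcd).
pose m s := (C * t `^ (H - 1)) * s `^ (H - 1).
have im : mu.-integrable `[0, T] (EFin \o m).
  exact: (integrableZl (measurable_segment T) (C * t `^ (H - 1)) (powR_integrable T0 H1)).
have phim s : 0 <= s <= T -> `|phi s| <= m s.
  by move=> /[dup] /andP[s0 _] sT; rewrite /m -mulrA -powRM// ?(ltW t0)//; exact: phib.
have mphi : measurable_fun (`[0, T]%classic : set RT) phi.
  have [i _] : mu.-integrable `]0, T[ (EFin \o phi) /\
      (\int[mu]_(x in `]0%R, T[) (phi x)%:E = (D T - D 0)%:E)%E.
    apply: (@dominated_FTC R D phi m 0 T) => //.
      by move=> x /andP[x0 xT]; apply: phim; rewrite !ltW.
    by apply: integrableS im => //; exact: subset_itv_oo_cc.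
  have /integrableP[/measurable_EFinP mo _] := i.
  have -> : `[0, T]%classic = ([set 0] `|` `]0, T[%classic) `|` [set T] :> set R.
    by rewrite setU1itv ?bnd_simp// setUitv1// bnd_simp ltW.
  have mU : measurable ([set 0] `|` `]0, T[%classic : set RT) by exact: measurableU.
  apply/measurable_funU => //; split; last exact: measurable_fun_set1.
  by apply/measurable_funU => //; split => //; exact: measurable_fun_set1.
have dens : has_density T D phi.
  apply: (@dominated_density _ T 0 D phi m) => //.
  - by move=> x xT _; exact: dphi.
  - by move=> c d c0 cd dT _; exact: locb.
exists D, phi; split => //.
  by move=> s sT st; have [_ ->] := h s sT st.
have D0 : D 0 = 0.
  have z0 : (0 : R) <= 0 <= T by apply/andP; split => //; exact: ltW.
  have zt : 0 != t by rewrite lt_eqF.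
  have [_ ->] := h 0 z0 zt.
  rewrite !pderiv1_axis ?subrr//.
  move=> u /andP[u0 _]; rewrite /covB subr0 ger0_norm// powR0 ?addr0 ?subrr ?mulr0//.
  by have /andP[h0 _] := H01; rewrite gt_eqF//; lra.
move=> s /andP[s0 sT]; have [iphi e] := dens.
have := e 0 s (lexx _) s0 sT; rewrite D0 subr0 => ->.
have sub : `[0, s] `<=` `[0, T] by apply: subset_itv; rewrite bnd_simp.
have iphi' : mu.-integrable `[0, s] (EFin \o phi) by apply: integrableS iphi.
have im' : mu.-integrable `[0, s] (EFin \o m) by apply: integrableS im.
apply: (le_trans (le_normr_Rintegral _ iphi')); first exact: measurable_itv.
apply: (@le_trans _ _ (\int[mu]_(x in `[0, s]) m x)).
  apply: le_Rintegral => //; first by move/integrable_abse : iphi'.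
  by move=> x /=; rewrite in_itv/= => /andP[x0 xs]; apply: phim; rewrite x0 (le_trans xs).
rewrite -lee_fin /Rintegral fineK ?integrable_fin_num//.
apply: (@le_trans _ _ (\int[mu]_(x in `[0%R, T]) (m x)%:E)%E).
  apply: ge0_subset_integral => //.
  - by have /integrableP[] := im.
  - by move=> x _; rewrite lee_fin !mulr_ge0 ?powR_ge0.
under eq_integral do rewrite /m EFinM.
rewrite ge0_integralZl//; first last.
- by rewrite lee_fin mulr_ge0// powR_ge0.
- by move=> x _; rewrite lee_fin powR_ge0.
- by apply/measurable_EFinP; apply: measurable_funTS; exact: measurable_powR.
have -> : (C * A * t `^ (H - 1))%:E = ((C * t `^ (H - 1))%:E * A%:E)%E.
  by rewrite -EFinM mulrAC.
by rewrite lee_wpmul2l ?lee_fin ?mulr_ge0 ?powR_ge0//; exact: powR_integral_le.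
Qed.

End hypothesis_A_facts.

(** * The representation by the partial derivative *)

Section hypothesis_A_density.
Context {R : realType}.
Local Notation mu := (@lebesgue_measure R).
Local Notation RT := (measurableTypeR R).
Variables (T H C : R) (K : R -> R -> R).
Hypotheses (T0 : 0 < T) (H01 : 0 < H < 1) (hA : hypothesis_A H C T K).
Hypothesis K0 : forall t, 0 <= t <= T -> K t 0 = 0.
Hypothesis continuousK : {within `[0, T] `*` `[0, T],
                    continuous (fun p : R * R => K p.1 p.2)}.
Local Notation k := (pderiv1 T K).
Local Notation kB := (pderiv1 T (covB H)).

Lemma majorant_continuous c s x : 0 < x -> x != s -> {for x, continuous (majorant H c s)}.
Proof.
move=> x0 xs; have cx al : {for x, continuous (fun u => u `^ al)}.
  by apply: is_derive_continuous; exact: is_derive1_powR.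
have cd al : {for x, continuous (fun u => `|u - s| `^ al)}.
  have [sx|sx] := ltP s x.
    by apply: is_derive_continuous; exact: is_derive_powR_right.
  by apply: is_derive_continuous; apply: is_derive_powR_left; rewrite lt_neqAle xs.
apply: cvgD; apply: cvgM; [exact: cvg_cst|exact: cx|exact: cvg_cst|].
by apply: cvgD; [exact: cx|exact: cd].
Qed.

Lemma majorant_locally_bounded e s c d : 0 <= e -> 0 < c -> c < d -> s < c \/ d < s ->
  exists M, forall x, c <= x <= d -> majorant H e s x <= M.
Proof.
move=> e0 c0 cd sc.
have [M hM] : exists M, forall x, c <= x <= d -> `|majorant H e s x| <= M.
  case: sc => [sc|ds].
    apply: (@continuous_locally_bounded _ _ (Num.max 0 s) (d + 1)) => //.
    - move=> x; rewrite gt_max => /andP[/andP[x0 sx] _].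
      by apply: majorant_continuous => //; rewrite gt_eqF.
    - by rewrite gt_max c0.
    - by rewrite ltrDl.
  apply: (@continuous_locally_bounded _ _ 0 s) => // x /andP[x0 xs].
  by apply: majorant_continuous => //; rewrite lt_eqF.
by exists M => x xcd; exact: le_trans (ler_norm _) (hM x xcd).
Qed.

Lemma pderiv1_out (L : R -> R -> R) t s : ~~ (0 < t < T) -> pderiv1 T L t s = 0.
Proof. by rewrite /pderiv1 => /negbTE ->. Qed.

Lemma pderiv1_diag (L : R -> R -> R) t : pderiv1 T L t t = 0.
Proof. by rewrite /pderiv1 eqxx andbF. Qed.

Lemma pderiv1_difference_le : exists c : R, 0 <= c /\
  forall t s, 0 <= t <= T -> 0 <= s <= T -> `|k t s - kB t s| <= c * t `^ (H - 1).
Proof.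
have [c [c0 h]] := kernel_difference_density T0 H01 hA K0; exists c; split => // t s tT sT.
have r0 : 0 <= c * t `^ (H - 1) by rewrite mulr_ge0 ?powR_ge0.
have [tT'|tT'] := boolP (0 < t < T); last by rewrite !pderiv1_out// subrr normr0.
have [->|st] := eqVneq s t; first by rewrite !pderiv1_diag subrr normr0.
by have [D [phi [DE _ _ _ bD]]] := h t tT'; rewrite -DE// bD.
Qed.

Lemma pderiv1_majorant : exists c : R, 0 <= c /\
  forall t s, 0 <= t <= T -> 0 <= s <= T -> `|k t s| <= majorant H c s t.
Proof.
have [c [c0 h]] := pderiv1_difference_le; exists c; split => // t s tT sT.
have /andP[H0 _] := H01; have /andP[t0 _] := tT.
rewrite -[k t s](subrK (kB t s)); apply: (le_trans (ler_normD _ _)).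
by rewrite lerD ?h// pderiv1_covB_le.
Qed.

Lemma measurable_pderiv1_kernel : measurable_fun (square T) (fun p => k p.1 p.2).
Proof.
apply: measurable_pderiv1 => //; first exact: measurable_continuous_square.
by move=> t s tT sT ts; exact: (hA_derivable_square hA).
Qed.

(** A continuous covariance is recovered from its partial derivative, singular
    at t = 0 and at t = s but dominated there by an integrable function. *)
Lemma kernel_section_density s : 0 <= s <= T -> has_density T (K ^~ s) (k ^~ s).
Proof.
move=> sT; have [c [c0 kc]] := pderiv1_majorant.
apply: (@dominated_density _ T s _ _ (majorant H c s)).
- exact: (kernel_continuous1 continuousK).
- move=> x xT xs; have := hA_derivable_square hA xT sT xs.
  by rewrite /pderiv1 xT xs; exact: is_derive_derive1.
- move=> a b a0 ab bT sab.
  have [M hM] := majorant_locally_bounded c0 a0 ab sab.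
  exists M => x xab; apply: le_trans (hM x xab); apply: kc => //; lra.
- exact: (measurable_section measurable_pderiv1_kernel).
- by move=> x xT; exact: kc.
- have [A [A0 bA]] := majorant_integral_le T0 H01 c0.
  apply/integrableP; split; first by apply/measurable_EFinP; exact: measurable_majorant.
  under eq_integral do rewrite /= ger0_norm ?majorant_ge0//.
  exact: le_lt_trans (bA s sT) (ltry _).
Qed.

Lemma majorized_integral_le c (L : R -> R -> R) : 0 <= c ->
  measurable_fun (square T) (fun p => L p.1 p.2) ->
  (forall t s, 0 <= t <= T -> 0 <= s <= T -> `|L t s| <= majorant H c s t) ->
  exists A : R, 0 <= A /\ forall s, 0 <= s <= T ->
  (\int[mu]_(t in `[0%R, T]) (`|L t s|)%:E <= A%:E)%E.
Proof.
move=> c0 mL Lc; have [A [A0 bA]] := majorant_integral_le T0 H01 c0.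
exists A; split=> // s sT; apply: le_trans (bA s sT); have mD := measurable_segment T.
apply: ge0_le_integral => //.
- apply/measurable_EFinP; apply: measurableT_comp => //.
  exact: (measurable_section mL).
- by apply/measurable_EFinP; exact: measurable_majorant.
- by move=> t /=; rewrite in_itv/= lee_fin => tT; exact: Lc.
Qed.

Lemma pderiv1_integral_le : exists A : R, 0 <= A /\ forall s, 0 <= s <= T ->
  (\int[mu]_(t in `[0%R, T]) (`|k t s|)%:E <= A%:E)%E.
Proof.
have [c [c0 kc]] := pderiv1_majorant.
exact: majorized_integral_le c0 measurable_pderiv1_kernel kc.
Qed.

Lemma measurable_pderiv1_covB : measurable_fun (square T) (fun p => kB p.1 p.2).
Proof.
apply: measurable_pderiv1 => //; first exact: measurable_covB.
by move=> t s /andP[t0 _] _ ts; exact: covB_derivable.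
Qed.

Lemma pderiv1_covB_integral_le : exists A : R, 0 <= A /\ forall s, 0 <= s <= T ->
  (\int[mu]_(t in `[0%R, T]) (`|kB t s|)%:E <= A%:E)%E.
Proof.
have /andP[H0 _] := H01.
apply: (@majorized_integral_le 0) => //; first exact: measurable_pderiv1_covB.
move=> t s /andP[t0 _] _; rewrite /majorant mul0r add0r; exact: pderiv1_covB_le.
Qed.

(** Integration by parts in t at each s, then Fubini's theorem. *)
Lemma inner_dt_nuE f g : bounded_variation 0 T f -> bounded_variation 0 T g ->
  inner_dt_nu T K f g = (charge_integral (nu_ T g) T
    (fun s => charge_integral (nu_ T f) T (fun t => K t s)))%:E.
Proof.
move=> bvf bvg; set I := fun s => charge_integral (nu_ T f) T (K ^~ s).
have cI : {within `[0, T], continuous I} by exact: kernel_charge_integral_continuous.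
have [b [b0 Ib]] := compact_fun_bounded (@segment_compact _ 0 T) cI.
have Ib' s : 0 <= s <= T -> `|I s| <= b by move=> sT; apply: Ib; rewrite /= in_itv.
have mI := measurable_continuous_segment cI.
have [M [M0 fM]] := bounded_variation_bounded T0 bvf.
have [A [A0 kA]] := pderiv1_integral_le.
have mf := bounded_variation_measurable T0 bvf.
rewrite /inner_dt_nu.
rewrite (integral_measure_chargeE M0 mf fM measurable_pderiv1_kernel kA (nu_ T g) (psi := fun s => - I s) (c := b)).
- by rewrite (charge_integralN (nu_ T g) mI Ib') EFinN oppeK.
- exact: measurableT_comp.
- by move=> s sT; rewrite normrN Ib'.
- move=> s sT; rewrite /I (charge_integral_by_parts T0 bvf (kernel_continuous1 continuousK sT) (kernel_section_density sT)).
  by rewrite opprK.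
Qed.

End hypothesis_A_density.

(** * The comparison with fractional Brownian motion *)

Section comparison.
Context {R : realType}.
Local Notation mu := (@lebesgue_measure R).
Local Notation RT := (measurableTypeR R).
Variables (T H C : R) (K : R -> R -> R).
Hypotheses (T0 : 0 < T) (H01 : 0 < H < 1) (hA : hypothesis_A H C T K).
Hypothesis K0 : forall t, 0 <= t <= T -> K t 0 = 0.
Hypothesis continuousK : {within `[0, T] `*` `[0, T],
                    continuous (fun p : R * R => K p.1 p.2)}.
Variables (f g : R -> R).
Hypotheses (bvf : bounded_variation 0 T f) (bvg : bounded_variation 0 T g).
Local Notation k := (pderiv1 T K).
Local Notation kB := (pderiv1 T (covB H)).
Let delta t s := k t s - kB t s.
Let weight t s := `|f t * g s| * (t * s) `^ (H - 1).

Let mD := measurable_segment T.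
Let mf := bounded_variation_measurable T0 bvf.
Let mg := bounded_variation_measurable T0 bvg.
Let mk : measurable_fun (square T) (fun p => k p.1 p.2) := measurable_pderiv1_kernel T0 hA continuousK.
Let mkB : measurable_fun (square T) (fun p => kB p.1 p.2) := measurable_pderiv1_covB H T0.
Let mdelta : measurable_fun (square T) (fun p => delta p.1 p.2).
Proof. exact: measurable_funB. Qed.

Let mweight1 : measurable_fun (square T) (fun p => weight p.1 p.2).
Proof.
apply: measurable_funM.
  apply: measurableT_comp => //; apply: measurable_funM.
    apply: (measurable_comp (F := `[0, T]%classic : set RT)) => //.
    - by move=> _ [p [pT _] <-].
    - exact: measurable_funTS.
  apply: (measurable_comp (F := `[0, T]%classic : set RT)) => //.
  - by move=> _ [p [_ pT] <-].
  - exact: measurable_funTS.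
apply: (measurableT_comp (measurable_powR _)); apply: measurable_funM; exact: measurable_funTS.
Qed.

Let mweight : measurable_fun (square T) (fun p => (C * weight p.1 p.2)%:E).
Proof. by apply/measurable_EFinP; exact: measurable_funM. Qed.

Let weight_ge0 p : (0 <= (C * weight p.1 p.2)%:E)%E.
Proof. by rewrite lee_fin mulr_ge0 ?(hA_const hA)// mulr_ge0 ?powR_ge0. Qed.

Let section_comp (L : R -> R -> R) t : 0 <= t <= T ->
  measurable_fun (square T) (fun p => L p.1 p.2) ->
  measurable_fun (`[0, T]%classic : set RT) (L t).
Proof.
move=> tT mL; apply: (measurable_comp (F := square T) (f := fun p => L p.1 p.2)
   (g := fun s : RT => (t : RT, s))) => //.
- exact: measurable_square.
- by move=> _ [s sT <-]; split => //=; rewrite in_itv.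
- apply: measurable_funTS; apply: measurable_fun_pair; [exact: measurable_cst|exact: measurable_id].
Qed.

Let mdelta_section t : 0 <= t <= T -> measurable_fun (`[0, T]%classic : set RT) (delta t).
Proof. by move=> tT; exact: (section_comp tT mdelta). Qed.

Let mweight_section t : 0 <= t <= T ->
  measurable_fun (`[0, T]%classic : set RT) (fun s => (C * weight t s)%:E).
Proof.
move=> tT; apply/measurable_EFinP; move/measurable_EFinP : mweight => m.
exact: (section_comp (L := fun t s => C * weight t s) tT m).
Qed.

Let weighted_difference_integrable (m : {finite_measure set RT -> \bar R}) :
  (mu \x m)%E.-integrable (square T) (fun p => (f p.1 * delta p.1 p.2)%:E).
Proof.
have [M [M0 fM]] := bounded_variation_bounded T0 bvf.
have [c [c0 dc]] := pderiv1_difference_le T0 H01 hA K0.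
have [A [A0 dA]] : exists A : R, 0 <= A /\ forall s, 0 <= s <= T ->
  (\int[mu]_(t in `[0%R, T]) (`|delta t s|)%:E <= A%:E)%E.
  apply: (majorized_integral_le T0 H01 c0 mdelta) => t s tT sT.
  apply: (le_trans (dc t s tT sT)); rewrite lerDl.
  by have /andP[H0 _] := H01; rewrite mulr_ge0 ?(ltW H0)// addr_ge0 ?powR_ge0.
exact: (weighted_kernel_integrable M0 mf fM mdelta dA).
Qed.

(** Off the atoms of the charge, the value of the difference of the kernels on
    the diagonal is immaterial, and the difference may be replaced by its
    continuous extension, to which integration by parts applies. *)
Lemma section_difference_le t : 0 <= t <= T ->
  charge_pos (nu_ T g) [set t] = 0%E -> charge_neg (nu_ T g) [set t] = 0%E ->
  (`| \int[charge_pos (nu_ T g)]_(s in `[0%R, T]) (f t * delta t s)%:E -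
      \int[charge_neg (nu_ T g)]_(s in `[0%R, T]) (f t * delta t s)%:E | <=
   \int[mu]_(s in `[0%R, T]) (C * weight t s)%:E)%E.
Proof.
move=> tT pt nt.
have [tT'|tT'] := boolP (0 < t < T); last first.
  have z (m : {measure set RT -> \bar R}) : (\int[m]_(s in `[0%R, T]) (f t * delta t s)%:E = 0)%E.
    by apply: integral0_eq => s _; rewrite /delta !pderiv1_out// subrr mulr0.
  by rewrite !z sube0 abse0; apply: integral_ge0 => s _; exact: (weight_ge0 (t, s)).
have [c [c0 /(_ t tT')[D [phi [DE cD dens phib bD]]]]] := kernel_difference_density T0 H01 hA K0.
have mDt := measurable_continuous_segment cD.
have iD (m : {finite_measure set RT -> \bar R}) : m.-integrable `[0, T]%classic (EFin \o D).
  apply: (@bounded_finite_integrable _ _ _ m _ mD D (c * t `^ (H - 1))) => //.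
have e (m : {finite_measure set RT -> \bar R}) : m [set t] = 0%E ->
    (\int[m]_(s in `[0%R, T]) (f t * delta t s)%:E = (f t * \int[m]_(s in `[0, T]) D s)%:E)%E.
  move=> mt; transitivity (\int[m]_(s in `[0%R, T]) (f t * D s)%:E)%E.
    apply: ae_eq_integral => //.
    - by apply/measurable_EFinP; apply: measurable_funM => //; exact: mdelta_section.
    - by apply/measurable_EFinP; exact: measurable_funM.
    - exists [set t]; split => // s /= ns; apply: contrapT => st; apply: ns.
      rewrite in_itv/= => sT; rewrite DE//; exact/eqP.
  rewrite -RintegralZl//; last exact: iD.
  apply/esym; rewrite /Rintegral fineK//.
  apply: integrable_fin_num => //.
  exact: (integrableZl mD (f t) (iD m)).
rewrite !e// -EFinB -mulrBr -/(charge_integral (nu_ T g) T D).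
rewrite (charge_integral_by_parts T0 bvg cD dens).
have [iphi _] := dens.
have [M [M0 gM]] := bounded_variation_bounded T0 bvg.
have /integrableP[/measurable_EFinP mphi _] := iphi.
pose gphi s := g s * phi s.
have igphi : mu.-integrable `[0, T] (EFin \o gphi).
  have iM := integrableZl mD M (integrable_abse iphi).
  apply: le_integrable iM => //; first by apply/measurable_EFinP; exact: measurable_funM.
  move=> s /=; rewrite in_itv/= lee_fin => sT.
  rewrite normrM (ger0_norm (mulr_ge0 _ _))// ler_wpM2r//; exact: gM.
have ifg : mu.-integrable `[0, T] (EFin \o (fun s => f t * gphi s)).
  exact: (integrableZl mD (f t) igphi).
rewrite mulrN -RintegralZl// EFinN abseN.
apply: (@le_trans _ _ (\int[mu]_(s in `[0, T]) `|f t * gphi s|)%:E).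
  by rewrite lee_fin; exact: le_normr_Rintegral.
have /integrableP[/measurable_EFinP mfg _] := ifg.
rewrite /Rintegral fineK; last by apply: integrable_fin_num => //; exact: integrable_abse ifg.
apply: ge0_le_integral => //.
- by apply/measurable_EFinP; exact: measurableT_comp.
- exact: (mweight_section tT).
- move=> s /=; rewrite in_itv/= => sT; rewrite lee_fin /gphi /weight mulrA normrM.
  by rewrite mulrCA ler_wpM2l// phib.
Qed.

(** Fubini's theorem in the order opposite to that of the first formula: the
    bound on the second derivative is used at a fixed t, for almost every t. *)
Lemma difference_bound :
  (`|integral_measure_charge mu (nu_ T g) (square T) (fun p => (f p.1 * delta p.1 p.2)%:E)| <=
   inner2 H C T f g)%E.
Proof.
have idelta := weighted_difference_integrable.
rewrite /integral_measure_charge /square.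
rewrite !(rectangle_fubini12 mD mD (idelta _)).
have i m := rectangle_fubini_integrable mD mD (idelta m).
rewrite -integralB//=; [|exact: i..].
apply: (@le_trans _ _ (\int[mu]_(t in `[0%R, T]) \int[mu]_(s in `[0%R, T]) (C * weight t s)%:E)%E).
  have iB := integrableB mD (i (charge_pos (nu_ T g))) (i (charge_neg (nu_ T g))).
  have /integrableP[mB _] := iB.
  apply: (le_trans (le_abse_integral _ mD mB)).
  apply: ae_ge0_le_integral => //.
  - exact: measurableT_comp.
  - by move=> t _; apply: integral_ge0 => s _; exact: (weight_ge0 (t, s)).
  - exact: (@rectangle_tonelli_measurable1 _ _ _ _ _ mu _ _ mD mD
      (fun p => (C * weight p.1 p.2)%:E)).
  - have := ae_no_atom T (charge_pos (nu_ T g)); have := ae_no_atom T (charge_neg (nu_ T g)).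
    apply: filterS2 => t nt pt tT; apply: section_difference_le; [by []|exact: pt|exact: nt].
have -> : inner2 H C T f g = (\int[mu \x mu]_(p in square T) (C * weight p.1 p.2)%:E)%E.
  rewrite /inner2 -ge0_integralZl//; last by rewrite lee_fin (hA_const hA).
  - exact: measurable_square.
  - exact/measurable_EFinP.
  - by move=> p _; rewrite lee_fin mulr_ge0 ?powR_ge0.
by rewrite /square rectangle_tonelli12.
Qed.

Lemma inner_dt_nu_difference (r : R) : r%:E = inner_dt_nu T K f g ->
  (`|r%:E - inner1 H T f g| <= inner2 H C T f g)%E.
Proof.
move=> ->; have [M [M0 fM]] := bounded_variation_bounded T0 bvf.
have [A [A0 kA]] := pderiv1_integral_le T0 H01 hA K0 continuousK.
have [B [B0 kBB]] := pderiv1_covB_integral_le T0 H01.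
have ik (m : {finite_measure set RT -> \bar R}) := weighted_kernel_integrable M0 mf fM mk kA m.
have ikB (m : {finite_measure set RT -> \bar R}) := weighted_kernel_integrable M0 mf fM mkB kBB m.
have mS := measurable_square T.
have e (m : {finite_measure set RT -> \bar R}) :
    (\int[mu \x m]_(p in square T) (f p.1 * delta p.1 p.2)%:E =
     \int[mu \x m]_(p in square T) (f p.1 * k p.1 p.2)%:E -
     \int[mu \x m]_(p in square T) (f p.1 * kB p.1 p.2)%:E)%E.
  rewrite -integralB//; [|exact: ik|exact: ikB].
  by apply: eq_integral => p _; rewrite -EFinB -mulrBr.
have fin (m : {finite_measure set RT -> \bar R}) L :
    (mu \x m)%E.-integrable (square T) (fun p => (f p.1 * L p.1 p.2)%:E) ->
    exists x : R, (\int[mu \x m]_(p in square T) (f p.1 * L p.1 p.2)%:E)%E = x%:E.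
  move=> i; exists (fine (\int[mu \x m]_(p in square T) (f p.1 * L p.1 p.2)%:E)%E).
  by rewrite fineK// integrable_fin_num.
apply: le_trans difference_bound; rewrite /inner1 /inner_dt_nu /integral_measure_charge !e.
have [a ->] := fin _ _ (ik (charge_pos (nu_ T g))).
have [b ->] := fin _ _ (ik (charge_neg (nu_ T g))).
have [a' ->] := fin _ _ (ikB (charge_pos (nu_ T g))).
have [b' ->] := fin _ _ (ikB (charge_neg (nu_ T g))).
rewrite -!EFinB !abse_EFin lee_fin -normrN.
by rewrite (_ : - _ = a - a' - (b - b'))//; ring.
Qed.

End comparison.

(** * The canonical map on functions of bounded variation *)

Theorem proposition2p1 (R : realType) (d : measure_display)
    (Omega : measurableType d) (P : probability Omega R)
    (T : R) (T_gt0 : 0 < T) (G : R -> {RV P >-> R})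
    (gaussianG : gaussian_process T G)
    (centeredG : centered_process T G)
    (continuousG : continuous_process T G)
    (continuousR : {within `[0, T] `*` `[0, T],
                    continuous (fun p : R * R => cov_fun G p.1 p.2)})
    (E : completeNormedModType R) (ip : E -> E -> R) (iota : (R -> R) -> E)
    (hilbertE : associated_hilbert T G ip iota) :
  exists J : (R -> R) -> E,
    [/\ forall f, bounded_variation 0 T f -> represents T iota f (J f),
        closure [set J f | f in bounded_variation 0 T] = setT,
        forall f g, bounded_variation 0 T f -> bounded_variation 0 T g ->
          ((ip (J f) (J g))%:E =
           integral_charge_charge (nu_ T f) (nu_ T g) (square T)
             (fun p => (cov_fun G p.1 p.2)%:E))%E &
        forall H C : R, 0 < H < 1 -> H != 2^-1 ->
          hypothesis_A H C T (cov_fun G) ->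
          forall f g, bounded_variation 0 T f -> bounded_variation 0 T g ->
            ((ip (J f) (J g))%:E = inner_dt_nu T (cov_fun G) f g)%E /\
            (`|(ip (J f) (J g))%:E - inner1 H T f g| <= inner2 H C T f g)%E].
Proof.
pose J f : E := if pselect (exists h, represents T iota f h) is left h
  then projT1 (cid h) else 0.
have JP f : bounded_variation 0 T f -> represents T iota f (J f).
  move=> bvf; rewrite /J; case: pselect => [h|[]]; first exact: (projT2 (cid h)).
  exact: (represents_exists T_gt0 gaussianG continuousR hilbertE bvf).
exists J; split => //.
- apply/seteqP; split => // h _.
  have : closure [set iota f | f in step_fun T] h by rewrite (ah_dense hilbertE).
  apply: closure_subset => _ [u su <-]; exists u.
    exact: step_fun_bounded_variation.
  apply: represents_unique (JP _ _) _; first exact: step_fun_bounded_variation.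
  exact: (represents_step T_gt0 gaussianG continuousR hilbertE su).
- move=> f g bvf bvg.
  exact: (ip_charge_formula T_gt0 gaussianG continuousR hilbertE bvf bvg (JP f bvf) (JP g bvg)).
- move=> H C H01 _ hA f g bvf bvg.
  have K0 t : 0 <= t <= T -> cov_fun G t 0 = 0.
    by move=> tT; rewrite cov_fun_sym (hA_zero hA).
  have e : (ip (J f) (J g))%:E = inner_dt_nu T (cov_fun G) f g.
    rewrite (inner_dt_nuE T_gt0 H01 hA K0 continuousR bvf bvg).
    by rewrite (ip_represents T_gt0 gaussianG continuousR hilbertE bvf bvg (JP f bvf) (JP g bvg)).
  split => //; exact: (inner_dt_nu_difference T_gt0 H01 hA K0 continuousR bvf bvg e).
Qed.
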